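(* Let $0\le\alpha<1$ and $\beta>2$, let $\Sigma^+_{\alpha,\beta}$ be the $(\alpha$-$\beta)$-shift and let $\sigma\colon\Sigma^+_{\alpha,\beta}\to\Sigma^+_{\alpha,\beta}$ be the shift map. Then $(\Sigma^+_{\alpha,\beta},\sigma)$ is saturated; that is, for every $\sigma$-invariant Borel probability measure $\mu$ on $\Sigma^+_{\alpha,\beta}$, $$h_{\mathrm{top}}(\sigma,G_\mu)=h(\mu),$$ where $G_\mu$ is the set of generic points of $\mu$, $h_{\mathrm{top}}(\sigma,G_\mu)$ is its (Bowen) topological entropy, and $h(\mu)$ is the metric entropy of $\mu$.
   Context: **The $(\alpha$-$\beta)$-shift.** Let $T=T_{\alpha,\beta}\colon[0,1)\to[0,1)$, $T(x)=\beta x+\alpha \pmod 1$. Let $k$ be the smallest integer not less than $\alpha+\beta$, and put $I_1=\left(0,\frac{1-\alpha}{\beta}\right)$, $I_j=\left(\frac{j-1-\alpha}{\beta},\frac{j-\alpha}{\beta}\right)$ for $2\le j\le k-1$, and $I_k=\left(\frac{k-1-\alpha}{\beta},1\right)$. Let $X=\bigcap_{n=0}^\infty T^{-n}\left(\bigcup_{j=1}^kI_j\right)$. For $x\in X$ define $\mathrm{It}(x)\in\{1,\dots,k\}^{\mathbb N}$ ($\mathbb N=\{1,2,\dots\}$) by $\mathrm{It}(x)_i=j$ if $T^{i-1}(x)\in I_j$. The $(\alpha$-$\beta)$-shift is $\Sigma^+_{\alpha,\beta}=\mathrm{cl}\{\mathrm{It}(x):x\in X\}$, the closure being taken in $\{1,\dots,k\}^{\mathbb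 N}$ with the product topology of the discrete topology. It is invariant under the shift $\sigma(\omega_1\omega_2\cdots)=\omega_2\omega_3\cdots$. **Generic points.** For a continuous map $f\colon Y\to Y$ of a compact metric space $(Y,d)$ and an $f$-invariant Borel probability measure $\mu$, $G_\mu=\{x\in Y:\frac1n\sum_{j=0}^{n-1}\delta_{f^j(x)}\to\mu \text{ (weak}^* )\text{ as } n\to\infty\}$. **Topological entropy of a (not necessarily compact) set.** For $n\in\mathbb N$, $x\in Y$, $\epsilon>0$ let $B_n(x,\epsilon)=\{y\in Y:\max_{0\le j\le n-1}d(f^j(x),f^j(y))\le\epsilon\}$. For $Z\subset Y$, $s\in\mathbb R$, $M\in\mathbb N$, $\epsilon>0$ let $$M(Z,s,M,\epsilon)=\inf_\Gamma\sum_{B_{n_i}(x_i,\epsilon)\in\Gamma}e^{-sn_i},$$ the infimum being over all finite or countable covers $\Gamma=\{B_{n_i}(x_i,\epsilon)\}$ of $Z$ with all $n_i\ge M$. Put $M(Z,s,\epsilon)=\lim_{M\to\infty}M(Z,s,M,\epsilon)$, $h_{\mathrm{top}}(f,Z,\epsilon)=\inf\{s:M(Z,s,\epsilon)=0\}=\sup\{s:M(Z,s,\epsilon)=\infty\}$ and $h_{\mathrm{top}}(f,Z)=\lim_{\epsilon\to0}h_{\mathrm{top}}(f,Z,\epsilon)$. On $\Sigma^+_{\alpha,\beta}$ any metric compatible with the topology may be used. **Metric entropy.** $h(\mu)=\lim_{n\to\infty}\frac1n\sum_{w}-\mu[w]\log\mu[w]$, the sum being over all words $w\in\{1,\dots,k\}^n$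 with $[w]=\{x\in\Sigma^+_{\alpha,\beta}:x_i=w_i,\ 1\le i\le n\}\neq\emptyset$ (with $0\log0=0$). *)

(* Defs.v *)
From HB Require Import structures.
From mathcomp Require Import all_boot all_order all_algebra.
From mathcomp Require Import all_classical all_reals all_analysis.
From mathcomp Require Import lra.

Set Implicit Arguments.
Unset Strict Implicit.
Unset Printing Implicit Defensive.

Import Order.TTheory GRing.Theory Num.Theory.
Import numFieldNormedType.Exports.

Local Open Scope classical_set_scope.
Local Open Scope ring_scope.

Definition borel (Y : ptopologicalType) : Type :=
  g_sigma_algebraType (@open Y).

HB.instance Definition _ (Y : ptopologicalType) :=
  Measurable.on (borel Y).

Section GenericPoints.
Context {R : realType} {Y : ptopologicalType}.

Definition invariant_measure (f : Y -> Y) (mu : probability (borel Y) R) :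
    Prop :=
  forall A : set (borel Y), measurable A -> mu (f @^-1` A) = mu A.

(* For n = 0 this is the zero measure (as 0^-1 = 0); only the limit n -> oo is
   ever used. *)
Definition empirical_measure (f : Y -> Y) (x : Y) (n : nat) :
    {measure set (borel Y) -> \bar R} :=
  mscale (n%:R^-1)%:nng (msum (fun j => @dirac _ (borel Y) (iter j f x) R) n).

Definition weak_star_cvg (nu : nat -> {measure set (borel Y) -> \bar R})
    (mu : {measure set (borel Y) -> \bar R}) : Prop :=
  forall g : Y -> R, continuous g ->
    \int[nu n]_y g y @[n --> \oo] --> \int[mu]_y g y.

Definition generic_points (f : Y -> Y) (mu : probability (borel Y) R) :
    set Y :=
  [set x | weak_star_cvg (empirical_measure f x) mu].

End GenericPoints.

Section BowenEntropy.
Context {R : realType}.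

Definition compatible_metric (Y : topologicalType) (d : Y -> Y -> R) : Prop :=
  [/\ forall x y, d x y = 0 <-> x = y,
      forall x y, d x y = d y x,
      forall x y z, d x z <= d x y + d y z &
      forall x (U : set Y), nbhs x U <->
        exists2 e : R, 0 < e & [set y | d x y < e] `<=` U].

Context {Y : choiceType}.
Implicit Types (d : Y -> Y -> R) (f : Y -> Y) (Z : set Y) (s eps : R).

Definition bowen_ball d f (n : nat) (x : Y) eps : set Y :=
  [set y | forall j, (j < n)%N -> d (iter j f x) (iter j f y) <= eps].

(* A cover is encoded by its countable (possibly finite) set of labels
   (x_i, n_i). *)
Definition bowen_cover d f Z (N : nat) eps : set (set (Y * nat)) :=
  [set G | [/\ countable G,
               forall p, G p -> (N <= p.2)%N &
               Z `<=` \bigcup_(p in G) bowen_ball d f p.2 p.1 eps]].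

Definition bowen_premeasure d f Z s (N : nat) eps : \bar R :=
  ereal_inf [set \esum_(p in G) (expR (- s * p.2%:R))%:E
            | G in bowen_cover d f Z N eps].

Definition bowen_measure d f Z s eps : \bar R :=
  limn (fun N => bowen_premeasure d f Z s N eps).

Definition htop_scale d f Z eps : \bar R :=
  ereal_inf [set s%:E | s in [set s : R | bowen_measure d f Z s eps = 0%E]].

Definition htop d f Z : \bar R :=
  lim (htop_scale d f Z eps @[eps --> 0^'+]).

End BowenEntropy.

Section ABShift.
Context {R : realType}.
Implicit Types alpha beta x : R.

(* T is extended to R by the same formula; it maps R into [0, 1[, and only
   orbits starting in ]0, 1[ are considered. *)
Definition ab_map alpha beta x : R :=
  (beta * x + alpha) - (Num.floor (beta * x + alpha))%:~R.

Definition ab_k alpha beta : nat := `|Num.ceil (alpha + beta)|%N.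

Definition ab_itv alpha beta (j : nat) : set R :=
  if j == 1%N then `]0, (1 - alpha) / beta[%classic
  else if j == ab_k alpha beta then `](j%:R - 1 - alpha) / beta, 1[%classic
  else `](j%:R - 1 - alpha) / beta, (j%:R - alpha) / beta[%classic.

Definition ab_X alpha beta : set R :=
  \bigcap_n iter n (ab_map alpha beta) @^-1`
    (\bigcup_(j in [set j | (1 <= j <= ab_k alpha beta)%N]) ab_itv alpha beta j).

(* The element i of 'I_k stands for the letter i.+1 of {1, ..., k}, and the
   coordinate of index i stands for the coordinate i.+1 of a sequence. *)
Definition fullshift (k : nat) : Type :=
  prod_topology (fun _ : nat => discrete_topology 'I_k).

HB.instance Definition _ k := Topological.on (fullshift k).

Definition shift k (w : fullshift k) : fullshift k := fun i => w i.+1.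

(* w = It(x); for x in X there is exactly one such w, as the intervals are
   pairwise disjoint. *)
Definition itinerary alpha beta x (w : fullshift (ab_k alpha beta)) : Prop :=
  forall i, ab_itv alpha beta (w i : 'I__).+1 (iter i (ab_map alpha beta) x).

Definition ab_shift alpha beta : set (fullshift (ab_k alpha beta)) :=
  closure [set w | exists2 x, ab_X alpha beta x & itinerary x w].

Lemma continuous_prod (X : topologicalType) (I : eqType) (K : I -> topologicalType)
  (f : X -> prod_topology K) :
  (forall i, continuous (fun p => f p i : K i)) -> continuous f.
Proof.
move=> cf p; apply/cvg_sup => i.
move: p; apply/(@continuousP _ (initial_topology (@^~ i))) => A [B oB <-].
have -> : f @^-1` (@^~ i @^-1` B) = (fun p => f p i) @^-1` B by [].
by apply: open_comp => // ? _; exact: cf.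
Qed.

Lemma shift_continuous k : continuous (@shift k).
Proof.
apply: (@continuous_prod (fullshift k) nat (fun _ => discrete_topology 'I_k)).
move=> i; exact: (@proj_continuous nat (fun _ => discrete_topology 'I_k) i.+1).
Qed.

Lemma ab_shift_invariant alpha beta (w : fullshift (ab_k alpha beta)) :
  ab_shift w -> ab_shift (shift w).
Proof.
move=> cw B /shift_continuous /cw [v [[x Xx xv] Bv]].
exists (shift v); split => //; exists (ab_map alpha beta x).
  by move=> n _; have := Xx n.+1 I; rewrite /preimage /= -iterSr.
by move=> i; have := xv i.+1; rewrite iterSr.
Qed.

Lemma ab_shift_nonempty alpha beta : 0 <= alpha < 1 -> 2 < beta ->
  exists w, @ab_shift alpha beta w.
Proof.
move=> /andP[a0 a1] b2.
have k3 : (2 < ab_k alpha beta)%N.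
  have c2 : (2 < Num.ceil (alpha + beta))%R by rewrite ceil_gt_int; lra.
  by rewrite /ab_k -ltz_nat gez0_abs //; apply: ltW; exact: lt_trans c2.
have b0 : 0 < beta by lra.
have b1 : 0 < beta - 1 by lra.
pose x := (1 - alpha) / (beta - 1).
have xE : x * (beta - 1) = 1 - alpha by rewrite /x divfK // gt_eqF.
have x0 : 0 < x by rewrite divr_gt0 // subr_gt0.
have x1 : x < 1 by rewrite ltr_pdivrMr //; lra.
have Tx : ab_map alpha beta x = x.
  rewrite /ab_map (_ : beta * x + alpha = x + 1); last by lra.
  by rewrite (@floor_def _ _ 1) ?addrK //; apply/andP; split; lra.
have TxE n : iter n (ab_map alpha beta) x = x by elim: n => //= n ->.
have Ix : ab_itv alpha beta 2 x.
  rewrite /ab_itv /= (ltn_eqF k3) /= in_itv /=; apply/andP; split.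
    by rewrite ltr_pdivrMr //; lra.
  by rewrite ltr_pdivlMr //; lra.
exists (fun=> Ordinal (ltnW k3)); apply: subset_closure; exists x.
  by move=> n _; exists 2; rewrite /= ?TxE // (ltnW k3).
by move=> i; rewrite TxE.
Qed.

End ABShift.

(* The (dummy) dependency on ha and hb is what makes the type provably inhabited,
   as required of a measurable space. *)
Definition ab_space (R : realType) (alpha beta : R)
    (ha : 0 <= alpha < 1) (hb : 2 < beta) : Type :=
  set_type (@ab_shift R alpha beta).

Section ABSpace.
Context {R : realType} {alpha beta : R}.
Context (ha : 0 <= alpha < 1) (hb : 2 < beta).
Local Notation Sigma := (ab_space ha hb).

HB.instance Definition _ := Topological.on Sigma.

Definition ab_point : Sigma :=
  SigSub (mem_set (projT2 (cid (ab_shift_nonempty ha hb)))).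

HB.instance Definition _ := isPointed.Build Sigma ab_point.

Definition ab_sigma (w : Sigma) : Sigma :=
  SigSub (mem_set (ab_shift_invariant (set_mem (valP w)))).

Definition cylinder (n : nat) (w : n.-tuple 'I_(ab_k alpha beta)) : set Sigma :=
  [set x | forall i : 'I_n, (val x : fullshift _) i = tnth w i].

(* 0 log 0 = 0 holds since ln 0 = 0. *)
Definition metric_entropy (mu : probability (borel Sigma) R) : R :=
  limn (fun n => n%:R^-1 *
    \sum_(w : n.-tuple 'I_(ab_k alpha beta) | `[< cylinder w !=set0 >])
      (- fine (mu (cylinder w)) * ln (fine (mu (cylinder w))))).

End ABSpace.

Arguments ab_sigma {R alpha beta} ha hb w.

(* Main.v *)
(** The points whose itinerary starts with a word [w] are mapped by T^n onto an
    interval, and [w] is called full when this interval is ]0, 1[; full words can be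
    concatenated freely.

    Lower bound. For every [eta], a word [w] of the shift splits into at most [eta
    |w|] + O(1) pieces, each of which becomes full when boundedly many letters are
    appended, or becomes a loop (a word all of whose powers are admissible) when the
    last letter is changed, or is a single letter. Indeed beta > 2 makes short image
    intervals grow until they contain a branch point, and moving to the other side
    of the branch point at the end of a run that has not been cut before makes the
    run repeatable. Take long words, distributed according to the measure of
    cylinders, keep the full pieces in their order and gather the loops, which carry
    little entropy, as powers at the end: this gives exp(n(h - e)) full words of
    equal length n with almost the right frequencies. Concatenating such families
    with e -> 0 gives a tree of generic points, and a cover of too small weight is
    avoided by descending in this tree so that the remaining weight never grows.

    Upper bound. A word with the right frequencies of (r+1)-blocks has mass at least
    exp(-n(H_(r+1) - H_r + e)) for a suitable Markov measure of order r, hence there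
    are few such words; averaging over r bounds the entropy by H_n / n. *)

Require Import Defs.
From HB Require Import structures.
From mathcomp Require Import all_boot all_order all_algebra.
From mathcomp Require Import all_classical all_reals all_analysis.
From mathcomp Require Import zify ring lra.

Set Implicit Arguments.
Unset Strict Implicit.
Unset Printing Implicit Defensive.

Import Order.TTheory GRing.Theory Num.Theory.
Import numFieldNormedType.Exports.

Local Open Scope classical_set_scope.
Local Open Scope ring_scope.

(** * Words and their image intervals *)

(** The obstacle is the lack of a specification property: a word with a very short image interval
    may need arbitrarily many letters to become full. Loops circumvent this. A loop can be almost as
    long as the word it comes from, so dropping it would spoil the frequencies, and completing it at
    each occurrence would cost too much. But for a fixed word length only finitely many loops arise,
    and the completion of a power of a loop has a length independent of the exponent. When all
    copies of a loop are gathered in one power, the completions together cost a bounded number of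
    letters while the number of words tends to infinity. Loops carry little entropy because an uncut
    run is determined by its length and its uncut side, so that a few marks per word recover all of
    them. The hypothesis beta > 2 enters as [be / 2 > 1]: an image interval is stretched by [be],
    and the better of two branches keeps at least half of it. *)

Section Words.
Variable T : finType.
Implicit Types (u v w : seq T) (c : T).

Fixpoint words n : seq (seq T) :=
  if n is n'.+1 then [seq c :: w | c <- enum T, w <- words n'] else [:: [::]].

Lemma mem_words n w : (w \in words n) = (size w == n).
Proof.
elim: n w => [|n IHn] [|c w] //=.
  by apply/allpairsPdep => -[? [? []]].
rewrite eqSS -IHn; apply/allpairsPdep/idP => [[c' [w' [_ w'n [_ ->]]]]//|wn].
by exists c, w; rewrite mem_enum.
Qed.

Lemma size_words n : size (words n) = (#|T| ^ n)%N.
Proof. by elim: n => //= n IHn; rewrite size_allpairs IHn expnS cardE. Qed.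

Lemma uniq_words n : uniq (words n).
Proof.
elim: n => //= n IHn; apply: allpairs_uniq; rewrite ?enum_uniq //.
by move=> [? ?] [? ?] _ _ /= [-> ->].
Qed.

(** Finiteness of the set of words of length at most [n]. Applied to [siz], it says that a word with
    a positive but very short image must be long. *)
Lemma words_ge0_min (R : realType) (f : seq T -> R) n :
  exists2 e : R, 0 < e & forall w, (size w <= n)%N -> 0 < f w -> e <= f w.
Proof.
have min_seq (s : seq (seq T)) :
    exists2 e : R, 0 < e & forall w, w \in s -> 0 < f w -> e <= f w.
  elim: s => [|w s [e e0 es]]; first by exists 1.
  have [fw|fw] := ltP 0 (f w).
    exists (Num.min e (f w)); first by rewrite lt_min e0.
    move=> v; rewrite inE => /predU1P[-> _|/es vs /vs]; rewrite ge_min ?lexx ?orbT //.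
    by move=> ->.
  exists e => // v; rewrite inE => /predU1P[->|/es //].
  by rewrite ltNge fw.
elim: n => [|n [e e0 IHn]].
  have [e e0 es] := min_seq [:: [::]].
  by exists e => // w; rewrite leqn0 size_eq0 => /eqP ->; apply: es; rewrite inE.
have [e' e'0 e's] := min_seq (words n.+1).
exists (Num.min e e'); first by rewrite lt_min e0.
move=> w; rewrite leq_eqVlt => /orP[wn|/IHn wn] fw; rewrite ge_min.
  by rewrite e's ?orbT // mem_words.
by rewrite wn.
Qed.

End Words.

(** Restricts [case_minmax] to the innermost [max] and [min], so that every comparison it introduces
    is linear and usable by [lra]. *)
Ltac flat x :=
  lazymatch x with
  | context [Order.max _ _] => fail
  | context [Order.min _ _] => fail
  | _ => idtac
  end.

Ltac case_minmax :=
  repeat match goal with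
  | |- context [Order.max ?x ?y] => flat x; flat y; case: (leP x y) => ?
  | |- context [Order.min ?x ?y] => flat x; flat y; case: (leP x y) => ?
  end.

Section Branches.
Context {R : realType} {k : nat}.
Variables al be : R.
Implicit Types (u v w S : seq 'I_k) (c : 'I_k) (s t : R).

(* The points whose itinerary starts with [w] form an interval that T^n maps
   affinely onto ]lft 0 w, rgt 1 w[; [aff] is the same recursion without the
   truncation to [0, 1]. *)
Definition lft t w := foldl (fun t c => Num.max 0 (be * t + al - (c : nat)%:R)) t w.
Definition rgt t w := foldl (fun t c => Num.min 1 (be * t + al - (c : nat)%:R)) t w.
Definition aff t w := foldl (fun t c => be * t + al - (c : nat)%:R) t w.

Definition siz w := rgt 1 w - lft 0 w.
Definition full w := lft 0 w = 0 /\ rgt 1 w = 1.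
(* Every power of a loop is completed to a full word by boundedly many letters. *)
Definition loop w := exists2 x : R, 0 < x &
  forall m, x <= siz (flatten (nseq m w)).

Lemma lft_cat t u v : lft t (u ++ v) = lft (lft t u) v.
Proof. exact: foldl_cat. Qed.
Lemma rgt_cat t u v : rgt t (u ++ v) = rgt (rgt t u) v.
Proof. exact: foldl_cat. Qed.
Lemma aff_cat t u v : aff t (u ++ v) = aff (aff t u) v.
Proof. exact: foldl_cat. Qed.
Lemma lft_rcons t u c :
  lft t (rcons u c) = Num.max 0 (be * lft t u + al - (c : nat)%:R).
Proof. by rewrite -cats1 lft_cat. Qed.
Lemma rgt_rcons t u c :
  rgt t (rcons u c) = Num.min 1 (be * rgt t u + al - (c : nat)%:R).
Proof. by rewrite -cats1 rgt_cat. Qed.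
Lemma aff_rcons t u c :
  aff t (rcons u c) = be * aff t u + al - (c : nat)%:R.
Proof. by rewrite -cats1 aff_cat. Qed.

Definition params := [/\ 0 <= al < 1, 2 < be, al + be <= k%:R & k%:R < al + be + 1].

Hypothesis hp : params.

Local Ltac param := have [/andP[? ?] ? ? ?] := hp.

Lemma full_cat u v : full u -> full v -> full (u ++ v).
Proof. by move=> [lu ru] [lv rv]; rewrite /full lft_cat rgt_cat lu ru. Qed.

Lemma full_flatten (ws : seq (seq 'I_k)) :
  (forall w, w \in ws -> full w) -> full (flatten ws).
Proof.
elim: ws => [|w ws IH] // H; apply: full_cat; first by apply: H; rewrite inE eqxx.
by apply: IH => v vs; apply: H; rewrite inE vs orbT.
Qed.

Lemma lft_ge0 t w : 0 <= t -> 0 <= lft t w.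
Proof. by elim/last_ind: w => // w c _ _; rewrite lft_rcons le_max lexx. Qed.

Lemma rgt_le1 t w : t <= 1 -> rgt t w <= 1.
Proof. by elim/last_ind: w => // w c _ _; rewrite rgt_rcons ge_min lexx. Qed.

Lemma affB s t w : aff t w - aff s w = be ^+ size w * (t - s).
Proof.
elim/last_ind: w => [|w c IH]; first by rewrite mul1r.
by rewrite !aff_rcons size_rcons exprS -mulrA -IH; ring.
Qed.

(** As [be > 0], a truncation commutes with the later steps, so [t |-> lft t w] is the maximum of a
    constant and an affine map. Together with [rgtE] this computes images of subintervals, as needed
    to recognize loops. *)
Lemma lftE t w : 0 <= t -> lft t w = Num.max (lft 0 w) (aff t w).
Proof.
param.
move=> t0; elim/last_ind: w => [|w c IH] /=; first by rewrite max_r.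
have b0 : 0 < be by lra.
rewrite !lft_rcons aff_rcons IH; case: (leP (lft 0 w)) => [|/ltW] h;
  by move: h; rewrite -(ler_pM2l b0) => h; case_minmax; lra.
Qed.

Lemma rgtE t w : t <= 1 -> rgt t w = Num.min (rgt 1 w) (aff t w).
Proof.
param.
move=> t0; elim/last_ind: w => [|w c IH] /=; first by rewrite min_r.
have b0 : 0 < be by lra.
rewrite !rgt_rcons aff_rcons IH; case: (leP (rgt 1 w)) => [|/ltW] h;
  by move: h; rewrite -(ler_pM2l b0) => h; case_minmax; lra.
Qed.

Lemma lft_homo s t w : s <= t -> lft s w <= lft t w.
Proof.
param.
move=> st; elim/last_ind: w => [|w c IH] //.
by rewrite !lft_rcons ge_max !le_max lexx /=; apply/orP; right; nra.
Qed.

Lemma rgt_homo s t w : s <= t -> rgt s w <= rgt t w.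
Proof.
param.
move=> st; elim/last_ind: w => [|w c IH] //.
by rewrite !rgt_rcons le_min !ge_min lexx /=; apply/orP; right; nra.
Qed.

Lemma aff_le_lft t w : aff t w <= lft t w.
Proof.
param.
elim/last_ind: w => [|w c IH] //.
by rewrite lft_rcons aff_rcons le_max; apply/orP; right; nra.
Qed.

Lemma lt_prefix s t u v : lft s (u ++ v) < rgt t (u ++ v) -> lft s u < rgt t u.
Proof.
param.
elim/last_ind: v => [|v c IH]; first by rewrite cats0.
rewrite -rcons_cat lft_rcons rgt_rcons => h; apply: IH; move: h.
by rewrite lt_min !gt_max => /andP[_ /andP[_ h]]; nra.
Qed.

Lemma siz_prefix u v : 0 < siz (u ++ v) -> 0 < siz u.
Proof. by rewrite !subr_gt0; exact: lt_prefix. Qed.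

Lemma siz_suffix u v : siz (u ++ v) <= siz v.
Proof.
rewrite /siz lft_cat rgt_cat lerB //; first by rewrite rgt_homo // rgt_le1.
by rewrite lft_homo // lft_ge0.
Qed.

Lemma siz_le1 w : siz w <= 1.
Proof.
param.
by have := @rgt_le1 1 w (lexx _); have := @lft_ge0 0 w (lexx _); rewrite /siz; lra. Qed.

Lemma letter_exists s : 0 <= s < k%:R -> exists2 c : 'I_k, c%:R <= s & s < c%:R + 1.
Proof.
move=> /andP[s0 sk]; have fs := floor_itv s.
have f0 : 0 <= Num.floor s by rewrite floor_ge0.
have fE : (`|Num.floor s|%N)%:R = (Num.floor s)%:~R :> R.
  by rewrite natr_absz ger0_norm.
have fk : (`|Num.floor s| < k)%N.
  by rewrite -(ltr_nat R) fE; case/andP: fs => h _; exact: le_lt_trans sk.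
exists (Ordinal fk) => /=; rewrite fE; case/andP: fs => // _.
by rewrite intrD.
Qed.

Lemma le_clip (m x y : R) : m <= 1 -> m <= 1 - y -> m <= x -> m <= x - y ->
  m <= Num.min 1 x - Num.max 0 y.
Proof. by case_minmax; lra. Qed.

(* Either the image of the interval contains a whole branch, or it meets at
   most two branches, one of which gets at least half of the image. *)
Lemma grow1 s t : 0 <= s -> s < t -> t <= 1 -> exists c : 'I_k,
  Num.min 1 (be / 2 * (t - s)) <=
  Num.min 1 (be * t + al - c%:R) - Num.max 0 (be * s + al - c%:R).
Proof.
param.
move=> s0 st t1.
have -> : be / 2 * (t - s) = (be * t - be * s) / 2 by field.
have [s0' t1'] : 0 <= be * s /\ be * t <= be by split; nra.
have : be * s < be * t by rewrite ltr_pM2l //; lra.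
move: (be * s) (be * t) s0' t1' => {s0 t1 st}s {}t s0 t1 st.
have [|c c1 c2] := @letter_exists (s + al); first by apply/andP; split; lra.
set m := Num.min 1 _; have m1 : m <= 1 by rewrite ge_min lexx.
have : m <= (t - s) / 2 by rewrite ge_min lexx orbT.
move: m m1 => m m1 m2.
have [h|h] := leP (t + al) (c%:R + 1); first by exists c; apply: le_clip; lra.
have ck : (c.+1 < k)%N.
  by rewrite -(ltr_nat R) -natr1; apply: lt_le_trans h _; lra.
have [h2|h2] := leP m (c%:R + 1 - (s + al)).
  by exists c; apply: le_clip; lra.
by exists (Ordinal ck); rewrite /= -[c.+1%:R]natr1; apply: le_clip; lra.
Qed.

Lemma grow n s t : 0 <= s -> s < t -> t <= 1 -> exists2 v : seq 'I_k,
  size v = n & Num.min 1 ((be / 2) ^+ n * (t - s)) <= rgt t v - lft s v.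
Proof.
param.
move=> s0 st t1; elim: n => [|n [v vn IH]].
  by exists [::] => //; rewrite mul1r ge_min lexx orbT.
have p0 : 0 < (be / 2) ^+ n by rewrite exprn_gt0 //; lra.
have lv0 := lft_ge0 v s0; have rv1 := rgt_le1 v t1.
have v0 : lft s v < rgt t v.
  by rewrite -subr_gt0; apply: lt_le_trans IH; rewrite lt_min ltr01 mulr_gt0 // subr_gt0.
have [c hc] := grow1 lv0 v0 rv1.
exists (rcons v c); rewrite ?size_rcons ?vn // lft_rcons rgt_rcons.
apply: le_trans hc; rewrite le_min ge_min lexx /=; move: IH.
rewrite exprS -mulrA !ge_min => /orP[h|h]; apply/orP; [left|right]; first nra.
by rewrite ler_pM2l //; lra.
Qed.

(** Lengths grow by the factor [be / 2 > 1] until they reach 1, and a full interval can be kept full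
    afterwards; hence exactly [K] letters suffice for all [w] at once. *)
Lemma full_completion (e : R) : 0 < e -> exists K, forall w, e <= siz w ->
  exists2 v : seq 'I_k, size v = K & full (w ++ v).
Proof.
param.
move=> e0; have [K hK] : exists K : nat, 1 <= (be / 2) ^+ K * e.
  have h1 : `|(be / 2)^-1| < 1.
    by rewrite ger0_norm ?invr_ge0 ?invf_lt1; lra.
  have /cvgrPdist_lt /(_ e e0) [N _ HN] := cvg_expr h1.
  exists N; have := HN N (leqnn _); rewrite /= sub0r normrN ger0_norm; last first.
    by rewrite exprn_ge0 // invr_ge0; lra.
  have p0 : 0 < (be / 2) ^+ N by rewrite exprn_gt0 //; lra.
  by rewrite exprVn -[_^-1]mul1r ltr_pdivrMr // mulrC => /ltW.
exists K => w ew; have l0 := @lft_ge0 0 w (lexx _); have r1 := @rgt_le1 1 w (lexx _).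
have [|v vK hv] := @grow K (lft 0 w) (rgt 1 w) l0 _ r1.
  by rewrite -subr_gt0; exact: lt_le_trans ew.
exists v => //; rewrite /full lft_cat rgt_cat.
have lv := lft_ge0 v l0; have rv := rgt_le1 v r1.
suff : 1 <= rgt (rgt 1 w) v - lft (lft 0 w) v by move=> h; split; lra.
apply: le_trans hv; rewrite le_min lexx /=; apply: le_trans hK _.
by rewrite ler_pM2l ?exprn_gt0 //; lra.
Qed.

(** A truncation is never undone: each further letter multiplies the difference between [lft] and
    [aff] at least by [be]. *)
Lemma aff0_prefix u v : lft 0 (u ++ v) = aff 0 (u ++ v) -> lft 0 u = aff 0 u.
Proof.
param.
elim/last_ind: v => [|v c IH]; first by rewrite cats0.
rewrite -rcons_cat lft_rcons aff_rcons => h; apply: IH.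
have := aff_le_lft 0 (u ++ v); move: h; case_minmax => h1 h2; nra.
Qed.

(* The left end of an uncut run determines every letter of the run. *)
Lemma aff0_inj u v : size u = size v -> 0 < siz u -> 0 < siz v ->
  lft 0 u = aff 0 u -> lft 0 v = aff 0 v -> u = v.
Proof.
param.
elim/last_ind: u v => [|u c IH] v; first by case: v.
case: (lastP v) => [|{}v d]; first by rewrite size_rcons.
rewrite !size_rcons => -[uv]; rewrite -!cats1 => su sv lu lv.
have E : u = v.
  by apply: IH; [|exact: siz_prefix su|exact: siz_prefix sv
    |exact: aff0_prefix lu|exact: aff0_prefix lv].
subst v; congr (_ ++ [:: _]); apply: val_inj => /=.
have l1 w : 0 < siz w -> 0 <= lft 0 w < 1.
  by have := rgt_le1 w (lexx 1); have := lft_ge0 w (lexx 0); rewrite /siz; lra.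
have := l1 _ su; have := l1 _ sv; rewrite lu lv !aff_cat /=.
set z := be * _ + al => h1 h2; apply/eqP; rewrite eqn_leq -(ltnS c) -(ltnS d) -!(ltr_nat R) -!natr1.
by apply/andP; split; lra.
Qed.

End Branches.

Arguments params {R} k al be.

(** * Full pieces, loops and single letters *)

Section Pieces.
Context {R : realType} {k : nat}.
Variables al be : R.
Implicit Types (u v w S : seq 'I_k) (c d : 'I_k) (s t : R).

(** [true] stands for the right end of the image interval, [false] for the left one. *)
Definition uncut (b : bool) S :=
  if b then rgt al be 1 S = aff al be 1 S
  else lft al be 0 S = aff al be 0 S.

(* The tag of a piece is [None] for a discarded letter, [Some None] for a piece
   that becomes full by appending [K] letters, and [Some (Some right)] for a
   piece that becomes a loop by changing its last letter. *)
Definition piece : Type := (seq 'I_k * option (option bool))%type.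

Definition good_piece K (p : piece) := p.1 <> [::] /\
  match p.2 with
  | None => size p.1 = 1%N
  | Some None => exists2 v, size v = K & full al be (p.1 ++ v)
  | Some (Some b) => exists S c c', [/\ p.1 = rcons S c, 0 < siz al be S,
      uncut b S & loop al be (rcons S c')]
  end.

(** Bounds the letters changed, appended or dropped. The extra 1 in [K.+1] makes every cost
    positive, so that the total cost also bounds the number of pieces. *)
Definition cost K (p : piece) := if p.2 is Some None then K.+1 else 1%N.

Definition word_of (ps : seq piece) := flatten (map fst ps).

Definition thin (ps : seq piece) :=
  forall p, p \in ps -> p.2 <> Some None /\ forall K, good_piece K p.

Lemma thin_cat ps qs : thin ps -> thin qs -> thin (ps ++ qs).
Proof. by move=> H1 H2 p; rewrite mem_cat => /orP[/H1|/H2]. Qed.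

Lemma thin_letters w : thin [seq ([:: c], None) | c <- w].
Proof. by move=> p /mapP[c _ ->]. Qed.

Lemma word_of_letters w : word_of [seq ([:: c], None) | c <- w] = w.
Proof. by rewrite /word_of; elim: w => //= c w ->. Qed.

Lemma word_of_cat ps qs : word_of (ps ++ qs) = word_of ps ++ word_of qs.
Proof. by rewrite /word_of map_cat flatten_cat. Qed.

Hypothesis hp : params k al be.

Local Ltac param := have [/andP[? ?] ? ? ?] := hp.
Local Notation lft := (lft al be).
Local Notation rgt := (rgt al be).
Local Notation aff := (aff al be).
Local Notation siz := (siz al be).

(** The interval ]s, t[ lies in its own image under [u], hence in its image under every power of
    [u]. *)
Lemma loop_of s t u : 0 <= s -> s < t -> t <= 1 ->
  lft s u <= s -> t <= rgt t u -> loop al be u.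
Proof.
move=> s0 st t1 su tu; exists (t - s); rewrite ?subr_gt0 // => m.
have {}su : lft s (flatten (nseq m u)) <= s.
  elim: m => //= m IH; rewrite lft_cat; apply: le_trans IH.
  exact: (lft_homo hp).
have {}tu : t <= rgt t (flatten (nseq m u)).
  elim: m {su} => //= m IH; rewrite rgt_cat; apply: le_trans IH _.
  exact: (rgt_homo hp).
apply: lerB.
  by apply: le_trans tu _; exact: (rgt_homo hp).
by apply: le_trans _ su; exact: (lft_homo hp).
Qed.

Lemma last_right_cut S : 0 < siz S -> uncut true S \/
  exists S1 c S2, [/\ S = rcons S1 c ++ S2, uncut true S2,
    rgt 1 (rcons S1 c) = 1 & 1 < be * rgt 1 S1 + al - (c : nat)%:R].
Proof.
elim/last_ind: S => [|S d IH] sS; first by left.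
have [h|h] := ltP 1 (be * rgt 1 S + al - (d : nat)%:R).
  right; exists S, d, [::]; rewrite cats0; split=> //.
  by rewrite rgt_rcons min_l // ltW.
have {}sS : 0 < siz S by rewrite -cats1 in sS; exact: (siz_prefix hp sS).
have [uS|[S1 [c [S2 [SE u2 r1 c1]]]]] := IH sS.
  by left; rewrite /uncut rgt_rcons aff_rcons -uS min_r.
right; exists S1, c, (rcons S2 d); rewrite SE rcons_cat; split=> //.
rewrite /uncut rgt_rcons aff_rcons -u2 min_r //.
by move: h; rewrite SE rgt_cat r1.
Qed.

Lemma uncut_siz S : uncut false S -> uncut true S -> siz S = be ^+ size S.
Proof. by rewrite /siz => -> ->; rewrite affB subr0 mulr1. Qed.

Lemma uncut_prefix u v : uncut false (u ++ v) -> uncut false u.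
Proof. exact: aff0_prefix. Qed.

(* When the left end is not cut along [S] and the image of the interval of [S]
   crosses an integer, that integer cuts it in lengths [y] and [x].  If [x] is
   not much smaller than [y], moving right at the end of [S] gives a loop.
   Otherwise the part of [S] after its last right cut is a loop, and one recurses
   on the part before. *)
Lemma uncut_pieces J1 : exists J0 : nat, forall S c c0, uncut false S -> 0 < siz S ->
  c0%:R <= be * lft 0 S + al < c0%:R + 1 -> c0%:R + 1 < be * rgt 1 S + al ->
  exists ps, [/\ word_of ps = rcons S c, thin ps &
    (J1 * size ps <= (size S).+1 + J1 * J0)%N].
Proof.
param.
(* [th] and [J0] are tuned to the recursion: for a run of length at least [J0] that yields no loop,
   [x] is below [th], and then the part split off has at least [J1] letters. So each new piece is
   paid for by [J1] letters. *)
have [th th0 thP] := words_ge0_min (siz : seq 'I_k -> R) J1.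
have [J0 [J01 J0J1 J0P]] : exists J0 : nat, [/\ (0 < J0)%N, (J1 <= J0)%N &
    forall n, (J0 <= n)%N -> 1 < th * (be ^+ n - 1)].
  have h1 : `|be^-1| < 1 by rewrite ger0_norm ?invr_ge0 ?invf_lt1; lra.
  have /cvgrPdist_lt /(_ (th / (th + 1))) [|N _ HN] := cvg_expr h1.
    by rewrite divr_gt0 //; lra.
  exists (N + J1).+1; split=> [||n Nn]; [by []|exact/leqW/leq_addl|].
  have {}HN : `|0 - be^-1 ^+ n| < th / (th + 1) by apply: HN; rewrite /=; clear -Nn; lia.
  have b0 : 0 <= be^-1 by rewrite invr_ge0; lra.
  move: HN; rewrite sub0r normrN ger0_norm ?exprn_ge0 //.
  have p0 : 0 < be ^+ n by rewrite exprn_gt0 //; lra.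
  rewrite exprVn -[_^-1]mul1r ltr_pdivrMr // mulrAC ltr_pdivlMr; last lra.
  by rewrite mul1r; lra.
exists J0 => S; have [n Sn] := ubnP (size S); elim: n S Sn => // n IH S Sn c c0.
move=> uS sS /andP[c01 c02] c03.
have [jJ|jJ] := leqP (size S).+1 J0.
  exists [seq ([:: c], None) | c <- rcons S c]; rewrite word_of_letters size_map size_rcons.
  split; [by []|exact: thin_letters|].
  by have := leq_mul (leqnn J1) jJ; clear; lia.
have be0 : 0 < be by lra.
have l0 := lft_ge0 al be S (lexx 0); have r1 := rgt_le1 al be S (lexx 1).
have ck : (c0.+1 < k)%N.
  by rewrite -(ltr_nat R) -[c0.+1%:R]natr1; apply: lt_le_trans c03 _; nra.
pose c1 := Ordinal ck; have c1E : c1%:R = c0%:R + 1 :> R by rewrite natr1.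
pose x := rgt 1 (rcons S c1); pose y := c1%:R - (be * lft 0 S + al).
have [y0 y1] : 0 < y /\ y <= 1 by rewrite /y c1E; lra.
have x0 : 0 < x by rewrite /x rgt_rcons lt_min ltr01 /= c1E; lra.
have x1 : x <= 1 by rewrite /x rgt_le1.
have P1 (n' : nat) : (0 < n')%N -> 2 < be ^+ n'.
  case: n' => // n' _; rewrite exprS.
  have : 1 <= be ^+ n' by apply: exprn_ege1; lra.
  by nra.
have aE : lft 0 S = aff 0 S := uS.
(* With last letter [c1], [aff] sends 0 to [- y] and [x] to [be ^+ (size S).+1 * x - y]; the first
   case says that this is at least [x], so ]0, x[ gives a loop. *)
have [h|h] := leP y ((be ^+ (size S).+1 - 1) * x).
  exists [:: (rcons S c, Some (Some false))]; split; first by rewrite /word_of /= cats0.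
    move=> p; rewrite inE => /eqP ->; split=> // K; split; first by case: (S).
    exists S, c, c1; split=> //; apply: (@loop_of 0 x) => //.
      by rewrite lft_rcons ge_max lexx /=; move: y0; rewrite /y; lra.
    rewrite (rgtE hp) // -/x le_min lexx /=.
    have := affB al be 0 x (rcons S c1); rewrite size_rcons (aff_rcons _ _ 0) -aE.
    by move: h; rewrite /y; lra.
  by rewrite /= muln1; clear -jJ J0J1; lia.
have hx : 1 < th * (be ^+ (size S).+1 - 1) by apply: J0P; clear -jJ; lia.
have x_th : x < th by have := P1 (size S).+1 isT; nra.
have {}x1 : x < 1 by have := P1 (size S).+1 isT; nra.
have xE : x = be * rgt 1 S + al - c1%:R.
  by move: x1; rewrite /x rgt_rcons; clear; case_minmax; lra.
(* A nonempty run uncut on both sides would have image length [be ^+ size S > 1], so there is a last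
   right cut. That cut of [S1] by [d] is the crossing required by the induction hypothesis. *)
have [uS'|[S1 [d [S2 [SE u2 rd d1]]]]] := last_right_cut sS.
  have := siz_le1 hp S; rewrite uncut_siz //; case: (posnP (size S)) => [S0|/P1]; last lra.
  by move: jJ; rewrite S0; clear -J01; lia.
have rS : rgt 1 S = rgt 1 S2 by rewrite SE rgt_cat rd.
have lS : lft 0 S2 <= lft 0 S.
  by rewrite SE lft_cat; apply: (lft_homo hp); exact: lft_ge0.
have blS : be * lft 0 S2 <= be * lft 0 S by rewrite ler_pM2l.
have us1 : uncut false S1 by move: uS; rewrite SE -cats1 -catA => /uncut_prefix.
have usd : uncut false (rcons S1 d) by move: uS; rewrite SE => /uncut_prefix.
have s1 : 0 < siz S1 by move: sS; rewrite SE -cats1 -catA => /(siz_prefix hp).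
have s2 : 0 < siz S2 by apply: lt_le_trans sS _; rewrite SE; exact: (siz_suffix hp).
have sd : 0 < siz (rcons S1 d) by move: sS; rewrite SE => /(siz_prefix hp).
have dE : lft 0 (rcons S1 d) = be * lft 0 S1 + al - d%:R.
  by rewrite usd aff_rcons us1.
have [|||ps [psE pst pss]] := IH S1 _ d d us1 s1.
- by move: Sn; rewrite SE size_cat size_rcons; clear; lia.
- have := lft_ge0 al be (rcons S1 d) (lexx 0); move: sd; rewrite /siz rd dE.
  by clear => ? ?; apply/andP; split; lra.
- by lra.
exists (rcons ps (rcons S2 c, Some (Some true))); split.
- by rewrite -cats1 word_of_cat psE /word_of /= cats0 SE -rcons_cat.
- rewrite -cats1; apply: thin_cat => // p; rewrite inE => /eqP -> /=; split=> // K; split.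
    by case: (S2).
  exists S2, c, c0; split=> //.
  (* The loop lives on ]p0, 1[, with the letter [c0] to the left of the branch point: [aff] sends 1
     to [x + 1], and [1 - p0 >= y > x] with slope above 2 forces the image of [p0] to be at most
     [p0]. *)
  pose p0 := lft 0 (rcons S2 c0).
  have p0y : p0 <= 1 - y.
    rewrite /p0 lft_rcons ge_max; apply/andP; split; first lra.
    by rewrite /y c1E; lra.
  apply: (@loop_of p0 1); rewrite ?lexx //; first exact: lft_ge0.
  + by lra.
  + rewrite (lftE hp) ?lft_ge0 // ge_max lexx /=.
    have := affB al be p0 1 (rcons S2 c0); rewrite size_rcons (aff_rcons _ _ 1).
    rewrite -[aff 1 S2]u2 -rS.
    have -> : be * rgt 1 S + al - c0%:R = x + 1 by rewrite xE c1E; lra.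
    have xy : x < y by have := P1 (size S).+1 isT; nra.
    have := P1 (size S2).+1 isT; set B := be ^+ _ => B1 E.
    have : x <= (B - 1) * (1 - p0) by nra.
    by lra.
  + rewrite rgt_rcons le_min lexx /= -rS; by move: x0; rewrite xE c1E; clear; lra.
(* If [S2] were shorter, [rcons S2 c1] would have at most [J1] letters and the image ]0, x[ with 0 <
   x < th. *)
- rewrite size_rcons mulnS; suff : (J1 <= (size S2).+1)%N.
    by move: pss; rewrite SE size_cat size_rcons; clear; lia.
  rewrite leqNgt; apply/negP => hJ; have : th <= siz (rcons S2 c1).
    apply: thP; first by rewrite size_rcons ltnW.
    rewrite /siz rgt_rcons -rS -rgt_rcons -/x lft_rcons max_l ?subr0 //.
    by move: blS y0; rewrite /y c1E; clear; lra.
  rewrite /siz rgt_rcons -rS -rgt_rcons -/x lft_rcons max_l; first lra.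
  by move: blS y0; rewrite /y c1E; clear; lra.
Qed.

End Pieces.

Section Reflection.
Context {R : realType} {k : nat}.
Variables al be : R.
Implicit Types (u v w S : seq 'I_k) (c : 'I_k) (s t : R).

(* The reflection x |-> 1 - x conjugates the map of parameter [al] to the one of
   parameter [al'], exchanges left and right and reverses the alphabet. *)
Let al' := k%:R - al - be.
Local Notation rev_word := (map (@rev_ord k)).

Lemma natr_rev_ord c : (rev_ord c)%:R = k%:R - 1 - c%:R :> R.
Proof. by rewrite /= natrB // -natr1; ring. Qed.

Lemma params_rev : params k al be -> params k al' be.
Proof. by move=> [/andP[? ?] ? ? ?]; rewrite /al'; split; try apply/andP; lra. Qed.

Lemma lft_rev t w : lft al' be t (rev_word w) = 1 - rgt al be (1 - t) w.
Proof.
elim/last_ind: w => [|w c IH]; first by rewrite /= subKr.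
rewrite map_rcons lft_rcons rgt_rcons IH natr_rev_ord /al' oppr_min addr_maxr subrr.
by congr Num.max; ring.
Qed.

Lemma rgt_rev t w : rgt al' be t (rev_word w) = 1 - lft al be (1 - t) w.
Proof.
elim/last_ind: w => [|w c IH]; first by rewrite /= subKr.
rewrite map_rcons lft_rcons rgt_rcons IH natr_rev_ord /al' oppr_max addr_minr subr0.
by congr Num.min; ring.
Qed.

Lemma aff_rev t w : aff al' be t (rev_word w) = 1 - aff al be (1 - t) w.
Proof.
elim/last_ind: w => [|w c IH]; first by rewrite /= subKr.
by rewrite map_rcons !aff_rcons IH natr_rev_ord /al'; ring.
Qed.

Lemma siz_rev w : siz al' be (rev_word w) = siz al be w.
Proof. by rewrite /siz lft_rev rgt_rev subr0 subrr; ring. Qed.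

Lemma loop_rev w : loop al' be (rev_word w) -> loop al be w.
Proof.
move=> [x x0 xP]; exists x => // m; rewrite -siz_rev; apply: le_trans (xP m) _.
by rewrite map_flatten map_nseq.
Qed.

Lemma uncut_rev b S : uncut al' be b (rev_word S) <-> uncut al be (~~ b) S.
Proof.
by case: b; rewrite /uncut /= (lft_rev, rgt_rev) aff_rev (subrr, subr0);
  split => [/subrI|->].
Qed.

Definition rev_piece (p : @piece k) : @piece k :=
  (rev_word p.1, if p.2 is Some (Some b) then Some (Some (~~ b)) else p.2).

Lemma rev_wordK : involutive rev_word.
Proof. exact: (mapK (@rev_ordK k)). Qed.

Lemma thin_rev ps : thin al' be ps -> thin al be (map rev_piece ps).
Proof.
move=> H p /mapP[[q1 q2] /H[/= qt qg] ->]; split; first by case: q2 qt {qg} => [[b|]|].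
move=> K; have [/= q0 {}qg] := qg K; split; first by case: q1 q0 {qg}.
move: qg; rewrite /rev_piece /=; case: q2 qt => [[b|]|] //= _; last by rewrite size_map.
move=> [S [c [c' [-> sS uS lS]]]].
exists (rev_word S), (rev_ord c), (rev_ord c'); split.
- by rewrite map_rcons.
- by rewrite -siz_rev rev_wordK.
- by apply/uncut_rev; rewrite rev_wordK.
- by apply: loop_rev; rewrite map_rcons rev_wordK rev_ordK.
Qed.

Lemma word_of_rev ps : word_of (map rev_piece ps) = rev_word (word_of ps).
Proof. by rewrite /word_of -map_comp map_flatten -map_comp. Qed.

Hypothesis hp : params k al be.

Lemma uncut_pieces_right J1 : exists J0 : nat, forall S c c0,
  uncut al be true S -> 0 < siz al be S ->
  c0%:R < be * rgt al be 1 S + al <= c0%:R + 1 -> be * lft al be 0 S + al < c0%:R ->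
  exists ps, [/\ word_of ps = rcons S c, thin al be ps &
    (J1 * size ps <= (size S).+1 + J1 * J0)%N].
Proof.
have [J0 HJ] := uncut_pieces (params_rev hp) J1.
exists J0 => S c c0 uS sS /andP[c1 c2] c3.
have [||||ps [psE pst pss]] := HJ (rev_word S) (rev_ord c) (rev_ord c0).
- exact/uncut_rev.
- by rewrite siz_rev.
- by rewrite lft_rev natr_rev_ord subr0 /al'; apply/andP; split; lra.
- by rewrite rgt_rev natr_rev_ord subrr /al'; lra.
exists (map rev_piece ps); rewrite word_of_rev psE map_rcons rev_wordK rev_ordK.
by rewrite size_map; split=> //; [exact: thin_rev|rewrite size_map in pss].
Qed.

End Reflection.

(** * Runs between two consecutive cuts *)

Section Gaps.
Context {R : realType} {k : nat}.
Variables al be : R.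
Hypothesis hp : params k al be.
Implicit Types (u v w S : seq 'I_k) (c d : 'I_k) (s t : R).

Local Ltac param := have [/andP[? ?] ? ? ?] := hp.
Local Notation lft := (lft al be).
Local Notation rgt := (rgt al be).
Local Notation aff := (aff al be).
Local Notation siz := (siz al be).

Definition cut u c := be * lft 0 u + al < c%:R \/ c%:R + 1 < be * rgt 1 u + al.

Definition uncut_after u v :=
  lft 0 (u ++ v) = aff (lft 0 u) v /\ rgt 1 (u ++ v) = aff (rgt 1 u) v.

Lemma uncut_after_rcons u v c : uncut_after u v -> ~ cut (u ++ v) c ->
  uncut_after u (rcons v c).
Proof.
move=> [h1 h2] /not_orP[/negP + /negP]; rewrite -!leNgt => n1 n2.
rewrite /uncut_after -rcons_cat lft_rcons rgt_rcons !aff_rcons -h1 -h2.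
by split; [rewrite max_r //; lra|rewrite min_r //; lra].
Qed.

Lemma uncut_after_siz u v : uncut_after u v -> siz (u ++ v) = be ^+ size v * siz u.
Proof. by rewrite /siz => -[-> ->]; rewrite affB. Qed.

Lemma cut_end u c : 0 < siz (rcons u c) -> cut u c ->
  lft 0 (rcons u c) = 0 \/ rgt 1 (rcons u c) = 1.
Proof.
move=> _ [h|h]; [left|right]; rewrite ?lft_rcons ?rgt_rcons.
  by rewrite max_l //; lra.
by rewrite min_l //; lra.
Qed.

(** After the cut by [d] one end of the image is 0 or 1, so [v] taken alone is uncut on that side
    and [uncut_pieces] or its mirror image applies. The short image before the next cut forces [v]
    to be long, which absorbs the additive constants [J1 * J0] and [J1 * J0']. *)
Lemma gap_pieces J1 : exists2 e : R, 0 < e & forall u d v c,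
  0 < siz (rcons (rcons u d ++ v) c) -> cut u d -> uncut_after (rcons u d) v ->
  cut (rcons u d ++ v) c -> siz (rcons u d ++ v) < e ->
  exists ps, [/\ word_of ps = rcons v c, thin al be ps &
    (J1 * size ps <= 2 * (size v).+1)%N].
Proof.
param.
have [J0 HL] := uncut_pieces hp J1.
have [J0' HR] := uncut_pieces_right hp J1.
pose J := (J1 * J0 + J1 * J0')%N.
have [th th0 thP] := words_ge0_min (siz : seq 'I_k -> R) J.
exists (th / be) => [|u d v c]; first by rewrite divr_gt0 //; lra.
have be0 : 0 < be by lra.
set w := rcons u d => sc cu uv cw; rewrite ltr_pdivlMr //.
move=> sw; have sw0 : 0 < siz (w ++ v) by move: sc; rewrite -cats1 => /(siz_prefix hp).
have sv0 : 0 < siz v by apply: lt_le_trans sw0 _; exact: (siz_suffix hp).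
have sw_gt0 : 0 < siz w by move: sw0 => /(siz_prefix hp).
have lv : lft 0 v <= lft 0 (w ++ v).
  by rewrite lft_cat; apply: (lft_homo hp); rewrite lft_ge0.
have rv : rgt 1 (w ++ v) <= rgt 1 v.
  by rewrite rgt_cat; apply: (rgt_homo hp); rewrite rgt_le1.
have l0 := lft_ge0 al be (w ++ v) (lexx 0); have r1 := rgt_le1 al be (w ++ v) (lexx 1).
(* A branch point strictly inside the stretched image: it exists since [c] cuts this image and keeps
   a nonempty part of it. *)
have [m [m1 m2]] : exists m : nat,
    be * lft 0 (w ++ v) + al < m%:R /\ m%:R < be * rgt 1 (w ++ v) + al.
  move: sc; rewrite /siz lft_rcons rgt_rcons subr_gt0 lt_min !gt_max.
  move=> /andP[/andP[_ h1] /andP[h2 h3]]; case: cw => h; [exists c|exists c.+1].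
    by split; lra.
  by rewrite -natr1; split; lra.
have [|c0 c01 c02] := @letter_exists R k (be * lft 0 (w ++ v) + al).
  by apply/andP; split; nra.
have c0m : (c0 < m)%N by rewrite -(ltr_nat R); lra.
have {}c0m : c0%:R + 1 <= m%:R :> R by rewrite natr1 ler_nat.
have blr : be * lft 0 (w ++ v) <= be * rgt 1 (w ++ v).
  by rewrite ler_pM2l // -subr_ge0 ltW.
have blv : be * lft 0 v <= be * lft 0 (w ++ v) by rewrite ler_pM2l.
have brv : be * rgt 1 (w ++ v) <= be * rgt 1 v by rewrite ler_pM2l.
move: sw; rewrite mulrC {1}/siz mulrBr => sw.
case: (cut_end sw_gt0 cu) => hw.
  have lvE : lft 0 (w ++ v) = lft 0 v by rewrite lft_cat hw.
  have uvl : uncut al be false v by rewrite /uncut -lvE uv.1 hw.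
  have [||ps [psE pst pss]] := HL v c c0 uvl sv0.
  - by rewrite -lvE c01.
  - by lra.
  exists ps; split=> //; suff : (J < (size v).+1)%N by rewrite /J; clear -pss; lia.
  (* The image of [rcons v c0] corresponds to the part between the left end and the next branch
     point; its length is positive and below [be * siz (w ++ v) < th]. *)
  rewrite ltnNge; apply/negP => hJ; have : th <= siz (rcons v c0).
    apply: thP; rewrite ?size_rcons //.
    rewrite /siz lft_rcons rgt_rcons -lvE min_l; last lra.
    by rewrite max_r; lra.
  by rewrite /siz lft_rcons rgt_rcons -lvE min_l ?max_r; lra.
have rvE : rgt 1 (w ++ v) = rgt 1 v by rewrite rgt_cat hw.
have uvr : uncut al be true v by rewrite /uncut -rvE uv.2 hw.
rewrite rvE in sw.
have [c1 c11 c12] : exists2 c1 : 'I_k, c1%:R < be * rgt 1 v + al &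
    be * rgt 1 v + al <= c1%:R + 1.
  have [|c1 h1 h2] := @letter_exists R k (k%:R - (be * rgt 1 v + al)).
    by rewrite -rvE; apply/andP; split; nra.
  by exists (rev_ord c1); rewrite natr_rev_ord; lra.
have mc1 : (m < c1.+1)%N by rewrite -(ltr_nat R) -natr1; lra.
have {}mc1 : m%:R <= c1%:R :> R by rewrite ler_nat -ltnS.
have [||ps [psE pst pss]] := HR v c c1 uvr sv0.
- by apply/andP; split; lra.
- by lra.
exists ps; split=> //; suff : (J < (size v).+1)%N by rewrite /J; clear -pss; lia.
rewrite ltnNge; apply/negP => hJ; have : th <= siz (rcons v c1).
  apply: thP; rewrite ?size_rcons //.
  rewrite /siz lft_rcons rgt_rcons min_r; last lra.
  by rewrite max_l; lra.
by rewrite /siz lft_rcons rgt_rcons min_r ?max_l; lra.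
Qed.

End Gaps.

(** * Decomposition of arbitrary words into pieces *)

Section PieceDecomposition.
Context {R : realType} {k : nat}.
Variables al be : R.
Hypothesis hp : params k al be.
Implicit Types (u v w S : seq 'I_k) (c d : 'I_k) (s t : R).

Local Ltac param := have [/andP[? ?] ? ? ?] := hp.
Local Notation lft := (lft al be).
Local Notation rgt := (rgt al be).
Local Notation aff := (aff al be).
Local Notation siz := (siz al be).

Notation cut := (cut al be).
Notation uncut_after := (uncut_after al be).
Definition is_cut_end w := exists u c, w = rcons u c /\ cut u c.

Lemma tail_pieces J1 : exists2 e : R, 0 < e & forall u d v,
  0 < siz (rcons u d ++ v) -> cut u d ->
  (forall v1 v2, v = v1 ++ v2 -> siz (rcons u d ++ v1) < e) ->
  exists v1 v2 ps, v = v1 ++ v2 /\ [/\ is_cut_end (rcons u d ++ v1),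
    uncut_after (rcons u d ++ v1) v2, word_of ps = v1, thin al be ps &
    (J1 * size ps <= 2 * size v1)%N].
Proof.
have [e e0 HG] := gap_pieces hp J1; exists e => // u d v.
elim/last_ind: v => [|v c IH] sv cu sme.
  exists [::], [::], [::]; rewrite !cats0 muln0; split=> //; split=> //.
    by exists u, d.
  by rewrite /uncut_after cats0.
have sv' : 0 < siz (rcons u d ++ v).
  by move: sv; rewrite -rcons_cat -cats1 => /(siz_prefix hp).
have [|v1 [v2 [ps [vE [[u' [d' [uE cu']]] ua psE pst pss]]]]] := IH sv' cu.
  by move=> v1 v2 vE; apply: (sme v1 (rcons v2 c)); rewrite vE rcons_cat.
have vE' : rcons u d ++ v = rcons u' d' ++ v2 by rewrite vE catA uE.
have [ct|ct] := pselect (cut (rcons u d ++ v) c); last first.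
  exists v1, (rcons v2 c), ps; split; first by rewrite vE rcons_cat.
  split=> //; first by exists u', d'.
  by apply: uncut_after_rcons; rewrite ?uE -?vE' // -uE.
have [||||| qs [qsE qst qss]] := HG u' d' v2 c.
- by rewrite -vE' rcons_cat.
- exact: cu'.
- by rewrite -uE.
- by rewrite -vE'.
- by rewrite -vE'; apply: (sme v [:: c]); rewrite cats1.
exists (rcons v c), [::], (ps ++ qs); split; first by rewrite cats0.
split.
  - by exists (rcons u d ++ v), c; rewrite rcons_cat.
  - by rewrite /uncut_after cats0.
  - by rewrite word_of_cat psE qsE vE rcons_cat.
  - exact: thin_cat.
  - by rewrite size_cat mulnDr vE size_rcons size_cat; move: pss qss; clear; lia.
Qed.

Lemma last_long e w : e <= 1 -> e <= siz w \/ exists u d v,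
  [/\ w = u ++ d :: v, e <= siz u &
      forall v1 v2, v = v1 ++ v2 -> siz (rcons u d ++ v1) < e].
Proof.
move=> e1; elim/last_ind: w => [|w c IH]; first by left; rewrite /siz /= subr0.
have [h|h] := leP e (siz (rcons w c)); first by left.
right; case: IH => [sw|[u [d [v [wE su H]]]]].
  exists w, c, [::]; rewrite cats1; split=> // v1 v2 /esym/nilP.
  by rewrite cat_nilp => /andP[/nilP -> _]; rewrite cats0.
exists u, d, (rcons v c); split=> //; first by rewrite wE rcons_cat.
move=> v1 v2; case/lastP: v2 => [|v2 c'].
  by rewrite cats0 => <-; rewrite -rcons_cat cat_rcons -wE.
by rewrite -rcons_cat => /rcons_inj[/H].
Qed.

Definition total_cost K (ps : seq (@piece k)) := sumn (map (cost K) ps).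

Lemma total_cost_cat K ps qs :
  total_cost K (ps ++ qs) = (total_cost K ps + total_cost K qs)%N.
Proof. by rewrite /total_cost map_cat sumn_cat. Qed.

Lemma total_cost_thin K ps : thin al be ps -> total_cost K ps = size ps.
Proof.
elim: ps => //= p ps IH H; rewrite /total_cost /= -/(total_cost K ps) IH.
  by have [] := H p (mem_head _ _); rewrite /cost; case: p.2 => [[]|].
by move=> q qps; apply: H; rewrite inE qps orbT.
Qed.

(** The last prefix [u] with image at least [e] is a full piece, the next letter is dropped, the
    gaps up to the last cut give thin pieces, and the uncut rest [v2] is treated again as a word of
    its own. *)
Lemma decomposition D : exists K M, forall w, 0 < siz w -> exists ps,
  [/\ word_of ps = w, forall p, p \in ps -> good_piece al be K p &
      (D * total_cost K ps <= size w + M)%N].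
Proof.
param.
(* With [4 * D] the thin pieces use up at most half of the length available; [L] below is such that
   the cost of [u] and [d], at most [K + 2], fits into the other half once [size p > L]. *)
have [e' e'0 HT] := tail_pieces (4 * D).
pose e := Num.min 1 e'.
have e1 : e <= 1 by rewrite /e ge_min lexx.
have ee' : e <= e' by rewrite /e ge_min lexx orbT.
have e0 : 0 < e by rewrite /e lt_min ltr01.
have [K HK] := full_completion hp e0.
pose L := (2 * (D * (K + 2))).+1.
have [th th0 thP] := words_ge0_min (siz : seq 'I_k -> R) L.
have [L' HL'] : exists L' : nat, 1 < be ^+ L' * th.
  have h1 : `|be^-1| < 1 by rewrite ger0_norm ?invr_ge0 ?invf_lt1; lra.
  have /cvgrPdist_lt /(_ th th0) [N _ HN] := cvg_expr h1.
  exists N; have := HN N (leqnn _); rewrite /= sub0r normrN ger0_norm; last first.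
    by rewrite exprn_ge0 // invr_ge0; lra.
  have p0 : 0 < be ^+ N by rewrite exprn_gt0 //; lra.
  by rewrite exprVn -[_^-1]mul1r ltr_pdivrMr // mulrC.
exists K, (D * (L + L' + K.+1))%N => w; have [n wn] := ubnP (size w).
elim: n w wn => // n IH w wn sw.
have [sme|[u [d [v [wE su H]]]]] := last_long w e1.
  case: (posnP (size w)) => [/size0nil ->|w0].
    by exists [::]; rewrite /word_of /total_cost /= muln0.
  exists [:: (w, Some None)]; split; first by rewrite /word_of /= cats0.
    move=> p; rewrite inE => /eqP ->; split; first by move=> /= w00; rewrite w00 in w0.
    by have [x xK xf] := HK _ sme; exists x.
  by rewrite /total_cost /= /cost /= addn0; clear; lia.
(* Without a cut the image of [u] is multiplied by [be], and [rcons u d] would still have image at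
   least [e]. *)
have cu : cut u d.
  apply: contrapT => ncu.
  have ua0 : uncut_after u [::] by rewrite /uncut_after cats0.
  rewrite -{1}(cats0 u) in ncu.
  have := uncut_after_siz (uncut_after_rcons ua0 ncu).
  rewrite /= cats1 expr1 => E; have := H [::] v erefl; rewrite cats0 E.
  by move=> ?; nra.
have wE' : w = rcons u d ++ v by rewrite wE cat_rcons.
have [||v1 [v2 [ps [vE [_ ua psE pst pss]]]]] := HT u d v _ cu.
- by rewrite -wE'.
- by move=> v1 v2 /H h; apply: lt_le_trans h ee'.
set p := rcons u d ++ v1; have wpE : w = p ++ v2 by rewrite wE' vE catA.
have sp0 : 0 < siz p by move: sw; rewrite wpE => /(siz_prefix hp).
(* If [p] is short, its image is at least [th] and every letter of the uncut [v2] multiplies it by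
   [be]; as it stays at most 1, the length of [w] is bounded and [w] can be split into letters. *)
have [pL|pL] := leqP (size p) L.
  exists [seq ([:: c], None) | c <- w]; rewrite word_of_letters; split=> //.
    by move=> q /thin_letters -/(_ R al be) [_]; apply.
  rewrite total_cost_thin; last exact: thin_letters.
  rewrite size_map; suff h : (size w <= L + L')%N.
    by rewrite (leq_trans _ (leq_addl _ _)) // leq_mul2l (leq_trans h) ?leq_addr ?orbT.
  rewrite wpE size_cat; suff h : (size v2 <= L')%N by rewrite leq_add.
  rewrite leqNgt; apply/negP => hL'; have := siz_le1 hp w.
  rewrite wpE uncut_after_siz // leNgt => /negP; apply.
  have b0 : 0 <= be by lra.
  have b1 : 1 <= be by lra.
  apply: lt_le_trans HL' _; apply: ler_pM.
  - exact: exprn_ge0.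
  - exact: ltW.
  - exact: (ler_weXn2l b1 (ltnW hL')).
  - exact: thP.
have sv2 : 0 < siz v2 by apply: lt_le_trans sw _; rewrite wpE; exact: (siz_suffix hp).
have [|qs [qsE qsg qsc]] := IH v2 _ sv2.
  by move: wn pL; rewrite wpE size_cat /L; clear; lia.
pose ps0 : seq (@piece k) := if u is [::] then [::] else [:: (u, Some None)].
have w0 : word_of ps0 = u by rewrite /ps0 /word_of; case: (u) => //= a u'; rewrite cats0.
have g0 q : q \in ps0 -> good_piece al be K q.
  rewrite /ps0; case uE: (u) => [|a u'] //; rewrite inE => /eqP ->; split=> //.
  by rewrite -uE; have [x xK xf] := HK _ su; exists x.
have c0 : (total_cost K ps0 <= K.+1)%N.
  by rewrite /ps0; case: (u) => //= a u'; rewrite /total_cost /= /cost /= addn0.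
exists (ps0 ++ ([:: d], None) :: ps ++ qs); split.
- rewrite word_of_cat w0 /word_of /= -/(word_of (ps ++ qs)) word_of_cat psE qsE wpE /p.
  by rewrite cat_rcons -!catA.
- move=> q; rewrite mem_cat inE mem_cat => /or4P[/g0 //|/eqP -> //|/pst[_]|/qsg //].
  exact.
rewrite total_cost_cat [total_cost K (_ :: _)]/total_cost /= -/(total_cost _ _).
rewrite total_cost_cat (total_cost_thin _ pst).
have szp : (size v1 <= size p)%N by rewrite /p size_cat leq_addl.
rewrite /cost /= wpE size_cat.
move: c0; move: (total_cost K ps0) => c c0.
have : (D * c <= D * K.+1)%N by rewrite leq_mul2l c0 orbT.
move: qsc pss szp pL; rewrite /L.
move: (total_cost K qs) (size ps) (size p) (size v1) (size v2) => a1 a2 a3 a4 a5.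
by clear; rewrite !mulnDr; lia.
Qed.

End PieceDecomposition.

(** * Compression of words to full words *)

Lemma mem_tail (T : eqType) (x y : T) s : y \in s -> y \in x :: s.
Proof. by rewrite inE orbC => ->. Qed.

Section Occurrences.
Variable T : eqType.
Implicit Types (g u v w : seq T).

(** Overlapping occurrences are counted; the empty word has [size w] of them. *)
Fixpoint occ g w : nat := if w is c :: w' then (prefix g w + occ g w')%N else 0.

Lemma occ_cons g c w : occ g (c :: w) = (prefix g (c :: w) + occ g w)%N.
Proof. by []. Qed.

Lemma occ_size g w : (occ g w <= size w)%N.
Proof.
by elim: w => [|c w IH] //; rewrite occ_cons -[size _]add1n leq_add // leq_b1.
Qed.

Lemma occ_cat_ge g u v : (occ g u + occ g v <= occ g (u ++ v))%N.
Proof.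
elim: u => [|c u IH] //; rewrite cat_cons !occ_cons -addnA leq_add //.
have [/prefixP[s sE]|//] := boolP (prefix g (c :: u)).
by rewrite -cat_cons sE -catA prefix_prefix.
Qed.

Lemma occ_cat_le g u v : (occ g (u ++ v) <= occ g u + occ g v + size g)%N.
Proof.
suff : (occ g (u ++ v) <= occ g u + occ g v + minn (size u) (size g))%N.
  by move=> h; apply: leq_trans h _; rewrite leq_add2l geq_minr.
elim: u => [|c u IH]; first by rewrite min0n addn0.
rewrite cat_cons !occ_cons; have [gu|gu] := leqP (size g) (size (c :: u)).
  have -> : prefix g (c :: u ++ v) = prefix g (c :: u).
    by rewrite !prefixE -cat_cons takel_cat.
  by move: IH; move: (nat_of_bool _) => b; clear; rewrite /=; lia.
move: (leq_b1 (prefix g (c :: u ++ v))) IH gu.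
move: (nat_of_bool _) (nat_of_bool _) => b b'; clear; rewrite /=; lia.
Qed.

Definition near e (a b : nat) := (a <= b + e)%N && (b <= a + e)%N.

Lemma near_flatten g (ws : seq (seq T)) :
  near (size g * size ws) (occ g (flatten ws)) (sumn (map (occ g) ws)).
Proof.
rewrite /near; elim: ws => [|w ws IH] /=; first by rewrite muln0.
have := occ_cat_ge g w (flatten ws); have := occ_cat_le g w (flatten ws).
by move: IH; rewrite mulnS; clear; lia.
Qed.

End Occurrences.

Section Compression.
Context {R : realType} {k : nat}.
Variables al be : R.
Hypothesis hp : params k al be.
Implicit Types (g u v w S : seq 'I_k) (c : 'I_k) (p : @piece k) (ps : seq (@piece k)).

Lemma aff1_inj u v : size u = size v -> 0 < siz al be u -> 0 < siz al be v ->
  uncut al be true u -> uncut al be true v -> u = v.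
Proof.
move=> uv su sv hu hv; apply: (can_inj (@rev_wordK k)).
apply: (aff0_inj (params_rev hp)); rewrite ?size_map ?siz_rev //.
  exact/(@uncut_rev _ _ _ _ false).
exact/(@uncut_rev _ _ _ _ false).
Qed.

Definition completion K w : seq 'I_k :=
  xget [::] [set v | size v = K /\ full al be (w ++ v)].

Definition kept K p := if p.2 is Some None then p.1 ++ completion K p.1 else [::].

Definition is_loop_of (w u : seq 'I_k) :=
  loop al be u /\ exists S c c', w = rcons S c /\ u = rcons S c'.

Definition loops p := if p.2 is Some (Some _) then [:: xget [::] (is_loop_of p.1)] else [::].

Definition kept_of K ps := flatten (map (kept K) ps).
Definition loops_of ps := flatten (map loops ps).

Definition symbol : finType := option (option (option bool) * option 'I_k).

(* Only the pieces that are not kept have to be recovered: a word that is uncut on a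
   given side is determined by its length, so besides it the tag and the last
   letter are enough. *)
Definition code p : seq symbol :=
  rcons (nseq (size p.1).-1 None) (Some (p.2, ohead (rev p.1))).
Definition code_of ps := flatten (map code ps).

Lemma completionP K p : good_piece al be K p -> p.2 = Some None ->
  size (completion K p.1) = K /\ full al be (p.1 ++ completion K p.1).
Proof.
move=> [_ +] pE; rewrite pE => -[v vK vf].
by have [] : [set v | size v = K /\ full al be (p.1 ++ v)] (completion K p.1)
  by apply: (@xgetI _ _ _ v).
Qed.

Lemma loopsP K p u : good_piece al be K p -> u \in loops p -> is_loop_of p.1 u.
Proof.
move=> [_]; rewrite /loops; case: p.2 => [[b|]|] // [S [c [c' [pE _ _ lS]]]].
rewrite inE => /eqP ->; apply: (@xgetI _ _ _ (rcons S c')).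
by split=> //; exists S, c, c'.
Qed.

Lemma kept_full K ps : (forall p, p \in ps -> good_piece al be K p) ->
  full al be (kept_of K ps).
Proof.
move=> H; apply: full_flatten => _ /mapP[p /H pg ->].
rewrite /kept; case pE: p.2 => [[b|]|] //.
by have [] := completionP pg pE.
Qed.

Lemma code_size ps : (forall p, p \in ps -> p.1 <> [::]) ->
  size (code_of ps) = size (word_of ps) /\
  count (fun x => x != None) (code_of ps) = size ps.
Proof.
elim: ps => // p ps IH H; have [] := IH (fun q qps => H q (mem_tail _ qps)).
have p0 := H p (mem_head _ _).
rewrite /code_of /word_of /= !size_cat count_cat => -> ->.
rewrite /code size_rcons size_nseq -cats1 count_cat count_nseq /= mul0n; split=> //.
by case: p.1 p0.
Qed.

Lemma code_cat_inj n m (x y : symbol) s t : x != None -> y != None ->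
  rcons (nseq n (None : symbol)) x ++ s = rcons (nseq m None) y ++ t ->
  [/\ n = m, x = y & s = t].
Proof.
move=> x0 y0; elim: n m => [|n IH] [|m] //=.
- by move=> [-> ->].
- by move=> [xE _]; rewrite xE in x0.
- by move=> [yE _]; rewrite -yE in y0.
by move=> [/IH[-> -> ->]].
Qed.

Lemma ohead_rev_rcons (S : seq 'I_k) c : ohead (rev (rcons S c)) = Some c.
Proof. by rewrite rev_rcons. Qed.

(** The code is self-delimiting, as each piece ends with its only symbol other than [None]; it
    yields tags, lengths and last letters. Then a loop piece follows from [aff0_inj] or [aff1_inj],
    a full piece is the beginning of its kept part, and a single letter is its own last letter. *)
Lemma code_inj K ps qs : (forall p, p \in ps -> good_piece al be K p) ->
  (forall p, p \in qs -> good_piece al be K p) -> code_of ps = code_of qs ->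
  kept_of K ps = kept_of K qs -> word_of ps = word_of qs.
Proof.
elim: ps qs => [|p ps IH] [|q qs] //.
- by rewrite /code_of /= /code => _ _ /eqP; case: (size q.1).-1.
- by rewrite /code_of /= /code => _ _ /eqP; case: (size p.1).-1.
move=> gp gq; have {}IH := IH qs (fun q qps => gp q (mem_tail _ qps))
  (fun q qps => gq q (mem_tail _ qps)).
have {gp}gp := gp p (mem_head _ _); have {gq}gq := gq q (mem_head _ _).
rewrite /code_of /= /code => /code_cat_inj[//|//|spq [tE lE]] /IH {}IH.
have {spq}spq : size p.1 = size q.1.
  by move: spq gp.1 gq.1; case: p.1 q.1 => [|? ?] [|? ?] //= ->.
rewrite /kept_of /= => kE; rewrite /word_of /= -/(word_of ps) -/(word_of qs).
suff E : p.1 = q.1 /\ kept K p = kept K q.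
  case: E => -> kpq; congr (_ ++ _); apply: IH; move: kE; rewrite kpq => /eqP.
  by rewrite eqseq_cat // eqxx => /eqP.
case: (gp) (gq) => _ + [_ +]; rewrite /kept -tE; case pE: p.2 => [[b|]|].
- move=> [S [c [c' [SE sS uS _]]]] [S' [d [d' [SE' sS' uS' _]]]].
  split=> //; move: lE spq; rewrite SE SE' !ohead_rev_rcons !size_rcons => -[->] [sz].
  congr rcons; case: b {pE} uS uS' => uS uS'; first exact: aff1_inj.
  exact: (aff0_inj hp).
- move=> _ _; move: kE; rewrite /kept -tE pE.
  have [cp _] := completionP gp pE; have [cq _] := completionP gq (etrans (esym tE) pE).
  move=> /eqP; rewrite -!catA eqseq_cat // => /andP[/eqP pq _].
  by rewrite pq.
move=> p1 q1; split=> //; move: lE; case: p.1 p1 => [|a [|]] //; case: q.1 q1 => [|b [|]] //.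
by move=> _ _ [->].
Qed.

Definition sum_occ g (ws : seq (seq 'I_k)) := sumn (map (occ g) ws).

Lemma size_le_cost K ps : (size ps <= total_cost K ps)%N.
Proof.
elim: ps => //= p ps IH; rewrite /total_cost /= -addn1 addnC leq_add //.
by rewrite /cost; case: p.2 => [[]|].
Qed.

Lemma near_loop g w u : is_loop_of w u -> near (size g).+1 (occ g w) (occ g u).
Proof.
move=> [_ [S [c [c' [-> ->]]]]]; rewrite -!cats1 /near.
have := occ_cat_ge g S [:: c]; have := occ_cat_le g S [:: c].
have := occ_cat_ge g S [:: c']; have := occ_cat_le g S [:: c'].
have := occ_size g [:: c]; have := occ_size g [:: c'].
by move: (occ g [:: c]) (occ g [:: c']) => a b /=; clear; lia.
Qed.

(** One third of the error comes from the changes inside the pieces, the rest from the junctions in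
    the two concatenations. *)
Lemma near_compression g K ps : (forall p, p \in ps -> good_piece al be K p) ->
  near (3 * (size g).+1 * total_cost K ps) (occ g (word_of ps))
    (occ g (kept_of K ps) + sum_occ g (loops_of ps)).
Proof.
move=> H; have : near ((size g).+1 * total_cost K ps) (sumn (map (occ g) (map fst ps)))
    (sumn (map (occ g) (map (kept K) ps)) + sum_occ g (loops_of ps)).
  elim: ps H => [|p ps IH] H //.
  have {}IH := IH (fun q qps => H q (mem_tail _ qps)).
  have {H}gp := H p (mem_head _ _).
  have : near ((size g).+1 * cost K p) (occ g p.1) (occ g (kept K p) + sum_occ g (loops p)).
    rewrite /near /kept /cost; have lP := loopsP gp.
    rewrite /loops in lP *; case pE: p.2 lP => [[b|]|] lP.
    - have := near_loop g (lP _ (mem_head _ _)); rewrite /near /sum_occ /=; clear; lia.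
    - have [cK _] := completionP gp pE.
      have := occ_cat_ge g p.1 (completion K p.1); have := occ_cat_le g p.1 (completion K p.1).
      have := occ_size g (completion K p.1); rewrite cK /sum_occ /=.
      by rewrite mulnS addn0; clear; nia.
    - have [_] := gp; rewrite pE; have := occ_size g p.1; rewrite /sum_occ /=.
      by clear; lia.
  move: IH; rewrite /near /sum_occ /loops_of /= map_cat sumn_cat /total_cost /= mulnDr.
  by clear; lia.
have := near_flatten g (map fst ps); have := near_flatten g (map (kept K) ps).
rewrite !size_map /word_of /kept_of /near; have := size_le_cost K ps.
move=> h; have : (size g * size ps <= size g * total_cost K ps)%N by rewrite leq_mul2l h orbT.
rewrite -mulnA (mulSn (size g)).
move: (size g * size ps)%N (size g * total_cost K ps)%N => x y; clear.
move: (sumn (map (occ g) (map fst ps))) (sumn (map (occ g) (map (kept K) ps))) => a b.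
move: (occ g (flatten (map fst ps))) (occ g (flatten (map (kept K) ps))) => c d.
by lia.
Qed.

Lemma near_size K ps : (forall p, p \in ps -> good_piece al be K p) ->
  near (total_cost K ps) (size (word_of ps))
    (size (kept_of K ps) + sumn (map size (loops_of ps))).
Proof.
elim: ps => // p ps IH H; have {}IH := IH (fun q qps => H q (mem_tail _ qps)).
have {H}gp := H p (mem_head _ _).
have : near (cost K p) (size p.1) (size (kept K p) + sumn (map size (loops p))).
  rewrite /near /kept /cost; have lP := loopsP gp.
  rewrite /loops in lP *; case pE: p.2 lP => [[b|]|] lP.
  - have [_ [S [c [c' [-> ->]]]]] := lP _ (mem_head _ _); rewrite /= !size_rcons; clear; lia.
  - by have [cK _] := completionP gp pE; rewrite size_cat cK /=; clear; lia.
  - by have [_] := gp; rewrite pE => -> /=.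
move: IH; rewrite /near /word_of /kept_of /loops_of /= !size_cat map_cat sumn_cat.
rewrite /total_cost /=; clear; lia.
Qed.

End Compression.

(** * Counting arrangements and sparse words *)

Section LogFactorial.
Variable R : realType.
Implicit Types (x : R) (n : nat).

Lemma ln_le_sub1 x : 0 < x -> ln x <= x - 1.
Proof. by move=> x0; have := expR_ge1Dx (ln x); rewrite lnK //; lra. Qed.

Lemma ln_le_linear (e : R) : 0 < e -> exists2 C, 0 <= C & forall x, 0 < x -> ln x <= e * x + C.
Proof.
move=> e0; exists `|ln e|; rewrite ?normr_ge0 // => x x0.
have := ln_le_sub1 (mulr_gt0 e0 x0); rewrite lnM ?posrE //.
by have := ler_norm (- ln e); rewrite normrN; lra.
Qed.

Lemma ln_fact_ge n : n%:R * ln n%:R - n%:R <= ln (n`!)%:R :> R.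
Proof.
elim: n => [|n IH]; first by rewrite mul0r fact0 ln1 subr0.
rewrite factS natrM lnM ?posrE ?ltr0n ?fact_gt0 //.
have [->|n0] := posnP n; first by rewrite fact0 ln1; lra.
have n0' : 0 < n%:R :> R by rewrite ltr0n.
have h1 : ln (n.+1%:R / n%:R) <= n.+1%:R / n%:R - 1 :> R.
  by apply: ln_le_sub1; rewrite divr_gt0 // ltr0n.
have : n%:R * ln (n.+1%:R / n%:R) <= 1 :> R.
  apply: le_trans (ler_wpM2l (ltW n0') h1) _.
  by rewrite mulrBr mulrCA divff ?gt_eqF // -[n.+1%:R]natr1; lra.
rewrite ln_div ?posrE ?ltr0n // -[n.+1%:R]natr1 => h2; lra.
Qed.

Lemma ln_fact_le n : ln (n`!)%:R <= n%:R * ln n%:R - n%:R + 1 + ln n%:R :> R.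
Proof.
elim: n => [|n IH]; first by rewrite mul0r fact0 ln1 ln0; lra.
rewrite factS natrM lnM ?posrE ?ltr0n ?fact_gt0 //.
have [->|n0] := posnP n; first by rewrite fact0 ln1; lra.
have n0' : 0 < n%:R :> R by rewrite ltr0n.
have m0' : 0 < n.+1%:R :> R by rewrite ltr0n.
have h1 : ln (n%:R / n.+1%:R) <= n%:R / n.+1%:R - 1 :> R.
  by apply: ln_le_sub1; rewrite divr_gt0 // ltr0n.
have : n.+1%:R * ln (n%:R / n.+1%:R) <= - 1 :> R.
  apply: le_trans (ler_wpM2l (ltW m0') h1) _.
  by rewrite mulrBr mulrCA divff ?gt_eqF // -[n.+1%:R]natr1; lra.
rewrite ln_div ?posrE ?ltr0n // -[n.+1%:R]natr1 => h2; lra.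
Qed.

Lemma ln_prod (I : finType) (F : I -> R) : (forall i, 0 < F i) ->
  ln (\prod_i F i) = \sum_i ln (F i).
Proof.
move=> F0; have [] : 0 < \prod_i F i /\ ln (\prod_i F i) = \sum_i ln (F i) by
  elim/big_rec2 : _ => [|i x y _ [y0 yE]]; rewrite ?ltr01 ?ln1 // lnM ?posrE // yE mulr_gt0.
by [].
Qed.

End LogFactorial.

Section Arrangements.
Variable T : finType.
Implicit Types (s : seq T) (x : T).

Lemma sum_count_mem s : (\sum_x count_mem x s = size s)%N.
Proof.
elim: s => [|y s IH] /=; first by rewrite big1.
rewrite big_split /= IH -add1n; congr (_ + _)%N; rewrite (bigD1 y) //= eqxx big1 ?addn0 //.
by move=> x /negPf; rewrite eq_sym => ->.
Qed.

(** The multinomial formula, by induction on the first letter of a rearrangement; [permutations]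
    lists each rearrangement once. *)
Lemma size_permutations_prod s :
  (size (permutations s) * \prod_x (count_mem x s)`! = (size s)`!)%N.
Proof.
have [n] := ubnP (size s); elim: n s => // n IH s sn.
have [/size0nil ->|s0] := posnP (size s).
  by rewrite big1 // muln1.
rewrite (perm_size (permutationsE s0)) size_allpairs_dep sumnE big_map big_distrl /=.
rewrite (eq_big_seq (fun x => count_mem x s * (size s).-1`!)%N) => [|x]; last first.
  rewrite mem_undup => xs; have rn : (size (rem x s) < n)%N.
    by rewrite size_rem // -ltnS prednK.
  rewrite -(size_rem xs) -(IH _ rn).
  rewrite mulnCA; congr (_ * _)%N.
  rewrite (bigD1 x) //= [in RHS](bigD1 x) //= mulnA; congr (_ * _)%N.
    rewrite count_rem xs /= eqxx subn1; have : (0 < count_mem x s)%N.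
      by rewrite -has_count has_pred1.
    by case: (count_mem x s).
  by apply: eq_bigr => y yx; rewrite count_rem /= [x == y]eq_sym (negPf yx) andbF subn0.
rewrite -big_distrl /= big_uniq ?undup_uniq //= (eq_bigl (fun x => x \in s)); last first.
  by move=> x; rewrite mem_undup.
rewrite (_ : (\sum_(x in s) _ = size s)%N); last first.
  rewrite -sum_count_mem [RHS](bigID (fun x => x \in s)) /= [X in (_ + X)%N]big1 ?addn0 //.
  by move=> x xs; apply/count_memPn.
by case: (size s) s0.
Qed.

Variables (R : realType) (p : T -> R).
Hypotheses (p0 : forall x, 0 <= p x) (p1 : \sum_x p x = 1).

Definition multiset (m : nat) : seq T :=
  flatten [seq nseq (Num.trunc (m%:R * p x)) x | x <- enum T].

Lemma count_multiset m x : count_mem x (multiset m) = Num.trunc (m%:R * p x).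
Proof.
rewrite /multiset count_flatten -map_comp sumnE big_map big_enum /= (bigD1 x) //=.
rewrite count_nseq /= eqxx mul1n big1 ?addn0 // => y yx.
by rewrite count_nseq /= (negPf yx).
Qed.

Lemma trunc_bounds m x :
  m%:R * p x - 1 <= (Num.trunc (m%:R * p x))%:R <= m%:R * p x.
Proof.
have mp : 0 <= m%:R * p x by rewrite mulr_ge0 ?ler0n.
by have /andP[h1] := truncn_itv mp; rewrite h1 andbT -natr1; lra.
Qed.

Lemma size_multiset m :
  (m%:R - #|T|%:R : R) <= (size (multiset m))%:R <= (m%:R : R).
Proof.
have mE : m%:R = \sum_x m%:R * p x :> R by rewrite -mulr_sumr p1 mulr1.
rewrite -sum_count_mem natr_sum mE -sum1_card natr_sum -sumrB.
apply/andP; split; apply: ler_sum => x _; rewrite count_multiset;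
  by have /andP[] := trunc_bounds m x.
Qed.

(** Stirling's bounds in the multinomial coefficient. Each letter of [T] contributes a logarithmic
    error; the slope [e / (t + 1)] keeps the sum of these errors below [e * m] up to a constant. *)
Lemma perms_entropy (e : R) : 0 < e -> exists C, forall m,
  m%:R * (\sum_x - p x * ln (p x)) - e * m%:R - C <=
  ln (size (permutations (multiset m)))%:R.
Proof.
move=> e0; pose t : R := #|T|%:R.
have t0 : 0 <= t by rewrite ler0n.
have [|C C0 lnC] := @ln_le_linear R (e / (t + 1)); first by rewrite divr_gt0 //; lra.
exists (\sum_x - ln (p x) + t + t * (1 + C)) => m.
set s := multiset m; have /andP[sm1 sm2] := size_multiset m; rewrite -/s -/t in sm1 sm2.
have px1 x : p x <= 1.
  by rewrite -p1 (bigD1 x) //= lerDl sumr_ge0.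
have ln_p x : 0 <= - ln (p x).
  rewrite oppr_ge0; have [px0|px0] := ltP 0 (p x); last by rewrite ln0.
  by have := ln_le_sub1 px0; have := px1 x; lra.
have prod_gt0 : (0 < \prod_x (count_mem x s)`!)%N by rewrite prodn_gt0 // => x; rewrite fact_gt0.
have perm_gt0 : (0 < size (permutations s))%N.
  by have := size_permutations_prod s; case: size => //= /esym/eqP;
    rewrite mul0n -leqn0 leqNgt fact_gt0.
have := congr1 (fun n => ln n%:R : R) (size_permutations_prod s).
rewrite natrM lnM ?posrE ?ltr0n // => lnE.
rewrite natr_prod ln_prod in lnE; last by move=> x; rewrite ltr0n fact_gt0.
set M := (size s)%:R : R in lnE sm1 sm2.
have M0 : 0 <= M by rewrite ler0n.
pose c x : R := (count_mem x s)%:R.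
have cb x : m%:R * p x - 1 <= c x <= m%:R * p x by rewrite /c count_multiset trunc_bounds.
have c0 x : 0 <= c x by rewrite ler0n.
have cM : \sum_x c x = M by rewrite /c -natr_sum sum_count_mem.
have lnc x : ln (count_mem x s)`!%:R <= c x * ln (c x) - c x + (1 + (e / (t + 1) * m%:R + C)).
  apply: le_trans (ln_fact_le _ _) _; rewrite -/(c x) -!addrA lerD2l lerD2l lerD2l.
  have [c00|cx0] := leP (c x) 0.
    by rewrite ln0 //; rewrite addr_ge0 // mulr_ge0 ?ler0n // divr_ge0; lra.
  apply: le_trans (lnC _ cx0) _; rewrite lerD2r ler_pM2l ?divr_gt0 //; last lra.
  by have := cb x; have := px1 x; have := p0 x; have : 0 <= m%:R :> R by []; nra.
have lnc' x : c x * ln (c x) <= c x * ln m%:R + (m%:R * p x - 1) * ln (p x).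
  have [cx0|cx0] := ltP 0 (c x); last first.
    have -> : c x = 0 by apply/eqP; rewrite eq_le cx0 c0.
    rewrite !mul0r add0r; have := ln_p x; have /andP[] := cb x.
    have -> : c x = 0 by apply/eqP; rewrite eq_le cx0 c0.
    by move=> ? _; nra.
  have /andP[cb1 cb2] := cb x.
  have mp0 : 0 < m%:R * p x by exact: lt_le_trans cx0 cb2.
  have m0 : 0 < m%:R :> R by rewrite lt_neqAle eq_sym ler0n andbT; apply/eqP => m0; move: mp0;
    rewrite m0 mul0r ltxx.
  have px0 : 0 < p x by rewrite -(pmulr_rgt0 _ m0).
  have : ln (c x) <= ln m%:R + ln (p x).
    by rewrite -lnM ?posrE // ler_ln ?posrE.
  by have := ln_p x; nra.
have MlnM : M * ln m%:R - M * ln M <= t.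
  have [M_gt0|M00] := ltP 0 M; last first.
    by have -> : M = 0 by [apply/eqP; rewrite eq_le M00 M0]; rewrite !mul0r subrr.
  have m0 : 0 < m%:R :> R by exact: lt_le_trans M_gt0 sm2.
  have : ln (m%:R / M) <= m%:R / M - 1 by apply: ln_le_sub1; rewrite divr_gt0.
  rewrite ln_div ?posrE // => /(ler_wpM2l M0).
  by rewrite !mulrBr mulrCA divff ?gt_eqF //; lra.
have lnf := @ln_fact_ge R (size s); rewrite -/M in lnf.
have S1 : \sum_x ln (count_mem x s)`!%:R <= M * ln m%:R + m%:R * (\sum_x p x * ln (p x))
    + \sum_x - ln (p x) - M + t * (1 + (e / (t + 1) * m%:R + C)).
  apply: (@le_trans _ _ (\sum_x (c x * ln m%:R + m%:R * (p x * ln (p x)) + - ln (p x)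
      - c x + (1 + (e / (t + 1) * m%:R + C))))).
    by apply: ler_sum => x _; apply: le_trans (lnc x) _; have := lnc' x; lra.
  have E1 : \sum_x c x * ln m%:R = M * ln m%:R by rewrite -mulr_suml cM.
  have E2 : \sum_x - c x = - M by rewrite sumrN cM.
  have E3 (y : R) : \sum_(x : T) y = t * y by rewrite sumr_const mulr_natl.
  by rewrite !big_split /= E1 E2 -mulr_sumr !E3; lra.
have et : t * (e / (t + 1)) <= e.
  by rewrite mulrA ler_pdivrMr; [nra|lra].
have : t * (e / (t + 1)) * m%:R <= e * m%:R by rewrite ler_wpM2r.
rewrite (eq_bigr (fun x => - (p x * ln (p x)))); last by move=> x _; rewrite mulNr.
rewrite sumrN; lra.
Qed.

End Arrangements.

Section FewMarks.
Variables (R : realType) (T : finType).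

Lemma sum_words (f : T -> R) n :
  \sum_(w <- words T n) \prod_(x <- w) f x = (\sum_x f x) ^+ n.
Proof.
elim: n => [|n IH]; first by rewrite big_seq1 big_nil.
rewrite big_allpairs_dep exprS -IH big_enum /= mulr_suml; apply: eq_bigr => x _.
by rewrite mulr_sumr; apply: eq_bigr => w _; rewrite big_cons.
Qed.

Definition sparse_words (a : pred T) q n := [seq w <- words T n | (count a w <= q)%N].

(** An exponential Markov bound: with weight [t] per marked symbol, a sparse word weighs at least
    [t ^+ q], and all words together weigh at most the right-hand side. *)
Lemma size_sparse_words (a : pred T) q n (t : R) : 0 < t <= 1 ->
  #|[pred x | ~~ a x]| = 1%N ->
  (size (sparse_words a q n))%:R * t ^+ q <= (1 + #|T|%:R * t) ^+ n.
Proof.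
move=> /andP[t0 t1] a1; pose f x := if a x then t else 1.
have fE w : \prod_(x <- w) f x = t ^+ count a w.
  elim: w => [|x w IH]; first by rewrite big_nil.
  by rewrite big_cons IH /f /=; case: (a x); rewrite ?mul1r // add1n exprS.
have f0 : 0 <= \sum_x f x by apply: sumr_ge0 => x _; rewrite /f; case: (a x) => //; rewrite ltW.
apply: (@le_trans _ _ ((\sum_x f x) ^+ n)); last first.
  have g0 : 0 <= 1 + #|T|%:R * t by rewrite addr_ge0 // mulr_ge0 // ltW.
  rewrite lerXn2r ?nnegrE //.
  rewrite (bigID a) /= addrC lerD //.
    rewrite (eq_bigr (fun=> 1)) => [|x /negPf ax]; last by rewrite /f ax.
    by rewrite sumr_const a1.
  rewrite (eq_bigr (fun=> t)) => [|x ax]; last by rewrite /f ax.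
  by rewrite sumr_const -[t *+ _]mulr_natl ler_wpM2r ?(ltW t0) // ler_nat max_card.
rewrite -sum_words (eq_bigr _ (fun w _ => fE w)) -sum1_size natr_sum mulr_suml big_filter /=.
rewrite big_mkcond /=; apply: ler_sum => w _; case: ifP => [wq|_].
  by rewrite mul1r ler_wiXn2l // ltW.
by rewrite exprn_ge0 // ltW.
Qed.

Lemma ln_size_sparse_words (a : pred T) (e : R) : 0 < e ->
  #|[pred x | ~~ a x]| = 1%N -> exists2 D, (0 < D)%N & forall q n, (D * q <= 2 * n)%N ->
  ln (size (sparse_words a q n))%:R <= e * n%:R :> R.
Proof.
move=> e0 a1; pose c : R := #|T|%:R; have c0 : 0 <= c by rewrite ler0n.
pose t : R := Num.min 1 (e / (2 * (c + 1))).
have t0 : 0 < t by rewrite lt_min ltr01 divr_gt0 // mulr_gt0; lra.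
have t1 : t <= 1 by rewrite ge_min lexx.
have ct : c * t <= e / 2.
  apply: (@le_trans _ _ (c * (e / (2 * (c + 1))))); first by rewrite ler_wpM2l // ge_min lexx orbT.
  by rewrite mulrA ler_pdivrMr; nra.
have lnt : 0 <= - ln t by have := ln_le_sub1 t0; lra.
(* As [q <= 2 n / D], this choice makes [q * - ln t] at most [e / 2 * n]; the other half of [e] pays
   for [ln (1 + c * t)]. *)
pose D := (Num.trunc (4 * - ln t / e)).+1.
have x0 : 0 <= 4 * - ln t / e by rewrite divr_ge0 ?mulr_ge0 // ltW.
have hD : 4 * - ln t < D%:R * e.
  by rewrite -ltr_pdivrMr // /D; have /andP[] := truncn_itv x0.
exists D => // q n qn; have D0 : 0 < D%:R :> R by rewrite ltr0n.
have qn' : D%:R * q%:R <= 2 * n%:R :> R by rewrite -!natrM ler_nat.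
have [s0|s0] := posnP (size (sparse_words a q n)).
  by rewrite s0 ln0 // mulr_ge0 // ltW.
have := @size_sparse_words a q n t; rewrite t0 t1 => /(_ isT a1) h.
have ct1 : 0 < 1 + c * t by rewrite ltr_wpDr // mulr_ge0 // ltW.
have : ln ((size (sparse_words a q n))%:R * t ^+ q) <= ln ((1 + c * t) ^+ n).
  by rewrite ler_ln ?posrE ?mulr_gt0 ?exprn_gt0 ?ltr0n.
rewrite lnM ?posrE ?exprn_gt0 ?ltr0n // !lnXn //.
have := ln_le_sub1 ct1; rewrite addrAC subrr add0r => h1.
have {}h1 : ln (1 + c * t) <= e / 2 by lra.
have h2 : ln (1 + c * t) * n%:R <= e / 2 * n%:R by rewrite ler_wpM2r.
have h3 : q%:R * (- ln t) <= e / 2 * n%:R.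
  have q0 : 0 <= q%:R :> R by [].
  suff : D%:R * (q%:R * - ln t) <= D%:R * (e / 2 * n%:R) by rewrite ler_pM2l.
  have : (4 * - ln t) * n%:R <= D%:R * e * n%:R by rewrite ler_wpM2r // ltW.
  have : D%:R * q%:R * - ln t <= 2 * n%:R * - ln t by rewrite ler_wpM2r.
  by lra.
rewrite -[ln t *+ q]mulr_natr -[ln (1 + c * t) *+ n]mulr_natr; lra.
Qed.

End FewMarks.

(** * Superblocks *)

Lemma near_trans e e' a b c : near e a b -> near e' b c -> near (e + e') a c.
Proof. by rewrite /near; lia. Qed.

Lemma near_sym e a b : near e a b -> near e b a.
Proof. by rewrite /near andbC. Qed.

Lemma near_add e e' a b a' b' : near e a a' -> near e' b b' -> near (e + e') (a + b) (a' + b').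
Proof. by rewrite /near; lia. Qed.

Lemma near_le e e' a b : (e <= e')%N -> near e a b -> near e' a b.
Proof. by rewrite /near; lia. Qed.

Lemma near_mul m e a b : near e a b -> near (m * e) (m * a) (m * b).
Proof. by rewrite /near => /andP[h1 h2]; rewrite -!mulnDr !leq_mul2l h1 h2 !orbT. Qed.

Lemma near_sum (I : Type) (s : seq I) (e f h : I -> nat) :
  (forall i, near (e i) (f i) (h i)) ->
  near (\sum_(i <- s) e i) (\sum_(i <- s) f i) (\sum_(i <- s) h i).
Proof.
move=> H; elim/big_rec3 : _ => [|i y1 y2 y3 _ IH] //.
exact: near_add.
Qed.

Lemma near_occ_flatten (T : eqType) (I : Type) (g : seq T) (s : seq I) (f : I -> seq T)
    (e h : I -> nat) : (forall i, near (e i) (occ g (f i)) (h i)) ->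
  near (\sum_(i <- s) (size g + e i)) (occ g (flatten (map f s))) (\sum_(i <- s) h i).
Proof.
move=> H; elim: s => [|i s IH]; first by rewrite !big_nil.
rewrite !big_cons /=; have := H i.
have := occ_cat_ge g (f i) (flatten (map f s)); have := occ_cat_le g (f i) (flatten (map f s)).
by move: IH; rewrite /near; clear; lia.
Qed.

Section Superblock.
Context {R : realType} {k : nat}.
Variables (al be : R) (hp : params k al be).
Variables (N K q : nat).
Local Notation W := (N.-tuple 'I_k).
Variables (p : W -> R) (ps : W -> seq (@piece k)).
Hypotheses (p0 : forall w, 0 <= p w) (p1 : \sum_w p w = 1).
Hypothesis ps_good : forall w x, x \in ps w -> good_piece al be K x.
Hypothesis ps_word : forall w, 0 < p w -> word_of (ps w) = w.
Hypothesis ps_cost : forall w, (total_cost K (ps w) <= q)%N.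
Implicit Types (w : W) (u g : seq 'I_k) (s : seq W) (m : nat).

Definition kw w := kept_of al be K (ps w).
Definition lw w := loops_of al be (ps w).

Lemma lw_loop w u : u \in lw w -> loop al be u.
Proof.
move=> /flatten_mapP[x xps /loopsP] => H.
by have [] := H K (ps_good xps).
Qed.

(** The images of all powers of a loop have a common lower bound, so the length [Kf.1] is the same
    for all exponents. A word that is not a loop gets a dummy value. *)
Lemma closing_exists u : exists Kf : nat * (nat -> seq 'I_k),
  (forall n, size (Kf.2 n) = Kf.1) /\
  (loop al be u -> forall n, full al be (flatten (nseq n u) ++ Kf.2 n)).
Proof.
have [[x x0 xP]|nl] := pselect (loop al be u); last by exists (0%N, fun=> [::]).
have [Ku HK] := full_completion hp x0.
have /choice[f fP] : forall n, exists v, size v = Ku /\ full al be (flatten (nseq n u) ++ v).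
  by move=> n; have [v vK vf] := HK _ (xP n); exists v.
by exists (Ku, f); split => [n|_ n]; have [] := fP n.
Qed.

Definition closing u := projT1 (cid (closing_exists u)).

Lemma size_closing u n : size ((closing u).2 n) = (closing u).1.
Proof. by rewrite /closing; case: cid => Kf /= []. Qed.

Lemma full_closing u n : loop al be u -> full al be (flatten (nseq n u) ++ (closing u).2 n).
Proof. by rewrite /closing; case: cid => Kf /= [_ H] /H. Qed.

Definition copies m w := Num.trunc (m%:R * p w).
Definition closed_power n u := flatten (nseq n u) ++ (closing u).2 n.
Definition loop_part m w := flatten (map (closed_power (copies m w)) (lw w)).
Definition all_loops m := flatten (map (loop_part m) (enum {: W})).
(* The frequencies of short words hardly depend on the order of the pieces, so the
   loops are moved to the end and grouped as powers; only the arrangement [s] of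
   the kept parts varies. *)
Definition superblock m s := flatten (map kw s) ++ all_loops m.

Lemma superblock_full m s : full al be (superblock m s).
Proof.
apply: full_cat; first by apply: full_flatten => _ /mapP[w _ ->]; exact: (kept_full (@ps_good w)).
apply: full_flatten => _ /mapP[w _ ->]; apply: full_flatten => _ /mapP[u /lw_loop lu ->].
exact: full_closing.
Qed.

Lemma sum_multiset m (f : W -> nat) :
  (\sum_(w <- multiset p m) f w = \sum_w copies m w * f w)%N.
Proof.
rewrite /multiset big_flatten big_map big_enum /=; apply: eq_bigr => w _.
by rewrite big_nseq iter_addn_0 mulnC.
Qed.

Lemma size_multiset_sum m : size (multiset p m) = (\sum_w copies m w)%N.
Proof.
by rewrite -sum1_size sum_multiset; apply: eq_bigr => w _; rewrite muln1.
Qed.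

Lemma size_superblock m s : perm_eq s (multiset p m) ->
  size (superblock m s) = size (superblock m (multiset p m)).
Proof.
move=> sp; rewrite !size_cat !size_flatten /shape -!map_comp !sumnE !big_map.
by rewrite (perm_big _ sp).
Qed.

Lemma size_lw w : (size (lw w) <= q)%N.
Proof.
apply: leq_trans (ps_cost w); apply: leq_trans (size_le_cost K _).
rewrite /lw /loops_of; elim: (ps w) => //= x s IH; rewrite size_cat -add1n leq_add //.
by rewrite /loops; case: x.2 => [[]|].
Qed.

Lemma copies_word m w : (0 < copies m w)%N -> word_of (ps w) = w.
Proof.
move=> c0; apply: ps_word; rewrite lt_neqAle eq_sym p0 andbT; apply/eqP => pw.
by move: c0; rewrite /copies pw mulr0 truncn0.
Qed.

Lemma near_copies m w (e a b : nat) : (word_of (ps w) = w -> near e a b) ->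
  near (copies m w * e) (copies m w * a) (copies m w * b).
Proof.
move=> H; have [->|c0] := posnP (copies m w); first by rewrite !mul0n.
by apply: near_mul; apply: H; exact: copies_word c0.
Qed.

Lemma near_size_superblock : exists C, forall m,
  near (q * size (multiset p m) + C) (size (superblock m (multiset p m)))
    (N * size (multiset p m)).
Proof.
exists (\sum_w \sum_(u <- lw w) (closing u).1)%N => m.
have h1 : near (\sum_w \sum_(u <- lw w) (closing u).1) (size (all_loops m))
    (\sum_w copies m w * sumn (map size (lw w))).
  rewrite /all_loops size_flatten /shape -map_comp sumnE big_map big_enum /=.
  apply: near_sum => w; rewrite /loop_part size_flatten /shape -map_comp.
  have := @lw_loop w; elim: (lw w) => [|u l IH] ll; first by rewrite !big_nil muln0.
  rewrite big_cons /= mulnDr; apply: near_add; last by apply: IH => v vl; apply: ll;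
    rewrite mem_tail.
  rewrite /closed_power size_cat size_closing.
  by rewrite size_flatten /shape map_nseq sumn_nseq mulnC /near; clear; lia.
have h2 : size (flatten (map kw (multiset p m))) = (\sum_w copies m w * size (kw w))%N.
  by rewrite size_flatten /shape -map_comp sumnE big_map sum_multiset.
have h3 : near (q * size (multiset p m))
    (\sum_w copies m w * (size (kw w) + sumn (map size (lw w)))) (N * size (multiset p m)).
  rewrite size_multiset_sum !big_distrr /=.
  rewrite (eq_bigr (fun w => copies m w * q)%N); last by move=> w _; rewrite mulnC.
  rewrite [X in near _ _ X](eq_bigr (fun w => copies m w * N)%N); last by move=> w _; rewrite mulnC.
  apply: near_sum => w; apply: near_copies => wE; apply: near_sym.
  apply: near_le (ps_cost w) _; have := near_size (ps_good (w := w)).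
  by rewrite wE size_tuple.
rewrite addnC /superblock size_cat h2; apply: near_trans h3.
under [X in near _ _ X]eq_bigr do rewrite mulnDr.
by rewrite big_split /= -[X in near X _ _]add0n; apply: near_add => //; rewrite /near addn0 leqnn.
Qed.

(** [C] collects the closing words and the junctions around them, and does not grow with [m]. The
    error per word comes from the compression, the junctions inside the powers and those between
    kept parts. *)
Lemma near_occ_superblock r : exists C, forall m s g, perm_eq s (multiset p m) ->
  (size g <= r)%N ->
  near (r.+1 * (4 * q).+1 * size (multiset p m) + C) (occ g (superblock m s))
    (\sum_w copies m w * occ g w).
Proof.
pose C0 := (\sum_w (r + \sum_(u <- lw w) (r + (r + (closing u).1))))%N.
exists (r + C0)%N => m s g sp gr.
have h1 : near (\sum_w copies m w * (r * q) + C0) (occ g (all_loops m))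
    (\sum_w copies m w * sum_occ g (lw w)).
  have h w : near (\sum_(u <- lw w) (size g +
      (copies m w * size g + (size g + (closing u).1))))
      (occ g (loop_part m w)) (copies m w * sum_occ g (lw w)).
    rewrite /sum_occ sumnE big_map big_distrr /=; apply: near_occ_flatten => u.
    rewrite /closed_power; have := near_flatten g (nseq (copies m w) u).
    rewrite size_nseq map_nseq sumn_nseq.
    set x := flatten _; set y := (closing u).2 _.
    have := occ_cat_ge g x y; have := occ_cat_le g x y; have := occ_size g y.
    rewrite size_closing /near !(mulnC _ (copies m w)).
    move: (copies m w * _)%N (copies m w * _)%N => z t.
    by set e := size g; move: (occ g x) (occ g y) (occ g (x ++ y)) (closing u).1; clear; lia.
  have := near_occ_flatten (enum {: W}) h; rewrite !big_enum /=; apply: near_le.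
  rewrite /C0 -[leqRHS]big_split /=; apply: leq_sum => w _.
  have -> : (\sum_(u <- lw w) (size g + (copies m w * size g + (size g + (closing u).1))) =
      copies m w * (size g * size (lw w)) +
      \sum_(u <- lw w) (size g + (size g + (closing u).1)))%N.
    under eq_bigr do rewrite addnCA.
    by rewrite big_split /= big_const_seq count_predT iter_addn_0 mulnA.
  rewrite addnCA; apply: leq_add; first by rewrite leq_mul2l leq_mul ?size_lw ?orbT.
  by apply: leq_add => //; apply: leq_sum => u _; rewrite !leq_add.
have h2 : near (size g * size (multiset p m)) (occ g (flatten (map kw s)))
    (\sum_w copies m w * occ g (kw w)).
  have := near_flatten g (map kw s); rewrite size_map (perm_size sp) -map_comp sumnE big_map.
  by rewrite (perm_big _ sp) sum_multiset.
have h3 : near (\sum_w copies m w * (3 * r.+1 * q))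
    (\sum_w copies m w * (occ g (kw w) + sum_occ g (lw w))) (\sum_w copies m w * occ g w).
  apply: near_sum => w; apply: near_copies => wE; apply: near_sym.
  have := near_compression g (@ps_good w); rewrite wE; apply: near_le.
  by rewrite -!mulnA leq_mul2l leq_mul ?ltnS ?ps_cost ?orbT.
have h4 : near (size g) (occ g (superblock m s)) (occ g (flatten (map kw s)) + occ g (all_loops m)).
  have := occ_cat_ge g (flatten (map kw s)) (all_loops m).
  by have := occ_cat_le g (flatten (map kw s)) (all_loops m); rewrite /near /superblock;
    set e := size g;
    move: (occ g (_ ++ _)) (occ g (flatten _)) (occ g (all_loops m)); clear; lia.
have h5 : (\sum_w copies m w * (occ g (kw w) + sum_occ g (lw w)) =
    \sum_w copies m w * occ g (kw w) + \sum_w copies m w * sum_occ g (lw w))%N.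
  by rewrite -big_split; apply: eq_bigr => w _; rewrite /= mulnDr.
rewrite h5 in h3; have := near_trans h4 (near_trans (near_add h2 h1) h3); apply: near_le.
rewrite -!big_distrl /= -size_multiset_sum; set M := size (multiset p m).
have : (size g * M <= r * M)%N by rewrite leq_mul2r gr orbT.
have -> : (r.+1 * (4 * q).+1 * M = 4 * (r * q * M) + r * M + 4 * (q * M) + M)%N by ring.
have -> : (M * (3 * r.+1 * q) = 3 * (r * q * M) + 3 * (q * M))%N by ring.
have -> : (M * (r * q) = r * q * M)%N by ring.
move: gr; set e := size g; move: (e * M)%N (r * q * M)%N (r * M)%N (q * M)%N (C0).
by clear; lia.
Qed.

Definition marked (x : @symbol k) := x != None.

Definition sides := [seq (x, n) | x <- sparse_words marked q N, n <- iota 0 (N + q).+1].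

Definition side w := (code_of (ps w), size (kw w)).

Lemma side_mem w : 0 < p w -> side w \in sides.
Proof.
move=> pw; have wE := ps_word pw; have [|h1 h2] := @code_size k (ps w).
  by move=> x /ps_good[].
apply/allpairsP; exists (side w); rewrite mem_iota add0n ltnS; split=> //.
  by rewrite mem_filter mem_words h1 wE size_tuple h2 eqxx andbT
    (leq_trans (size_le_cost K _)).
have /andP[_ h] := near_size (@ps_good w).
rewrite wE size_tuple in h; apply: leq_trans (leq_trans h _); rewrite ?leq_addr //.
by rewrite leq_add2l.
Qed.

Definition arrangements m := undup (map (superblock m) (permutations (multiset p m))).

Lemma mem_multiset m w : w \in multiset p m -> 0 < p w.
Proof.
rewrite -has_pred1 has_count count_multiset // => c0.
rewrite lt_neqAle eq_sym p0 andbT; apply/eqP => pw; move: c0.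
by rewrite pw mulr0 truncn0.
Qed.

Lemma kw_inj s t : map side s = map side t -> all (fun w => 0 < p w) s ->
  all (fun w => 0 < p w) t -> flatten (map kw s) = flatten (map kw t) -> s = t.
Proof.
elim: s t => [|w s IH] [|v t] //= [cE kE] sE /andP[pw ps0] /andP[pv pt] /eqP.
rewrite eqseq_cat ?kE // => /andP[/eqP kwE /eqP ke]; congr (_ :: _); last exact: IH.
apply: val_inj; rewrite /= -{1}(ps_word pw) -(ps_word pv).
exact: (code_inj hp (@ps_good w) (@ps_good v) cE kwE).
Qed.

(** Several rearrangements may give the same superblock. The side information makes the map
    injective: the sizes of the kept parts allow the superblock to be cut up, and the codes then
    recover the words. *)
Lemma size_arrangements m : (size (permutations (multiset p m)) <=
  size (arrangements m) * (size sides).+1 ^ size (multiset p m))%N.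
Proof.
pose mark w : 'I_(size sides).+1 := inord (index (side w) sides).
pose f s := (superblock m s, map mark s).
have f_inj : {in permutations (multiset p m) &, injective f}.
  move=> s t; rewrite !mem_permutations => sp tp [/eqP + mE].
  have pos r : perm_eq r (multiset p m) -> all (fun w => 0 < p w) r.
    by move=> rp; apply/allP => w; rewrite (perm_mem rp) => /mem_multiset.
  have ss : size s = size t by rewrite (perm_size sp) (perm_size tp).
  have sideE : map side s = map side t.
    have := pos _ sp; have := pos _ tp; move: mE; clear -ss ps_good ps_word ps_cost.
    elim: s t ss => [|w s IH] [|v t] //= [st] [ie me] /andP[pv pt] /andP[pw pws].
    congr (_ :: _); last exact: IH.
    have sw := side_mem pw; have sv := side_mem pv.
    by rewrite -(nth_index (side w) sw) -[RHS](nth_index (side w) sv);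
      congr nth; move/(congr1 val): ie; rewrite /mark /= !inordK // ltnS ltnW // index_mem.
  rewrite /superblock eqseq_cat; last first.
    rewrite !size_flatten /shape -!map_comp.
    have E : map (size \o kw) =1 map snd \o map side by move=> r /=; rewrite -map_comp.
    by rewrite !E /= sideE.
  by move=> /andP[/eqP kE _]; exact: kw_inj sideE (pos _ sp) (pos _ tp) kE.
rewrite -[X in (X ^ _)%N]card_ord -size_words -(size_map f).
rewrite -(size_allpairs pair); apply: uniq_leq_size.
  by rewrite map_inj_in_uniq ?permutations_uniq.
move=> _ /mapP[s sp ->]; apply/allpairsP; exists (f s); split=> //.
  by rewrite mem_undup; exact: map_f.
by rewrite mem_words size_map; move: sp; rewrite mem_permutations => /perm_size ->.
Qed.

Lemma arrangements_uniq m : uniq (arrangements m).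
Proof. exact: undup_uniq. Qed.

Lemma arrangementsP m u : u \in arrangements m ->
  exists2 s, perm_eq s (multiset p m) & u = superblock m s.
Proof.
by rewrite mem_undup => /mapP[s]; rewrite mem_permutations => sp ->; exists s.
Qed.

End Superblock.

Lemma exists_nat_ge (R : realType) (x : R) : exists n : nat, x <= n%:R.
Proof.
exists (Num.trunc `|x|).+1; apply: le_trans (ler_norm x) _.
by have /andP[_ /ltW] := truncn_itv (normr_ge0 x).
Qed.

Lemma near_natr (R : realType) e a b : near e a b -> `|a%:R - b%:R| <= e%:R :> R.
Proof.
move=> /andP[h1 h2]; rewrite ler_norml; move: h1 h2.
rewrite -!(ler_nat R) !natrD => h1 h2; apply/andP; split; lra.
Qed.

(** * Many full words with prescribed frequencies *)

Section Source.
Context {R : realType} {k : nat}.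
Variables (al be : R) (hp : params k al be).
Variables (c : R) (nu : seq 'I_k -> R).

Definition is_source N (p : N.-tuple 'I_k -> R) :=
  [/\ forall w, 0 <= p w, \sum_w p w = 1, forall w, 0 < p w -> 0 < siz al be w,
      N%:R * c <= \sum_w - p w * ln (p w) &
      forall g, g <> [::] ->
        `|\sum_w p w * (occ g w)%:R - N%:R * nu g| <= (size g)%:R].

Hypothesis nu01 : forall g, 0 <= nu g <= 1.
Hypothesis source : forall N0 : nat, exists N (p : N.-tuple 'I_k -> R),
  (N0 <= N)%N /\ is_source p.

Lemma card_unmarked : #|[pred x | ~~ @marked k x]| = 1%N.
Proof.
rewrite -(card1 (None : @symbol k)); apply: eq_card => x.
by rewrite !inE /marked negbK.
Qed.

Lemma superblocks (e : R) (r B : nat) : 0 < e -> exists La (Ss : seq (seq 'I_k)),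
  [/\ uniq Ss, (B <= La)%N, forall u, u \in Ss -> full al be u /\ size u = La,
      forall u g, u \in Ss -> g <> [::] -> (size g <= r)%N ->
        `|(occ g u)%:R - La%:R * nu g| <= e * La%:R &
      expR (La%:R * (c - e)) <= (size Ss)%:R].
Proof.
(* [d] is the unit in which all errors are measured. The term with [c] in its denominator serves to
   replace [La] by [m * N] in the exponent, where [c - e] may have either sign. *)
move=> e0; pose d := e / (16 * (`|c| + e + 4)).
have c0 := normr_ge0 c.
have d0 : 0 < d by rewrite divr_gt0 // mulr_gt0; lra.
have dE : d * (16 * (`|c| + e + 4)) = e by rewrite divfK //; apply/eqP; lra.
have d16 : 16 * (d * `|c|) + 16 * (d * e) + 64 * d = e by lra.
have dc : 0 <= d * `|c| by rewrite mulr_ge0 // ltW.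
have de : 0 <= d * e by rewrite mulr_ge0 // ltW.
have d4e : 4 * d <= e by lra.
have dce : d * (`|c| + e + 4) <= e / 16 by lra.
have d1 : d <= 1 / 4.
  by rewrite /d ler_pdivrMr; lra.
clearbody d; clear dE d16 c0.
(* The order of the choices: [D] makes the codes and the frequency errors cheap, [N] then outweighs
   the constants of the decomposition, and [m] finally outweighs [X], which gathers the errors
   depending on [N] only. *)
have [D1 D1_gt0 HD1] := ln_size_sparse_words d0 card_unmarked.
have [D2 hD2] := exists_nat_ge (32 * r.+1%:R / d).
pose D := (D1 + D2)%N.
have [K [M0 HM0]] := decomposition hp D.
have [|C3 C30 HC3] := @ln_le_linear R (d / 16); first by lra.
have [n1 hn1] := exists_nat_ge (8 * r.+1%:R / d).
have [n2 hn2] := exists_nat_ge (2 * C3 / d).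
have [N [p [NN0 [p0 p1 ps0 pH pnu]]]] := source (M0 + n1 + n2).+1.
have N_gt0 : (0 < N)%N by exact: leq_trans NN0.
have N0 : 1 <= N%:R :> R by rewrite ler1n.
pose q := (2 * N %/ D)%N.
have D_gt0 : (0 < D)%N by rewrite addn_gt0 D1_gt0.
have Dq : (D * q <= 2 * N)%N by rewrite mulnC leq_trunc_div.
have /choice[ps psP] : forall w : N.-tuple 'I_k, exists s, [/\
    forall x, x \in s -> good_piece al be K x, 0 < p w -> word_of s = w &
    (total_cost K s <= q)%N].
  move=> w; have [pw|pw] := ltP 0 (p w); last first.
    by exists [::]; split => //; move=> /lt_le_trans /(_ pw); rewrite ltxx.
  have [s [sE sg sc]] := HM0 w (ps0 w pw); exists s; split=> //.
  rewrite leq_divRL // mulnC; apply: leq_trans sc _; rewrite size_tuple.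
  by move: NN0; clear; lia.
have ps_good w := let: And3 h _ _ := psP w in h.
have ps_word w := let: And3 _ h _ := psP w in h.
have ps_cost w := let: And3 _ _ h := psP w in h.
have [C1 HC1] := near_size_superblock hp p0 ps_good ps_word ps_cost.
have [C2 HC2] := near_occ_superblock hp p0 ps_good ps_word ps_cost r.
have [C4 HC4] := perms_entropy p0 p1 d0.
pose T : R := #|{: N.-tuple 'I_k}|%:R.
have T0 : 0 <= T by [].
pose X := 2 * (N%:R * T + C1%:R + C2%:R) + `|C4|.
have NT0 : 0 <= N%:R * T by rewrite mulr_ge0.
have X0 : 0 <= X / d.
  have h1 : 0 <= C1%:R :> R by []. have h2 : 0 <= C2%:R :> R by [].
  by rewrite divr_ge0 ?(ltW d0) // /X; have := normr_ge0 C4; lra.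
have [m hm] := exists_nat_ge (X / d + 2 * B%:R + 1).
pose M := size (multiset p m).
have /andP[M1 M2] := size_multiset p0 p1 m; rewrite -/M -/T in M1 M2.
have B0 : 0 <= B%:R :> R by [].
have m0 : 1 <= m%:R :> R by move: hm X0 B0; clear -hp c nu01 source; lra.
have hm1 : X <= d * m%:R by rewrite -ler_pdivrMl // mulrC; move: hm B0; clear -hp c nu01 source;
  lra.
have hmB : 2 * B%:R <= m%:R :> R by move: hm X0; clear -hp c nu01 source; lra.
clear hm X0.
have qd : q%:R * r.+1%:R <= d * N%:R / 16.
  have : D%:R * q%:R <= 2 * N%:R :> R by rewrite -!natrM ler_nat.
  have : 32 * r.+1%:R <= d * D%:R.
    rewrite -ler_pdivrMl // mulrC; apply: le_trans hD2 _.
    by rewrite ler_nat /D leq_addl.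
  have q0 : 0 <= q%:R :> R by [].
  move=> h1 h2; have : 32 * r.+1%:R * q%:R <= d * D%:R * q%:R by rewrite ler_wpM2r.
  have : d * (D%:R * q%:R) <= d * (2 * N%:R) by rewrite ler_wpM2l // ltW.
  by clear -hp c nu01 source; lra.
have rd : r.+1%:R <= d * N%:R / 8.
  have : 8 * r.+1%:R <= d * n1%:R by rewrite -ler_pdivrMl // mulrC.
  have : d * n1%:R <= d * N%:R.
    by rewrite ler_wpM2l ?(ltW d0) // ler_nat; move: NN0; clear; lia.
  by clear -hp c nu01 source; lra.
have C3d : C3 <= d * N%:R / 2.
  have : 2 * C3 <= d * n2%:R by rewrite -ler_pdivrMl // mulrC.
  have : d * n2%:R <= d * N%:R.
    by rewrite ler_wpM2l ?(ltW d0) // ler_nat; move: NN0; clear; lia.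
  by clear -hp c nu01 source; lra.
clear hD2 hn1 hn2.
have q_le : q%:R <= d * N%:R / 16.
  apply: le_trans qd; rewrite ler_peMr //; by rewrite ler1n.
pose La := size (superblock hp K p ps m (multiset p m)).
have LaE : `|La%:R - m%:R * N%:R| <= d * m%:R * N%:R.
  have := near_natr R (HC1 m); rewrite -/La -/M !natrD !natrM => h.
  have : `|N%:R * M%:R - m%:R * N%:R| <= N%:R * T.
    rewrite mulrC -mulrBl normrM [X in _ * X]ger0_norm // mulrC ler_wpM2l //.
    by rewrite ler_norml; move: M1 M2 T0; clear -hp c nu01 source => *; apply/andP; split; lra.
  have : q%:R * M%:R <= d * N%:R / 16 * m%:R by rewrite ler_pM.
  have h3 : d * m%:R <= d * m%:R * N%:R by rewrite ler_peMr // mulr_ge0 // ltW.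
  have h4 : 0 <= C1%:R :> R by []. have h5 : 0 <= C2%:R :> R by [].
  have := normr_ge0 C4; rewrite /X in hm1.
  move: hm1 h3 h4 h5 NT0 h; clear -hp c nu01 source => hm1 h3 h4 h5 NT0.
  by rewrite !ler_norml => /andP[? ?] ? ? /andP[? ?]; apply/andP; split; lra.
have mN : m%:R <= m%:R * N%:R :> R by rewrite ler_peMr.
have dmN : 0 <= d * m%:R * N%:R by rewrite !mulr_ge0 // ltW.
have d4 : d * m%:R * N%:R <= 1 / 4 * (m%:R * N%:R) by rewrite -mulrA ler_wpM2r // mulr_ge0.
have La_ge : m%:R * N%:R / 2 <= La%:R :> R.
  by move: LaE d4; rewrite ler_norml; clear => /andP[? ?] ?; lra.
exists La, (arrangements hp K p ps m); split.
- exact: arrangements_uniq.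
- by rewrite -(ler_nat R); move: La_ge mN hmB; clear -hp c nu01 source; lra.
- move=> u /arrangementsP[s sp ->]; split; first exact: superblock_full.
  exact: size_superblock.
- move=> u g /arrangementsP[s sp ->] g0 gr.
  have := near_natr R (HC2 m s g sp gr); rewrite -/M natrD natr_sum.
  set S := \sum_i _ => h1.
  have h2 : `|S - m%:R * \sum_w p w * (occ g w)%:R| <= N%:R * T.
    rewrite mulr_sumr -sumrB; apply: le_trans (ler_norm_sum _ _ _) _.
    have -> : N%:R * T = \sum_(w : N.-tuple 'I_k) N%:R by rewrite sumr_const mulr_natr.
    apply: ler_sum => w _; rewrite natrM mulrA -mulrBl normrM [X in _ * X]ger0_norm //.
    rewrite -[leRHS]mul1r ler_pM // ?normr_ge0 //.
      have /andP[t1 t2] := trunc_bounds p0 m w; rewrite ler_norml /copies.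
      by move: t1 t2; clear => *; apply/andP; split; lra.
    by rewrite ler_nat; apply: leq_trans (occ_size _ _) _; rewrite size_tuple.
  have h3 : `|m%:R * (\sum_w p w * (occ g w)%:R) - m%:R * N%:R * nu g| <= m%:R * r%:R.
    rewrite -mulrA -mulrBr normrM ger0_norm // ler_wpM2l //.
    by apply: le_trans (pnu _ g0) _; rewrite ler_nat.
  have h4 : `|m%:R * N%:R * nu g - La%:R * nu g| <= d * m%:R * N%:R.
    rewrite -mulrBl normrM distrC; have /andP[v0 v1] := nu01 g.
    by rewrite [X in _ * X]ger0_norm // -[leRHS]mulr1 ler_pM.
  have h5 : (r.+1 * (4 * q).+1 * M)%:R <= (d * N%:R / 4 + d * N%:R / 8) * m%:R :> R.
    rewrite natrM ler_pM // natrM -[(4 * q).+1%:R]natr1 natrM.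
    by move: qd rd; clear -hp c nu01 source; lra.
  have h6 : m%:R * r%:R <= m%:R * (d * N%:R / 8) :> R.
    by rewrite ler_wpM2l //; apply: le_trans rd; rewrite ler_nat.
  have h7 : d * m%:R <= d * m%:R * N%:R by rewrite ler_peMr // mulr_ge0 // ltW.
  have h8 : 0 <= C1%:R :> R by []. have h9 : 0 <= C2%:R :> R by [].
  have h10 := normr_ge0 C4; rewrite /X in hm1.
  have h11 : 2 * (d * m%:R * N%:R) <= e * La%:R.
    apply: (@le_trans _ _ (e * (m%:R * N%:R / 2))); last by rewrite ler_wpM2l // ltW.
    have : 4 * d * (m%:R * N%:R) <= e * (m%:R * N%:R).
      by rewrite ler_wpM2r ?mulr_ge0 //; move: d4e; clear -hp c nu01 source; lra.
    by clear -hp c nu01 source; lra.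
  apply: le_trans h11.
  rewrite (_ : _ - _ = (occ g (superblock hp K p ps m s))%:R - S +
    (S - m%:R * \sum_w p w * (occ g w)%:R) +
    (m%:R * (\sum_w p w * (occ g w)%:R) - m%:R * N%:R * nu g) +
    (m%:R * N%:R * nu g - La%:R * nu g)); last by ring.
  apply: le_trans (ler_normD _ _) _; apply: le_trans (lerD (ler_normD _ _) h4) _.
  apply: le_trans (lerD (lerD (ler_normD _ _) h3) (lexx _)) _.
  by move: h1 h2 h5 h6 h7 h8 h9 h10 hm1; clear -hp c nu01 source; lra.
have perms0 : (0 < size (permutations (multiset p m)))%N.
  have : multiset p m \in permutations (multiset p m) by rewrite mem_permutations.
  by case: permutations.
have : ln (size (permutations (multiset p m)))%:R <=
    ln (size (arrangements hp K p ps m))%:R + M%:R * ln (size (@sides k N q)).+1%:R :> R.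
  have := size_arrangements hp p0 ps_good ps_word ps_cost m; rewrite -/M => h.
  have A0 : (0 < size (arrangements hp K p ps m))%N.
    by rewrite lt0n; apply/eqP => A0; move: h; rewrite A0 mul0n leqNgt perms0.
  have : ln (size (permutations (multiset p m)))%:R <=
      ln ((size (arrangements hp K p ps m) * (size (@sides k N q)).+1 ^ M)%N)%:R :> R.
    by rewrite ler_ln ?posrE ?ltr0n ?ler_nat // muln_gt0 A0 expn_gt0.
  rewrite natrM natrX lnM ?posrE ?ltr0n ?exprn_gt0 // lnXn //.
  by rewrite -[ln _ *+ M]mulr_natl.
have := HC4 m; have : m%:R * (N%:R * c) <= m%:R * (\sum_w - p w * ln (p w)).
  by rewrite ler_wpM2l.
have lnsides : ln (size (@sides k N q)).+1%:R <= 2 * d * N%:R.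
  have := HD1 q N (leq_trans (leq_mul (leq_addr _ _) (leqnn q)) Dq).
  rewrite /sides size_allpairs size_iota.
  set A := size _; have qN : (q <= 2 * N)%N by rewrite (leq_trans _ Dq) // leq_pmull.
  have h1 : ((A * (N + q).+1).+1 <= maxn 1 A * (8 * N))%N.
    have h0 : ((N + q).+1 <= 4 * N)%N by move: qN N_gt0; clear; lia.
    case: (A) => [|A']; first by move: N_gt0; clear; lia.
    rewrite (maxn_idPr _) //; have : (0 < A'.+1 * N)%N by rewrite muln_gt0.
    have := leq_mul (leqnn A'.+1) h0; rewrite [(_ * (4 * N))%N]mulnCA [(_ * (8 * N))%N]mulnCA.
    by move: (A'.+1 * _)%N (A'.+1 * N)%N; clear; lia.
  move=> h2; apply: (@le_trans _ _ (ln (maxn 1 A)%:R + ln (8 * N%:R))).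
    rewrite -lnM ?posrE ?mulr_gt0 ?ltr0n ?leq_maxl // ler_ln ?posrE ?mulr_gt0 ?ltr0n ?leq_maxl //.
    by rewrite -!natrM ler_nat.
  have h3 : ln (maxn 1 A)%:R <= d * N%:R.
    case: (posnP A) => [->|A0]; last by rewrite (maxn_idPr _).
    by rewrite maxn0 ln1 mulr_ge0 // ltW.
  have := HC3 (8 * N%:R); rewrite mulr_gt0 ?ltr0n // => /(_ isT).
  by move: h3 C3d; clear -hp c nu01 source; lra.
have Mln : M%:R * ln (size (@sides k N q)).+1%:R <= m%:R * (2 * d * N%:R).
  by rewrite ler_pM // ln_ge0 // ler1n.
move=> h1 h2 h3; rewrite -[leRHS]lnK; last first.
  rewrite posrE ltr0n lt0n; apply/eqP => A0.
  have := size_arrangements hp p0 ps_good ps_word ps_cost m.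
  by rewrite A0 mul0n leqNgt perms0.
rewrite ler_expR.
have h4 : La%:R * (c - e) <= m%:R * N%:R * (c - e) + d * m%:R * N%:R * (`|c| + e).
  rewrite -lerBlDl -mulrBl; apply: le_trans (ler_norm _) _; rewrite normrM ler_pM //.
  by apply: le_trans (ler_normB _ _) _; rewrite (gtr0_norm e0).
have h5 : d * m%:R <= d * m%:R * N%:R by rewrite ler_peMr // mulr_ge0 // ltW.
have h6 : 0 <= C1%:R :> R by []. have h7 : 0 <= C2%:R :> R by [].
have h8 := ler_norm C4; rewrite /X in hm1.
have h9 : (d * (`|c| + e + 4)) * (m%:R * N%:R) <= e / 16 * (m%:R * N%:R).
  by rewrite ler_wpM2r ?mulr_ge0 //; move: dce; clear -hp c nu01 source; lra.
have h10 : 0 <= e * (m%:R * N%:R) by rewrite !mulr_ge0 // ltW.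
by move: h1 h2 h3 h4 h5 h6 h7 h8 h9 h10 Mln hm1 NT0 dmN mN; clear -hp c nu01 source; lra.
Qed.

End Source.

(** * The topology of the shift *)

Section Fullshift.
Variable k : nat.
Implicit Types (w : fullshift k) (u : seq 'I_k).

Definition pre w n : seq 'I_k := mkseq (w : nat -> 'I_k) n.

Lemma size_pre w n : size (pre w n) = n.
Proof. exact: size_mkseq. Qed.

Lemma preS w n : pre w n.+1 = rcons (pre w n) (w n).
Proof. exact: mkseqS. Qed.

Lemma pre_eqP w w' n : pre w n = pre w' n <-> forall i, (i < n)%N -> w i = w' i.
Proof.
split=> [E i ik|E]; last by apply/eq_in_map => i; rewrite mem_iota => /andP[_ /E].
have := congr1 (fun s => nth (w i) s i) E.
by rewrite !nth_mkseq.
Qed.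

Lemma take_pre w m n : (m <= n)%N -> take m (pre w n) = pre w m.
Proof. by move=> mn; rewrite /pre /mkseq -map_take take_iota (minn_idPl mn). Qed.

Lemma nbhs_fullshift w (B : set (fullshift k)) : nbhs w B ->
  exists n, forall w', pre w' n = pre w n -> B w'.
Proof.
move=> wB; pose F := filter_from [set: nat] (fun n => [set w' : fullshift k | pre w' n = pre w n]).
have FF : Filter F.
  apply: filter_from_filter; first by exists 0%N.
  move=> i j _ _; exists (maxn i j) => // w' /= E.
  by split; apply/pre_eqP => l lt; apply: (pre_eqP _ _ _).1 E _ _;
    rewrite leq_max lt ?orbT.
suff /(_ _ wB)[n _ nB] : F --> w by exists n => w' /nB.
apply/cvg_sup => i A [_ [[C oC <-] Cw] CA]; exists i.+1 => // w' /= E; apply: CA.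
by rewrite /= ((pre_eqP w' w i.+1).1 E i (leqnn _)).
Qed.

Lemma nbhs_pre w n : nbhs w [set w' : fullshift k | pre w' n = pre w n].
Proof.
elim: n => [|n IH]; first by apply: filterS filterT => w'.
have H : nbhs w ((fun w' : fullshift k => w' n) @^-1` [set w n]).
  have := @proj_continuous nat (fun _ => discrete_topology 'I_k) n w; apply.
  exact: (@discrete_set1 (discrete_topology 'I_k)).
apply: filterS (filterI IH H) => w' [/= E1 E2].
by rewrite !preS E1 E2.
Qed.

Lemma open_pre n u : open [set w : fullshift k | pre w n = u].
Proof. by rewrite openE => w /= <-; exact: nbhs_pre. Qed.

End Fullshift.

Section Itineraries.
Context {R : realType} (alpha beta : R).
Hypothesis ha : 0 <= alpha < 1.
Hypothesis hb : 2 < beta.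
Local Notation k := (ab_k alpha beta).
Implicit Types (x y : R) (w : fullshift k) (u v : seq 'I_k) (c : 'I_k).

Local Ltac param := have [? ?] := andP ha; have ? := hb.

Lemma ab_params : params k alpha beta.
Proof.
param; have c0 : 0 <= Num.ceil (alpha + beta) by rewrite ceil_ge0; lra.
have kE : k%:R = (Num.ceil (alpha + beta))%:~R :> R by rewrite /ab_k natr_absz ger0_norm.
have h := ceil_itv (alpha + beta).
by split=> //; rewrite kE; move: h; rewrite intrB => /andP[? ?]; lra.
Qed.

(** The three shapes of the intervals become one: for the first and the last letter the inequality
    absent from the definition follows from [params]. *)
Lemma ab_itvE c x : ab_itv alpha beta c.+1 x <->
  [/\ 0 < x, x < 1, c%:R < beta * x + alpha & beta * x + alpha < c%:R + 1].
Proof.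
param; have [_ _ k1 k2] := ab_params.
have b0 : 0 < beta by lra.
rewrite /ab_itv eqSS; case: eqP => [->|/eqP c0].
  rewrite /= in_itv /= ltr_pdivlMr // ; split=> [/andP[x0 x1]|[x0 x1 _ x2]].
    have : beta * x < beta * 1 by lra.
    by rewrite ltr_pM2l // => ?; split=> //; nra.
  by rewrite x0 /=; lra.
have c1 : 1 <= c%:R :> R by rewrite ler1n lt0n.
case: eqP => [ck|/eqP ck].
  have cE : k%:R = c%:R + 1 :> R by rewrite natr1 ck.
  rewrite /= in_itv /= -[c.+1%:R]natr1 ltr_pdivrMr //.
  split=> [/andP[x0 x1]|[x0 x1 x2 x3]]; last by apply/andP; split; lra.
  by split; nra.
have ck' : c%:R + 2 <= k%:R :> R.
  have : (c.+2 <= k)%N by rewrite ltn_neqAle ck ltn_ord.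
  by rewrite -(ler_nat R) -[c.+2%:R]natr1 -[c.+1%:R]natr1; lra.
rewrite /= in_itv /= -[c.+1%:R]natr1 ltr_pdivrMr // ltr_pdivlMr //.
split=> [/andP[x0 x1]|[x0 x1 x2 x3]]; last by apply/andP; split; lra.
by split; nra.
Qed.

Lemma ab_mapE c x : c%:R < beta * x + alpha -> beta * x + alpha < c%:R + 1 ->
  ab_map alpha beta x = beta * x + alpha - c%:R.
Proof.
move=> c1 c2; rewrite /ab_map (@floor_def _ _ (Posz c)) ?pmulrn //.
by rewrite intrD; apply/andP; split; lra.
Qed.

Lemma itinerary_state w x n : itinerary x w ->
  lft alpha beta 0 (pre w n) < iter n (ab_map alpha beta) x < rgt alpha beta 1 (pre w n).
Proof.
param; move=> xw; elim: n => [|n /andP[IH1 IH2]].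
  by have /ab_itvE[/= -> -> _ _] := xw 0%N.
have /ab_itvE[t0 t1 t2 t3] := xw n; rewrite preS lft_rcons rgt_rcons iterS (ab_mapE t2 t3).
by rewrite gt_max lt_min; apply/andP; split; apply/andP; split; nra.
Qed.

Lemma state_point u y : lft alpha beta 0 u < y < rgt alpha beta 1 u ->
  exists x, [/\ 0 < x < 1, iter (size u) (ab_map alpha beta) x = y &
    forall i c, (i < size u)%N -> nth c u i = c ->
      ab_itv alpha beta c.+1 (iter i (ab_map alpha beta) x)].
Proof.
param; elim/last_ind: u y => [|u c IH] y; first by move=> yb; exists y.
rewrite lft_rcons rgt_rcons gt_max lt_min => /andP[/andP[y0 y1] /andP[y2 y3]].
pose z := (y + c%:R - alpha) / beta.
have zE : beta * z = y + c%:R - alpha by rewrite /z mulrCA divff ?mulr1 //; apply/eqP; lra.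
have [|x [x01 xz xu]] := IH z.
  have b0 : 0 < beta by lra.
  by rewrite -(ltr_pM2l b0 _ z) -(ltr_pM2l b0 z) zE; apply/andP; split; lra.
have zl := lft_ge0 alpha beta u (lexx 0); have zr := rgt_le1 alpha beta u (lexx 1).
exists x; rewrite size_rcons; split=> //.
  by rewrite iterS xz (@ab_mapE c); lra.
move=> i d; rewrite ltnS leq_eqVlt nth_rcons => /orP[/eqP ->|iu].
  rewrite ltnn eqxx => <-; rewrite xz; apply/ab_itvE; split; try lra.
    have b0 : 0 < beta by lra.
    by rewrite -(ltr_pM2l b0) zE; nra.
  have b0 : 0 < beta by lra.
  by rewrite -(ltr_pM2l b0) zE; nra.
by rewrite iu; exact: xu.
Qed.

(** Some point follows a full word and then lands on a given point [x0] of [ab_X], so its whole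
    orbit avoids the branch points. This approximates [w] by itineraries, and the shift is their
    closure. *)
Lemma full_in_shift w :
  (forall n, exists v, full alpha beta (pre w n ++ v)) -> @ab_shift R alpha beta w.
Proof.
move=> Hw B /nbhs_fullshift[n nB].
have [w1 cw1] := ab_shift_nonempty ha hb.
have [|w0 [[x0 Xx0 x0w0] _]] := cw1 setT; first exact: filterT.
have [v [lv rv]] := Hw n; set u := pre w n ++ v in lv rv.
have /ab_itvE[/= t0 t1 _ _] := x0w0 0%N.
have [|x [x01 xy xu]] := @state_point u x0; first by rewrite lv rv t0 t1.
pose w' : fullshift k := fun i => if (i < size u)%N then nth (w0 0%N) u i else w0 (i - size u)%N.
have xw' : itinerary x w'.
  move=> i; rewrite /w'; case: ltnP => iu; first by apply: xu => //; exact: set_nth_default.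
  by rewrite -{2}(subnK iu) iterD xy; exact: x0w0.
exists w'; split.
  exists x => // i _; exists (w' i : 'I_k).+1; first exact: ltn_ord (w' i).
  exact: xw'.
apply: nB; apply/pre_eqP => i iN; rewrite /w' /u size_cat size_pre ltn_addr //.
by rewrite nth_cat size_pre iN nth_mkseq.
Qed.

Lemma ab_shift_siz w n : @ab_shift R alpha beta w -> 0 < siz alpha beta (pre w n).
Proof.
move=> cw; have [w' [[x _ xw'] /= E]] := cw _ (nbhs_pre w n).
by rewrite -E subr_gt0; have /andP[] := itinerary_state n xw'; exact: lt_trans.
Qed.

End Itineraries.

Section ShiftSpace.
Context {R : realType} {alpha beta : R}.
Context {ha : 0 <= alpha < 1} {hb : 2 < beta}.
Local Notation k := (ab_k alpha beta).
Local Notation Sigma := (ab_space ha hb).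
Implicit Types (x y z : Sigma) (u v : seq 'I_k) (d : Sigma -> Sigma -> R).

Definition prx x n : seq 'I_k := pre (val x) n.

Lemma size_prx x n : size (prx x n) = n.
Proof. exact: size_pre. Qed.

Lemma ab_space_shift x : @ab_shift R alpha beta (val x).
Proof. exact: set_mem (valP x). Qed.

Lemma nbhs_sigma x (B : set Sigma) : nbhs x B ->
  exists n, forall y, prx y n = prx x n -> B y.
Proof.
move=> [_ [[C oC <-] Cx] CB].
have [n nC] := nbhs_fullshift (open_nbhs_nbhs (conj oC Cx)).
by exists n => y E; apply: CB; exact: nC.
Qed.

Lemma open_cyl n u : open [set x : Sigma | prx x n = u].
Proof. by exists [set w : fullshift k | pre w n = u]; first exact: open_pre. Qed.

Lemma nbhs_cyl x n : nbhs x [set y : Sigma | prx y n = prx x n].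
Proof. exact: open_nbhs_nbhs (conj (open_cyl _ _) erefl). Qed.

Lemma val_ab_sigma x i : (val (ab_sigma ha hb x) : fullshift k) i = (val x : fullshift k) i.+1.
Proof. by []. Qed.

Lemma val_iter_sigma x n i :
  (val (iter n (ab_sigma ha hb) x) : fullshift k) i = (val x : fullshift k) (n + i)%N.
Proof. by elim: n i => // n IH i; rewrite iterS val_ab_sigma IH addnS. Qed.

Lemma prx_iter x m n : prx (iter m (ab_sigma ha hb) x) n = take n (drop m (prx x (m + n))).
Proof.
apply: (@eq_from_nth _ (val x 0%N)) => [|i].
  by rewrite size_take size_drop !size_prx addKn ltnn.
rewrite size_prx => iN; rewrite nth_take // nth_drop !nth_mkseq ?ltn_add2l //.
exact: val_iter_sigma.
Qed.

Lemma prx_take x m n : (m <= n)%N -> take m (prx x n) = prx x m.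
Proof. exact: take_pre. Qed.

(* Koenig's lemma, i.e. the compactness of the shift space *)
Lemma uniform_prefix (P : seq 'I_k -> Prop) : (forall u v, P u -> P (u ++ v)) ->
  (forall x, exists n, P (prx x n)) -> exists n, forall x, P (prx x n).
Proof.
move=> Pcat HP; apply: contrapT => /forallNP nP.
have mono x m n : (m <= n)%N -> P (prx x m) -> P (prx x n).
  by move=> mn; rewrite -(prx_take x mn) => /(@Pcat _ (drop m (prx x n))); rewrite cat_take_drop.
pose bad u := forall n, exists x, prx x (size u) = u /\ ~ P (prx x n).
have bad0 : bad [::] by move=> n; have /existsNP[x xP] := nP n; exists x.
have badS u : exists c, bad u -> bad (rcons u c).
  apply: contrapT => /forallNP nb.
  have bu c : bad u /\ exists n, forall x, prx x (size u).+1 = rcons u c -> P (prx x n).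
    have /not_implyP[bu /existsNP[n /forallNP Hn]] := nb c; split => //; exists n => x.
    by move=> E; apply: contrapT => nPx; apply: (Hn x); rewrite size_rcons.
  have /choice[f fP] := fun c => (bu c).2.
  pose c0 : 'I_k := (val (ab_point ha hb) : fullshift k) 0%N.
  have [x [xu xP]] := (bu c0).1 (\max_c f c).
  apply: xP; apply: (mono x (f ((val x : fullshift k) (size u)))); first exact: leq_bigmax.
  by apply: fP; rewrite /prx preS -/(prx _ _) xu.
have [next nextP] := choice badS.
pose pfx := fix pfx n := if n is n'.+1 then rcons (pfx n') (next (pfx n')) else [::].
pose w : fullshift k := fun n => next (pfx n).
have wE n : pre w n = pfx n by elim: n => // n IH; rewrite preS IH.
have badw n : bad (pfx n) by elim: n => //= n /nextP.
have sz n : size (pfx n) = n by rewrite -wE size_pre.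
have cw : @ab_shift R alpha beta w.
  apply: closed_closure => B /nbhs_fullshift[n nB].
  have [x [xE _]] := badw n 0%N; exists (val x); split; first exact: ab_space_shift.
  by apply: nB; rewrite wE -xE sz.
have [n] := HP (SigSub (mem_set cw)); rewrite /prx /= wE => Pn.
have [x [xE]] := badw n n; rewrite sz in xE; by rewrite xE.
Qed.

Lemma uniform_cylinders (Q : Sigma -> Sigma -> Prop) :
  (forall z, exists n, forall x y, prx x n = prx z n -> prx y n = prx z n -> Q x y) ->
  exists n, forall x y, prx x n = prx y n -> Q x y.
Proof.
move=> H; pose P u := forall x y, prx x (size u) = u -> prx y (size u) = u -> Q x y.
have [u v Pu x y|z|n nP] := @uniform_prefix P.
- rewrite size_cat => xE yE; have su := leq_addr (size v) (size u).
  by apply: Pu; rewrite -(prx_take _ su) ?xE ?yE take_size_cat.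
- by have [n nQ] := H z; exists n => x y; rewrite size_prx; exact: nQ.
by exists n => x y E; apply: (nP x); rewrite size_prx.
Qed.

Lemma metric_small d (e : R) : compatible_metric d -> 0 < e ->
  exists n, forall x y, prx x n = prx y n -> d x y <= e.
Proof.
move=> [_ dsym dtri dnbhs] e0; apply: uniform_cylinders => z.
have e20 : 0 < e / 2 by lra.
have [n nB] : exists n, forall y, prx y n = prx z n -> d z y < e / 2.
  apply: (@nbhs_sigma z [set y | d z y < e / 2]); apply/dnbhs.
  by exists (e / 2).
exists n => x y /nB h1 /nB h2; have := dtri x z y; rewrite (dsym x z); lra.
Qed.

Lemma metric_expansive d : compatible_metric d ->
  exists2 e : R, 0 < e & forall x y, d x y <= e -> prx x 1 = prx y 1.
Proof.
move=> [_ dsym dtri dnbhs].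
(* The prefix length also serves as the inverse of a distance, so that the single [n] given by
   compactness controls both. *)
pose P u := forall x y, prx x (size u) = u -> d x y < (size u).+1%:R^-1 -> prx x 1 = prx y 1.
have [u v Pu x y|z|n nP] := @uniform_prefix P.
- rewrite size_cat => xE xy; apply: Pu; last first.
    by apply: lt_le_trans xy _; rewrite lef_pV2 ?posrE ?ltr0n // ler_nat ltnS leq_addr.
  by rewrite -(prx_take _ (leq_addr (size v) (size u))) xE take_size_cat.
- have [e e0 eB] := (dnbhs z _).1 (nbhs_cyl z 1).
  have e20 : 0 < e / 2 by lra.
  have [n nB] : exists n, forall y, prx y n = prx z n -> d z y < e / 2.
    apply: (@nbhs_sigma z [set y | d z y < e / 2]); apply/dnbhs; by exists (e / 2).
  pose m := (Num.trunc (2 / e)).+1.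
  have m_e : m%:R^-1 <= e / 2.
    have : 2 / e < m%:R by have /andP[] := @truncn_itv R (2 / e) (divr_ge0 (ler0n _ 2) (ltW e0)).
    rewrite -[e / 2]invrK invf_div => h; rewrite lef_pV2 ?posrE ?divr_gt0 ?ltr0n //; exact: ltW.
  exists (n + m)%N => x y; rewrite size_prx => xz xy.
  have zx : d z x < e / 2.
    by apply: nB; rewrite -(prx_take _ (leq_addr m n)) xz prx_take // leq_addr.
  have xy2 : d x y < e / 2.
    apply: lt_le_trans xy _; apply: le_trans m_e.
    by rewrite lef_pV2 ?posrE ?ltr0n // ler_nat leqW // leq_addl.
  have -> : prx x 1 = prx z 1 by apply: eB; rewrite /=; lra.
  by apply/esym; apply: eB; rewrite /=; have := dtri z x y; lra.
exists (n.+2%:R^-1); first by rewrite invr_gt0 ltr0n.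
move=> x y xy; apply: (nP x); rewrite size_prx //; apply: le_lt_trans xy _.
by rewrite ltf_pV2 ?posrE ?ltr0n // ltr_nat.
Qed.

Lemma continuous_cylinders (g : Sigma -> R) (e : R) : continuous g -> 0 < e ->
  exists n, forall x y, prx x n = prx y n -> `|g x - g y| <= e.
Proof.
move=> cg e0; apply: uniform_cylinders => z.
have e20 : 0 < e / 2 by lra.
have [n nB] : exists n, forall y, prx y n = prx z n -> `|g z - g y| < e / 2.
  by apply: (@nbhs_sigma z [set y | `|g z - g y| < e / 2]);
    by have /cvgrPdist_lt /(_ _ e20) := cg z.
exists n => x y /nB h1 /nB h2.
rewrite (_ : g x - g y = (g z - g y) - (g z - g x)); last by ring.
by apply: le_trans (ler_normB _ _) _; lra.
Qed.

End ShiftSpace.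

(** * Measures of cylinders and frequencies *)

Section CylinderMeasures.
Context {R : realType} {alpha beta : R}.
Context {ha : 0 <= alpha < 1} {hb : 2 < beta}.
Local Notation k := (ab_k alpha beta).
Local Notation Sigma := (ab_space ha hb).
Local Notation sg := (ab_sigma ha hb).
Implicit Types (x y : Sigma) (u v g : seq 'I_k) (L : seq (seq 'I_k)).

Definition cyl u : set (borel Sigma) := [set x | prx (x : Sigma) (size u) = u].

Definition prefix_in n L : set (borel Sigma) := [set x | prx (x : Sigma) n \in L].

Lemma open_borel (A : set Sigma) : open A -> measurable (A : set (borel Sigma)).
Proof. by move=> oA; apply: (@sub_sigma_algebra _ setT (@open Sigma)). Qed.

Lemma measurable_cyl u : measurable (cyl u).
Proof. by apply: open_borel; exact: open_cyl. Qed.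

Lemma prefix_in_nil n : prefix_in n [::] = set0.
Proof. by apply/seteqP; split. Qed.

Lemma prefix_in_cons n w L : size w = n -> prefix_in n (w :: L) = cyl w `|` prefix_in n L.
Proof.
move=> wn; rewrite /prefix_in /cyl wn; apply/seteqP; split => x /=.
  by rewrite inE => /orP[/eqP|]; [left|right].
by rewrite inE => -[->|->]; rewrite ?eqxx ?orbT.
Qed.

Lemma measurable_prefix_in n L : (forall w, w \in L -> size w = n) -> measurable (prefix_in n L).
Proof.
elim: L => [|w L IH] H; first by rewrite prefix_in_nil; exact: measurable0.
rewrite prefix_in_cons; last by apply: H; rewrite inE eqxx.
apply: measurableU; first exact: measurable_cyl.
by apply: IH => v vL; apply: H; rewrite mem_tail.
Qed.

Lemma cyl_disjoint n w L : size w = n -> w \notin L -> cyl w `&` prefix_in n L = set0.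
Proof.
move=> wn wL; rewrite -subset0 => x [/=]; rewrite /cyl /prefix_in /= wn => -> wL'.
by rewrite wL' in wL.
Qed.

Lemma prefix_in_words n : prefix_in n (words 'I_k n) = setT.
Proof. by rewrite -subTset => x _; rewrite /prefix_in /= mem_words size_prx. Qed.

Lemma continuous_measurable (f : Sigma -> R) : continuous f ->
  measurable_fun [set: borel Sigma] (f : borel Sigma -> R).
Proof.
move=> cf; apply: (measurability _ (measurable_realfun.RGenOInfty.measurableE R)) =>
  _ [_ [a ->] <-].
rewrite setTI; apply: open_borel; apply: open_comp; last exact: rray_open.
by move=> ? _; exact: cf.
Qed.

Variable nu : {measure set (borel Sigma) -> \bar R}.
(** An inequality, so that the empirical measure with [n = 0], which is zero, is covered. *)
Hypothesis nu1 : (nu setT <= 1)%E.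

Lemma nu_fin A : measurable A -> nu A \is a fin_num.
Proof.
move=> mA; rewrite ge0_fin_numE //; apply: le_lt_trans (ltry 1).
by apply: le_trans nu1; apply: le_measure; rewrite ?inE //; exact: measurableT.
Qed.

Definition mass A := fine (nu A).

Lemma mass_ge0 A : 0 <= mass A.
Proof. exact/fine_ge0. Qed.

Lemma massU A B : measurable A -> measurable B -> A `&` B = set0 ->
  mass (A `|` B) = mass A + mass B.
Proof. by move=> mA mB AB; rewrite /mass measureU // fineD //; exact: nu_fin. Qed.

Lemma mass_prefix_in n L : uniq L -> (forall w, w \in L -> size w = n) ->
  mass (prefix_in n L) = \sum_(w <- L) mass (cyl w).
Proof.
elim: L => [_ _|w L IH /= /andP[wL uL] H].
  by rewrite big_nil prefix_in_nil /mass measure0.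
have wn : size w = n by apply: H; rewrite inE eqxx.
have LH v : v \in L -> size v = n by move=> vL; apply: H; rewrite mem_tail.
rewrite big_cons prefix_in_cons // massU ?IH //; first exact: measurable_cyl.
  exact: measurable_prefix_in.
exact: cyl_disjoint.
Qed.

Lemma sum_mass_words n : \sum_(w <- words 'I_k n) mass (cyl w) = mass setT.
Proof.
rewrite -(prefix_in_words n) mass_prefix_in ?uniq_words // => w.
by rewrite mem_words => /eqP.
Qed.

Lemma mass_le1 A : measurable A -> mass A <= 1.
Proof.
move=> mA; rewrite -[1]/(fine 1%E) fine_le ?nu_fin //.
by apply: le_trans nu1; apply: le_measure; rewrite ?inE //; exact: measurableT.
Qed.

Lemma Rintegral_approx (f : Sigma -> R) (e : R) (c : seq 'I_k -> R) n :
  continuous f -> (forall x : Sigma, `|f x - c (prx x n)| <= e) ->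
  `|\int[nu]_x f (x : Sigma) - \sum_(w <- words 'I_k n) c w * mass (cyl w)| <= e * mass setT.
Proof.
move=> cf fc.
have mf := continuous_measurable cf.
have nuoo A : measurable A -> (nu A < +oo)%E.
  by move=> mA; have := nu_fin mA; rewrite ge0_fin_numE.
have bI A (h : borel Sigma -> R) M : measurable A -> measurable_fun setT h ->
    (forall x, `|h x| <= M) -> nu.-integrable A (EFin \o h).
  move=> mA mh hM; apply: measurable_bounded_integrable => //; first exact: nuoo.
    exact: measurable_funS mh.
  exists M; split; first exact: num_real.
  by move=> M' MM' x _; apply: le_trans (ltW MM'); exact: hM.
have cstI A r : measurable A -> nu.-integrable A (EFin \o (fun=> r)).
  by move=> mA; apply: (bI _ _ `|r|) => //; exact: measurable_cst.
have fI A : measurable A -> nu.-integrable A (EFin \o (f : borel Sigma -> R)).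
  move=> mA; apply: (bI _ _ (e + \sum_(w <- words 'I_k n) `|c w|)) => // x.
  have := fc x; have := ler_normD (f x - c (prx x n)) (c (prx x n)); rewrite subrK.
  rewrite (big_rem (prx x n)) /=; last by rewrite mem_words size_prx.
  have : 0 <= \sum_(w <- rem (prx x n) (words 'I_k n)) `|c w| by rewrite sumr_ge0.
  by lra.
have cyl_int w : size w = n ->
    `|\int[nu]_(x in cyl w) f (x : Sigma) - c w * mass (cyl w)| <= e * mass (cyl w).
  move=> wn; have mw := measurable_cyl w.
  have fcw x : cyl w x -> c w - e <= f x <= c w + e.
    by move=> xw; have := fc x; rewrite -wn xw ler_norml => /andP[? ?]; apply/andP; split; lra.
  rewrite ler_norml; apply/andP; split.
    rewrite lerBrDl -mulNr -mulrDl -Rintegral_cst //.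
    by apply: le_Rintegral => // [||x /fcw/andP[]]; [exact: cstI|exact: fI|].
  rewrite lerBlDl -mulrDl -Rintegral_cst //.
  by apply: le_Rintegral => // [||x /fcw/andP[]]; [exact: fI|exact: cstI|].
have H L : uniq L -> (forall w, w \in L -> size w = n) ->
    `|\int[nu]_(x in prefix_in n L) f (x : Sigma) - \sum_(w <- L) c w * mass (cyl w)|
    <= e * mass (prefix_in n L).
  elim: L => [_ _|w L IH /= /andP[wL uL] LH].
    by rewrite big_nil prefix_in_nil /mass measure0 mulr0 Rintegral_set0 subrr normr0.
  have wn : size w = n by apply: LH; rewrite inE eqxx.
  have LH' v : v \in L -> size v = n by move=> vL; apply: LH; rewrite mem_tail.
  have dj := cyl_disjoint wn wL; have mL := measurable_prefix_in LH'.
  have mw := measurable_cyl w.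
  rewrite big_cons prefix_in_cons // massU // Rintegral_setU //; first last.
  - by rewrite disj_set2E; apply/eqP.
  - by apply: fI; exact: measurableU.
  have := cyl_int w wn; have := IH uL LH'; rewrite mulrDr.
  by move=> h1 h2; rewrite opprD addrACA; apply: le_trans (ler_normD _ _) _; lra.
rewrite -{1}(prefix_in_words n); rewrite -(prefix_in_words n).
by apply: H => [|w]; rewrite ?uniq_words // mem_words => /eqP.
Qed.

End CylinderMeasures.

Lemma sum_tuple_words (R : realType) (T : finType) n (F : seq T -> R) :
  \sum_(w : n.-tuple T) F w = \sum_(w <- words T n) F w.
Proof.
rewrite -big_enum /= -(big_map val xpredT F).
apply: perm_big; apply: uniq_perm.
- by rewrite map_inj_uniq ?enum_uniq //; exact: val_inj.
- exact: uniq_words.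
move=> w; rewrite mem_words; apply/mapP/eqP => [[t _ ->]|wn]; first exact: size_tuple.
by exists (Tuple (introT eqP wn)); rewrite ?mem_enum.
Qed.

Lemma occE (T : eqType) (g w : seq T) :
  occ g w = (\sum_(j < size w) prefix g (drop j w))%N.
Proof.
elim: w => [|c w IH]; first by rewrite big_ord0.
by rewrite occ_cons big_ord_recl drop0 IH.
Qed.

Lemma sum_late n r : (\sum_(j < n) (n < j + r) <= r)%N.
Proof.
have [nr|rn] := leqP n r.
  apply: leq_trans nr; rewrite -[leqRHS]card_ord -sum1_card; apply: leq_sum => j _.
  exact: leq_b1.
rewrite -(big_mkord xpredT (fun j => (n < j + r : nat)%N)) (@big_cat_nat _ _ _ (n - r)) ?leq_subr
  //=.
rewrite big_nat big1 => [|j /andP[_ h]]; last first.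
  by apply/eqP; rewrite eqb0 -leqNgt; move: h rn; clear; lia.
rewrite add0n (@leq_trans (\sum_(n - r <= j < n) 1)%N) //.
  by apply: leq_sum => j _; exact: leq_b1.
by rewrite sum_nat_const_nat muln1 subKn // ltnW.
Qed.

Section Frequencies.
Context {R : realType} {alpha beta : R}.
Context {ha : 0 <= alpha < 1} {hb : 2 < beta}.
Local Notation k := (ab_k alpha beta).
Local Notation Sigma := (ab_space ha hb).
Local Notation sg := (ab_sigma ha hb).
Implicit Types (x y : Sigma) (u v g : seq 'I_k).

Definition visits g x n : nat := (\sum_(j < n) (prx (iter j sg x) (size g) == g))%N.

Lemma take_drop_prx x n j r : (j + r <= n)%N ->
  take r (drop j (prx x n)) = prx (iter j sg x) r.
Proof.
move=> jr; have sz : size (take r (drop j (prx x n))) = r.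
  by rewrite size_takel // size_drop size_prx leq_subRL ?(leq_trans _ jr) ?leq_addr.
apply: (@eq_from_nth _ ((val x : fullshift k) 0%N)) => [|i]; first by rewrite sz size_prx.
rewrite sz => ir; rewrite nth_take // nth_drop !nth_mkseq //.
  by rewrite val_iter_sigma.
by apply: leq_trans jr; rewrite ltn_add2l.
Qed.

Lemma prefix_prx g x n j : (j + size g <= n)%N ->
  prefix g (drop j (prx x n)) = (prx (iter j sg x) (size g) == g).
Proof. by move=> jn; rewrite prefixE take_drop_prx. Qed.

Lemma prefix_late g (w : seq 'I_k) j : g <> [::] -> (size w < j + size g)%N ->
  prefix g (drop j w) = false.
Proof.
move=> g0 h; apply/negP => /size_prefix; rewrite size_drop leqNgt => /negP; apply.
have : (0 < size g)%N by case: g g0 h.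
by move: h; move: (size w) (size g) => a b; clear; lia.
Qed.

(** [visits] also counts windows reaching beyond the first [n] letters; these start at the last
    positions, at most [size g] of them. *)
Lemma near_visits g x n : g <> [::] -> near (size g) (visits g x n) (occ g (prx x n)).
Proof.
move=> g0; rewrite occE size_prx /visits /near; apply/andP; split.
  apply: (@leq_trans (occ g (prx x n) + \sum_(j < n) (n < j + size g))%N); last first.
    by rewrite occE size_prx leq_add2l sum_late.
  rewrite occE size_prx -big_split /=; apply: leq_sum => j _.
  have [jn|jn] := leqP (j + size g) n; first by rewrite prefix_prx // leq_addr.
  by apply: leq_trans (leq_b1 _) _; rewrite addn1.
apply: leq_trans (leq_addr _ _); apply: leq_sum => j _.
have [jn|jn] := leqP (j + size g) n; first by rewrite prefix_prx.
by rewrite prefix_late // size_prx.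
Qed.

Lemma empiricalE x n (A : set (borel Sigma)) : empirical_measure sg x n A =
  ((\sum_(j < n) (iter j sg x \in A)%:R) / n%:R : R)%:E.
Proof.
have -> : empirical_measure sg x n A =
    ((n%:R^-1)%:E * \sum_(j < n) @dirac _ (borel Sigma) (iter j sg x) R A)%E by [].
under eq_bigr do rewrite diracE.
by rewrite sumEFin -EFinM mulrC.
Qed.

Lemma empirical_cyl g x n : mass (empirical_measure sg x n) (cyl g) =
  (visits g x n)%:R / n%:R :> R.
Proof.
rewrite /mass empiricalE /= /visits natr_sum; congr (_ / _).
by apply: eq_bigr => j _; congr (nat_of_bool _)%:R; apply/idP/eqP => [/set_mem|/mem_set].
Qed.

Lemma empirical_setT x n : ((empirical_measure sg x n : {measure set (borel Sigma) -> \bar R})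
  setT <= 1)%E.
Proof.
rewrite empiricalE lee_fin.
under eq_bigr do rewrite in_setT.
rewrite sumr_const card_ord.
have [->|n0] := posnP n; first by rewrite mulr0n mul0r.
by rewrite divff // pnatr_eq0 -lt0n.
Qed.

Variable mu : probability (borel Sigma) R.

Lemma mu_setT : (mu setT <= 1)%E.
Proof. by rewrite probability_setT. Qed.

Lemma mass_setT : mass mu setT = 1.
Proof. exact: (congr1 fine (probability_setT mu)). Qed.

Lemma continuous_indic g : continuous (fun x : Sigma => (prx x (size g) == g)%:R : R).
Proof.
move=> x U Ux; apply: (@filterS _ (nbhs x) (nbhs_filter x) _ _ _ (nbhs_cyl x (size g))) => y /= E.
by rewrite /= E; exact: nbhs_singleton Ux.
Qed.

Lemma Rintegral_cyl (nu : {measure set (borel Sigma) -> \bar R}) g : (nu setT <= 1)%E ->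
  \int[nu]_x ((prx (x : Sigma) (size g) == g)%:R : R) = mass nu (cyl g).
Proof.
move=> nu1; have := Rintegral_approx (nu := nu) (e := 0) nu1
  (c := fun w => (w == g)%:R) (n := size g) (@continuous_indic g).
rewrite mul0r normr_le0 subr_eq0 => H.
rewrite (eqP (H _)) => [|x]; last by rewrite subrr normr0.
rewrite (big_rem g) /=; last by rewrite mem_words.
rewrite eqxx mul1r big_seq big1 ?addr0 // => w.
by rewrite mem_rem_uniq ?uniq_words // inE => /andP[/negPf -> _]; rewrite mul0r.
Qed.

Lemma generic_visits x g : generic_points sg mu x ->
  (visits g x n)%:R / n%:R @[n --> \oo] --> mass mu (cyl g).
Proof.
move=> /(_ _ (@continuous_indic g)); rewrite Rintegral_cyl ?mu_setT //.
by under eq_fun do rewrite Rintegral_cyl ?empirical_setT // empirical_cyl.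
Qed.

Lemma visits_generic x :
  (forall g, (visits g x n)%:R / n%:R @[n --> \oo] --> mass mu (cyl g)) ->
  generic_points sg mu x.
Proof.
move=> H f cf; apply/cvgrPdist_le => e e0; have e3 : 0 < e / 3 by lra.
have [m mP] := continuous_cylinders cf e3.
pose c w := if pselect (exists y, prx y m = w) is left h then f (projT1 (cid h)) else 0.
have fc y : `|f y - c (prx y m)| <= e / 3.
  rewrite /c; case: pselect => [h|]; last by case; exists y.
  by apply: mP; case: cid.
have cvgS : \sum_(w <- words 'I_k m) c w * ((visits w x n)%:R / n%:R) @[n --> \oo] -->
    \sum_(w <- words 'I_k m) c w * mass mu (cyl w).
  elim: (words _ _) => [|w L IH].
    by under eq_fun do rewrite big_nil; rewrite big_nil; exact: cvg_cst.
  under eq_fun do rewrite big_cons; rewrite big_cons.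
  by apply: cvgD => //; apply: cvgMr; exact: H.
have /cvgrPdist_le /(_ _ e3) := cvgS; apply: filterS => n hn.
have h1 := Rintegral_approx (nu := empirical_measure sg x n) (empirical_setT x n) cf fc.
have h2 := Rintegral_approx mu_setT cf fc; rewrite mass_setT mulr1 in h2.
have h3 : e / 3 * mass (empirical_measure sg x n) setT <= e / 3.
  by rewrite -[leRHS]mulr1 ler_wpM2l ?mass_le1 ?empirical_setT //; lra.
have {}h1 := le_trans h1 h3.
move: h1 h2 hn; under eq_bigr do rewrite empirical_cyl.
 set I1 := \int[_]__ _; set I2 := \int[_]__ _; set S1 := \sum_(_ <- _) _; set S2 := \sum_(_ <- _) _.
by rewrite !ler_norml => /andP[? ?] /andP[? ?] /andP[? ?]; apply/andP; split; lra.
Qed.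

End Frequencies.

(** * Counting typical words *)

Section TypicalWords.
Variables (R : realType) (T : finType) (m : seq T -> R).
Hypothesis m_ge0 : forall u, 0 <= m u.
Hypothesis m_cons : forall u, \sum_c m (c :: u) = m u.
Local Notation K := (#|T|%:R : R).
Implicit Types (u v w : seq T) (c : T) (z : R).

Definition block_entropy n := \sum_(w <- words T n) - m w * ln (m w).

(** The conditional probability of the first letter given the following ones. Adding [z] to every
    block keeps the logarithms finite on blocks of mass 0. *)
Definition smoothed z v := (m v + z) / (m (behead v) + K * z).

(** An upper bound on the frequencies is enough, because it is multiplied by the nonpositive numbers
    [ln (smoothed z v)]. *)
Definition typical (r : nat) (e : R) n w :=
  all (fun v => (occ v w)%:R <= n%:R * m v + n%:R * e) (words T r).

Lemma sum_words_cons n (F : seq T -> R) :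
  \sum_(w <- words T n.+1) F w = \sum_(w <- words T n) \sum_c F (c :: w).
Proof. by rewrite big_allpairs_dep exchange_big; apply: eq_bigr => w _; rewrite big_enum. Qed.

Lemma m_cons_le c u : m (c :: u) <= m u.
Proof. by rewrite -(m_cons u) (bigD1 c) //= lerDl sumr_ge0. Qed.

Section Smoothed.
Variable z : R.
Hypothesis z0 : 0 < z.

Lemma smoothed_den c u : 0 < m u + K * z.
Proof. by rewrite ltr_wpDl // mulr_gt0 // ltr0n; apply/card_gt0P; exists c. Qed.

Lemma smoothed_gt0 c u : 0 < smoothed z (c :: u).
Proof. by rewrite divr_gt0 ?(smoothed_den c) // ltr_wpDl. Qed.

Lemma sum_smoothed c u : \sum_c' smoothed z (c' :: u) = 1.
Proof.
rewrite /smoothed /= -mulr_suml big_split /= m_cons sumr_const -[z *+ _]mulr_natl divff //.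
by rewrite gt_eqF // (smoothed_den c).
Qed.

Lemma smoothed_le1 c u : smoothed z (c :: u) <= 1.
Proof.
rewrite -(sum_smoothed c u) (bigD1 c) //= lerDl sumr_ge0 // => c' _.
by rewrite ltW // smoothed_gt0.
Qed.

Variable r : nat.

(* The Markov measure of order [r] with the smoothed transition probabilities,
   read from right to left. *)
Fixpoint coding_mass w : R := if w is c :: w' then
  (if (r <= size w')%N then smoothed z (c :: take r w') else 1) * coding_mass w' else 1.

Lemma coding_mass_gt0 w : 0 < coding_mass w.
Proof.
elim: w => //= c w IH; rewrite mulr_gt0 //; case: ifP => // _; exact: smoothed_gt0.
Qed.

(* Kraft's inequality *)
Lemma sum_coding_mass n : (0 < #|T|)%N -> \sum_(w <- words T n) coding_mass w <= K ^+ r.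
Proof.
(* The last [r] letters of a word get weight 1 each, hence the exponent [minn n r]. *)
move=> T0; suff -> : \sum_(w <- words T n) coding_mass w = K ^+ minn n r.
  by rewrite ler_weXn2l ?geq_minr // ler1n.
have /card_gt0P[c0 _] := T0.
elim: n => [|n IH]; first by rewrite big_seq1 min0n expr0.
rewrite sum_words_cons big_seq; under eq_bigr => w /[!mem_words]/eqP wn.
  rewrite /= wn -mulr_suml; over.
rewrite -big_seq /=; have [rn|nr] := leqP r n.
  rewrite (minn_idPr (leqW rn)) -(minn_idPr rn) -IH.
  by apply: eq_bigr => w _; rewrite (sum_smoothed c0) mul1r.
rewrite -mulr_sumr IH (minn_idPl (ltnW nr)) (minn_idPl nr) exprS.
by rewrite sumr_const.
Qed.

Lemma ln_coding_mass w : ln (coding_mass w) =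
  \sum_(v <- words T r.+1) (occ v w)%:R * ln (smoothed z v).
Proof.
elim: w => [|c w IH].
  rewrite ln1 big_seq big1 // => v; rewrite mem_words.
  by case: v => // a v _; rewrite mul0r.
rewrite [coding_mass _]/= lnM ?posrE ?coding_mass_gt0 //; last first.
  by case: ifP => // _; exact: smoothed_gt0.
have uW := uniq_words T r.+1; have memW v := mem_words r.+1 v.
set W := words T r.+1 in uW memW IH *.
rewrite IH; under [RHS]eq_bigr do rewrite occ_cons natrD mulrDl.
rewrite big_split; congr (_ + _); case: leqP => rw; last first.
  rewrite ln1 big_seq big1 // => v; rewrite memW => /eqP vr.
  case E: (prefix v (c :: w)); rewrite ?mul0r //; have := size_prefix E; rewrite vr /=.
  by rewrite ltnS leqNgt rw.
rewrite (big_rem (c :: take r w)); last by rewrite memW /= size_takel.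
rewrite prefixE [size _]/= size_takel // [take _ (c :: w)]/= eqxx mul1r big_seq.
rewrite big1 => [|v]; first exact/esym/addr0.
rewrite mem_rem_uniq // inE memW => /andP[vc /eqP vr].
by rewrite prefixE vr [take _ _]/= eq_sym (negPf vc) mul0r.
Qed.

(** Smoothing raises the numerator, and raises the logarithm of the denominator by at most
    [K * z / m u]; so each of the [K ^+ r.+1] blocks loses at most [K * z]. *)
Lemma entropy_smoothed :
  - (block_entropy r.+1 - block_entropy r) - K ^+ r.+2 * z <=
  \sum_(v <- words T r.+1) m v * ln (smoothed z v).
Proof.
pose f u c := m (c :: u) * ln (m (c :: u)) - m (c :: u) * ln (m u) - K * z.
have -> : - (block_entropy r.+1 - block_entropy r) - K ^+ r.+2 * z =
    \sum_(u <- words T r) \sum_c f u c.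
  have HE n : block_entropy n = - \sum_(w <- words T n) m w * ln (m w).
    by rewrite -sumrN; apply: eq_bigr => w _; rewrite mulNr.
  rewrite !{}HE; under [in RHS]eq_bigr do rewrite /f !sumrB -mulr_suml m_cons sumr_const.
  rewrite !sumrB -(sum_words_cons r (fun w => m w * ln (m w))) big_const_seq count_predT
    iter_addr_0 size_words.
  rewrite -[(K * z) *+ _]mulr_natl -[_ *+ (_ ^ _)]mulr_natl natrX !exprS; ring.
rewrite sum_words_cons; apply: ler_sum => u _; apply: ler_sum => c _.
have mc0 := m_ge0 (c :: u); have mu0 := m_ge0 u; have mcu := m_cons_le c u.
have Kz : 0 < K * z by rewrite mulr_gt0 // ltr0n; apply/card_gt0P; exists c.
rewrite /f /smoothed /= lnM ?posrE ?invr_gt0 ?ltr_wpDl // lnV ?posrE ?ltr_wpDl //.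
have [->|mc] := eqVneq (m (c :: u)) 0; first by rewrite !mul0r subrr sub0r oppr_le0 ltW.
have {mc mc0} mc : 0 < m (c :: u) by rewrite lt_neqAle eq_sym mc.
have mu : 0 < m u by exact: lt_le_trans mcu.
have h1 : ln (m (c :: u)) <= ln (m (c :: u) + z) by rewrite ler_ln ?posrE ?ltr_wpDl ?(ltW mc) //
  lerDl ltW.
have h2 : ln (m u + K * z) - ln (m u) <= K * z / m u.
  rewrite -ln_div ?posrE ?ltr_wpDl //.
  apply: le_trans (ln_le_sub1 _) _; first by rewrite divr_gt0 // ltr_wpDl.
  by rewrite mulrDl divff ?gt_eqF //; lra.
have h3 : m (c :: u) * (K * z / m u) <= K * z.
  by rewrite mulrCA -[leRHS]mulr1 ler_wpM2l ?(ltW Kz) // ler_pdivrMr // mul1r.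
have := ler_wpM2l (ltW mc) h1; have := ler_wpM2l (ltW mc) h2.
rewrite mulrBr mulrDr mulrN; lra.
Qed.

End Smoothed.

Lemma size_typical r (gamma : R) : 0 < gamma -> (0 < #|T|)%N -> exists2 e : R, 0 < e &
  forall n, (size [seq w <- words T n | typical r.+1 e n w])%:R <=
    K ^+ r * expR (n%:R * (block_entropy r.+1 - block_entropy r + gamma)).
Proof.
move=> g0 T0; have K0 : 0 < K by rewrite ltr0n.
have Kr0 : 0 < K ^+ r.+2 by rewrite exprn_gt0.
(* Half of [gamma] pays for the smoothing, through [z]; the other half pays for the frequency error,
   through [e] below. *)
pose z := gamma / (2 * K ^+ r.+2); have z0 : 0 < z by rewrite divr_gt0 // mulr_gt0.
have Kz : K ^+ r.+2 * z = gamma / 2 by rewrite /z; field; rewrite gt_eqF.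
pose C := \sum_(v <- words T r.+1) - ln (smoothed z v).
have lnQ v : v \in words T r.+1 -> ln (smoothed z v) <= 0.
  by rewrite mem_words; case: v => // c v _;
    rewrite -ln1 ler_ln ?posrE ?smoothed_gt0 // smoothed_le1.
have C0 : 0 <= C by rewrite /C big_seq sumr_ge0 // => v /lnQ; rewrite oppr_ge0.
pose e := gamma / (2 * (C + 1)).
have e0 : 0 < e by rewrite divr_gt0 //; lra.
have eC : e * C <= gamma / 2.
  by rewrite /e -mulrA ler_wpM2l ?(ltW g0) // invfM -mulrA ler_piMr ?invr_ge0 // mulrC
    ler_pdivrMr; lra.
exists e => // n; set D := block_entropy r.+1 - block_entropy r.
have typ w : typical r.+1 e n w -> expR (- (n%:R * (D + gamma))) <= coding_mass z r w.
  move=> /allP tw; rewrite -[leRHS]lnK ?posrE ?coding_mass_gt0 // ler_expR ln_coding_mass //.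
  apply: (@le_trans _ _ (\sum_(v <- words T r.+1) (n%:R * m v + n%:R * e) * ln (smoothed z v))).
    rewrite (eq_bigr (fun v => n%:R * (m v * ln (smoothed z v)) - n%:R * e * - ln (smoothed z
      v))); last by move=> v _; ring.
    rewrite sumrB -!mulr_sumr -/C -mulrN -mulrA -mulrBr ler_wpM2l ?ler0n //.
    by have := entropy_smoothed z0 r; rewrite Kz -/D; lra.
  rewrite big_seq [leRHS]big_seq; apply: ler_sum => v vr.
  by rewrite ler_wnM2r ?lnQ //; exact: tw.
rewrite -ler_pdivrMr ?expR_gt0 // -expRN.
apply: le_trans (sum_coding_mass z0 r n T0).
rewrite -sum1_size natr_sum mulr_suml big_filter big_mkcond /=; apply: ler_sum => w _.
by case: ifP => [/typ|_]; rewrite ?mul1r // ltW // coding_mass_gt0.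
Qed.
End TypicalWords.

(** * Block probabilities of an invariant measure *)

Section InvariantMeasure.
Context {R : realType} {alpha beta : R}.
Context {ha : 0 <= alpha < 1} {hb : 2 < beta}.
Local Notation k := (ab_k alpha beta).
Local Notation Sigma := (ab_space ha hb).
Local Notation sg := (ab_sigma ha hb).
Implicit Types (x y : Sigma) (u v g : seq 'I_k).
Variables (mu : probability (borel Sigma) R) (hmu : invariant_measure sg mu).
Local Notation m g := (mass mu (cyl (ha := ha) (hb := hb) g)).
Local Notation m_ := (fun g => m g).

Lemma mass_cyl_ge0 g : 0 <= m g.
Proof. exact: mass_ge0. Qed.

Lemma mass_cyl_le1 g : m g <= 1.
Proof. by apply: mass_le1; [exact: mu_setT|exact: measurable_cyl]. Qed.

Lemma sum_mass_cyl n : \sum_(w <- words 'I_k n) m w = 1.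
Proof. by rewrite sum_mass_words ?mass_setT //; exact: mu_setT. Qed.

Lemma mass_visit g j : mass mu [set x | prx (iter j sg (x : Sigma)) (size g) = g] = m g.
Proof.
elim: j => // j <-.
have mA : measurable ([set x | prx (iter j sg (x : Sigma)) (size g) = g] : set (borel Sigma)).
  rewrite (_ : mkset _ = prefix_in (j + size g)
      [seq w <- words 'I_k (j + size g) | take (size g) (drop j w) == g]).
    by apply: measurable_prefix_in => w; rewrite mem_filter mem_words => /andP[_ /eqP].
  apply/seteqP; split => x; rewrite /prefix_in /= mem_filter mem_words size_prx eqxx andbT.
    by rewrite take_drop_prx // => /eqP.
  by rewrite take_drop_prx // => /eqP.
apply: etrans (congr1 fine (hmu mA)); congr (fine (mu _)).
by apply/seteqP; split => x; rewrite /preimage /= -iterSr.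
Qed.

Lemma sum_mass_window g j n : (j + size g <= n)%N ->
  \sum_(w <- words 'I_k n | prefix g (drop j w)) m w = m g.
Proof.
move=> jn; rewrite -(mass_visit g j) -big_filter -(@mass_prefix_in _ _ _ _ _ mu _ n).
- congr (mass mu _); apply/seteqP; split => x;
  rewrite /prefix_in /= mem_filter mem_words size_prx eqxx andbT.
    by rewrite prefix_prx // => /eqP.
  by rewrite prefix_prx // => /eqP.
- exact: mu_setT.
- by rewrite filter_uniq // uniq_words.
by move=> w; rewrite mem_filter mem_words => /andP[_ /eqP].
Qed.

(** By invariance each window that fits into the word contributes [m g], and at most [size g]
    windows do not fit. *)
Lemma mean_occ g n : g <> [::] ->
  `|\sum_(w <- words 'I_k n) m w * (occ g w)%:R - n%:R * m g| <= (size g)%:R.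
Proof.
move=> g0.
have -> : \sum_(w <- words 'I_k n) m w * (occ g w)%:R =
    \sum_(j < n) (j + size g <= n)%:R * m g.
  rewrite big_seq (eq_bigr (fun w => \sum_(j < n) m w * (prefix g (drop j w))%:R)); last first.
    by move=> w; rewrite mem_words => /eqP wn; rewrite occE wn natr_sum mulr_sumr.
  rewrite -big_seq exchange_big /=; apply: eq_bigr => j _.
  have [jn|jn] := leqP (j + size g) n.
    rewrite mul1r -(sum_mass_window jn) [RHS]big_mkcond; apply: eq_bigr => w _.
    by case: ifP; rewrite ?mulr1 ?mulr0.
  rewrite mul0r big_seq big1 // => w; rewrite mem_words => /eqP wn.
  by rewrite prefix_late ?wn // mulr0.
have -> : n%:R * m g = \sum_(j < n) m g by rewrite sumr_const card_ord mulr_natl.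
rewrite distrC -sumrB; have m0 := mass_cyl_ge0 g; have m1 := mass_cyl_le1 g.
rewrite (eq_bigr (fun j : 'I_n => (n < j + size g)%:R * m g)); last first.
  by move=> j _; rewrite ltnNge; case: (_ <= _)%N; rewrite ?mul1r ?mul0r ?subrr ?subr0.
rewrite -mulr_suml -natr_sum normrM ger0_norm ?ler0n // ger0_norm //.
apply: le_trans (ler_wpM2l (ler0n _ _) m1) _; rewrite mulr1 ler_nat; exact: sum_late.
Qed.

Lemma mass_siz w : 0 < m w -> 0 < siz alpha beta w.
Proof.
move=> mw; have [x xw] : (cyl (ha := ha) (hb := hb) w) !=set0.
  by apply/set0P/eqP => E; move: mw; rewrite /= E /mass measure0 ltxx.
by rewrite -xw; apply: (ab_shift_siz ha hb); exact: ab_space_shift.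
Qed.

Lemma invariant_source c N : N%:R * c <= block_entropy m_ N ->
  is_source alpha beta c m_ (fun w : N.-tuple 'I_k => m w).
Proof.
move=> cN; split.
- by move=> w; exact: mass_cyl_ge0.
- by rewrite (sum_tuple_words N (fun w => m w)) sum_mass_cyl.
- by move=> w; exact: mass_siz.
- by rewrite (sum_tuple_words N (fun w => - m w * ln (m w))).
move=> g g0; rewrite (sum_tuple_words N (fun w => m w * (occ g w)%:R)).
exact: mean_occ.
Qed.

Lemma metric_entropyE : metric_entropy mu = limn (fun n => n%:R^-1 * block_entropy m_ n).
Proof.
rewrite /metric_entropy; congr (limn _); apply/funext => n; congr (_ * _).
rewrite /block_entropy -(sum_tuple_words n (fun w => - m w * ln (m w))) big_mkcond /=.
apply: eq_bigr => w _.
have -> : cylinder w = cyl w :> set (borel Sigma).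
  apply/seteqP; split => x; rewrite /cyl size_tuple /prx /= => H.
    apply: (@eq_from_nth _ (val x 0%N)) => [|i]; rewrite size_pre ?size_tuple // => ni.
    by rewrite nth_mkseq // (H (Ordinal ni)) (tnth_nth (val x 0%N)).
  by move=> i; rewrite (tnth_nth (val x 0%N)) -H nth_mkseq.
case: asboolP => // E; suff -> : cyl w = set0 :> set (borel Sigma).
  by rewrite /mass measure0 oppr0 mul0r.
by apply/eqP/negPn/negP => /set0P.
Qed.

End InvariantMeasure.

(** * The upper bound *)

Lemma ler_sum_sub (R : realType) (T : eqType) (s l : seq T) (f : T -> R) :
  (forall x, 0 <= f x) -> uniq s -> {subset s <= l} -> \sum_(x <- s) f x <= \sum_(x <- l) f x.
Proof.
move=> f0; elim: s l => [|x s IH] l; first by rewrite big_nil sumr_ge0.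
move=> /= /andP[xs us] sl; rewrite big_cons [leRHS](big_rem x) /=; last by rewrite sl ?mem_head.
rewrite lerD2l IH // => y ys; have /negPf yx : y != x by apply: contraNneq xs => <-.
by have := sl y; rewrite inE ys orbT => /(_ isT);
  rewrite (perm_mem (perm_to_rem (sl x (mem_head _ _)))) inE yx.
Qed.

Lemma esum_le_bound (R : realType) (T : choiceType) (S : set T) (a : T -> R) (B : R) :
  (forall s : seq T, uniq s -> (forall x, x \in s -> S x) -> \sum_(x <- s) a x <= B) ->
  (\esum_(x in S) (a x)%:E <= B%:E)%E.
Proof.
move=> H; apply: ge_ereal_sup => _ [A [fA AS] <-].
rewrite fsbig_finite // sumEFin lee_fin H ?finmap.fset_uniq // => x.
by rewrite in_fset_set // => /set_mem /AS.
Qed.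

Lemma sum_geometric_iota (R : realType) (x : R) N n : 0 <= x < 1 ->
  \sum_(i <- iota N n) x ^+ i <= x ^+ N / (1 - x).
Proof.
move=> /andP[x0 x1]; elim: n N => [|n IH] N.
  by rewrite big_nil divr_ge0 ?exprn_ge0 // subr_ge0 ltW.
rewrite big_cons; apply: le_trans (lerD (lexx _) (IH N.+1)) _.
rewrite le_eqVlt; apply/orP; left; apply/eqP; rewrite exprS; field.
by rewrite subr_eq0 gt_eqF.
Qed.

Section UpperBound.
Context {R : realType} {alpha beta : R}.
Context {ha : 0 <= alpha < 1} {hb : 2 < beta}.
Local Notation k := (ab_k alpha beta).
Local Notation Sigma := (ab_space ha hb).
Local Notation sg := (ab_sigma ha hb).
Implicit Types (x y : Sigma) (u v g w : seq 'I_k).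
Variables (mu : probability (borel Sigma) R) (hmu : invariant_measure sg mu).
Variables (d : Sigma -> Sigma -> R) (hd : compatible_metric d).
Local Notation m g := (mass mu (cyl (ha := ha) (hb := hb) g)).
Local Notation m_ := (fun g => m g).

Lemma sum_mass_cons u : \sum_c m (c :: u) = m u.
Proof.
rewrite -(sum_mass_window hmu (g := u) (j := 1) (n := (size u).+1)) ?add1n //.
rewrite [RHS]big_mkcond sum_words_cons [RHS](big_rem u) /=; last by rewrite mem_words.
rewrite -[LHS]addr0; congr (_ + _).
  by apply: eq_bigr => c _; rewrite drop0 prefix_refl.
rewrite big_seq big1 // => w; rewrite mem_rem_uniq ?uniq_words // inE mem_words =>
  /andP[wu /eqP su].
by rewrite big1 // => c _; rewrite drop0 prefixE -su take_size (negPf wu).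
Qed.

Lemma generic_typical x r (e : R) N : generic_points sg mu x -> 0 < e ->
  exists2 n, (N <= n)%N & typical m_ r.+1 e n (prx x n).
Proof.
move=> Gx e0; have e2 : 0 < e / 2 by lra.
have ev : \forall n \near \oo, forall v, v \in words 'I_k r.+1 ->
    `|m v - (visits v x n)%:R / n%:R| < e / 2.
  elim: (words _ _) => [|v L IH]; first by near=> n => v.
  have /cvgrPdist_lt /(_ _ e2) hv := generic_visits (g := v) Gx.
  near=> n => u; rewrite inE => /predU1P[->|uL]; first by near: n.
  by move: u uL; near: n.
have [n0 n0P] := exists_nat_ge (r.+1%:R / (e / 2)).
have [n1 _ n1P] := ev.
have [n [Nn n0n n1n n_gt]] : exists n, [/\ N <= n, n0 <= n, n1 <= n & 0 < n]%N.
  by exists (N + n0 + n1).+1; move: (N) (n0) (n1) => a b c; clear; split; lia.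
exists n => //; apply/allP => v vr; have h := n1P n n1n v vr.
have n_gt0 : 0 < n%:R :> R by rewrite ltr0n.
have h3 : (visits v x n)%:R / n%:R * n%:R = (visits v x n)%:R :> R by rewrite divfK // gt_eqF.
have sv : size v = r.+1 by apply/eqP; rewrite -(@mem_words 'I_k).
have v0 : v <> [::] by move=> v0; rewrite v0 in sv.
have /andP[_] := near_visits x n v0; rewrite sv -(ler_nat R) natrD => h2.
have h1 : r.+1%:R <= n%:R * (e / 2).
  by rewrite -ler_pdivrMr //; apply: le_trans n0P _; rewrite ler_nat.
set f := (visits v x n)%:R / n%:R in h h3; move: h; rewrite ltr_norml => /andP[h4 h5].
have : (f - m v) * n%:R <= e / 2 * n%:R by rewrite ler_pM2r //; lra.
by rewrite mulrBl h3; lra.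
Unshelve. all: by end_near.
Qed.

Lemma bowen_ball_prefix (eps : R) L x y n :
  (forall x y, prx x L = prx y L -> d x y <= eps) ->
  prx x (n + L) = prx y (n + L) -> bowen_ball d sg n x eps y.
Proof.
move=> hL E j jn; apply: hL; rewrite !prx_iter.
have jL : (j + L <= n + L)%N by rewrite leq_add2r ltnW.
by rewrite -!(prx_take _ jL) E.
Qed.

(** The cover consists of the typical words of all lengths from [N1] on, a word of length [n] giving
    a ball of order [n - L]. Since [s = D + 2 * gamma], the weights are dominated by a geometric
    series of ratio [expR (- gamma)]. *)
Lemma premeasure_small r (s eps : R) N : 0 < eps ->
  block_entropy m_ r.+1 - block_entropy m_ r < s ->
  bowen_premeasure d sg (generic_points sg mu) s N eps = 0%E.
Proof.
move=> eps0; set D := _ - _ => Ds; apply/eqP; rewrite eq_le; apply/andP; split; last first.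
  apply: le_ereal_inf_tmp => _ [G _ <-]; apply: esum_ge0 => p _.
  by rewrite lee_fin expR_ge0.
apply/lee_addgt0Pr => eta eta0; rewrite add0e.
pose gamma := (s - D) / 2; have g0 : 0 < gamma by rewrite /gamma; lra.
have k0 : (0 < #|'I_k|)%N by apply/card_gt0P; exists ((val (ab_point ha hb) : fullshift k) 0%N).
have [e e0 eP] := size_typical (fun u => mass_cyl_ge0 mu u) sum_mass_cons r g0 k0.
have [L LP] := metric_small hd eps0.
pose Typ n := [seq w <- words 'I_k n | typical m_ r.+1 e n w].
pose x := expR (- gamma); have x01 : 0 <= x < 1 by rewrite expR_ge0 expR_lt1; lra.
pose C := #|'I_k|%:R ^+ r * expR (s * L%:R).
have C0 : 0 < C by rewrite mulr_gt0 ?expR_gt0 // exprn_gt0 // ltr0n.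
have count n : (L <= n)%N -> (size (Typ n))%:R * expR (- s * (n - L)%:R) <= C * x ^+ n.
  move=> Ln; apply: le_trans (ler_wpM2r (expR_ge0 _) (eP n)) _.
  rewrite /C -!mulrA ler_wpM2l ?exprn_ge0 // /x -expRM_natl -!expRD ler_expR natrB //.
  by rewrite -/D /gamma; lra.
have [n0 n0P] := exists_nat_ge (C / (eta * (1 - x) * gamma)).
pose N1 := (n0 + N + L)%N.
have tail : C * (x ^+ N1 / (1 - x)) <= eta.
  have x1 : 0 < 1 - x by lra.
  have xN : x ^+ N1 = (expR (N1%:R * gamma))^-1 by rewrite /x -expRM_natl mulrN expRN.
  rewrite mulrA ler_pdivrMr // xN ler_pdivrMr ?expR_gt0 //.
  have ex0 : 0 < eta * (1 - x) by rewrite mulr_gt0.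
  have y0 : C / (eta * (1 - x)) <= N1%:R * gamma.
    rewrite -ler_pdivrMr // -mulrA -invfM; apply: le_trans n0P _.
    by rewrite ler_nat /N1 -addnA leq_addr.
  rewrite -ler_pdivrMl // [leLHS]mulrC; apply: le_trans y0 _.
  by have := expR_ge1Dx (N1%:R * gamma); lra.
pose pick w : Sigma := if pselect (exists y : Sigma, prx y (size w) = w) is left h
  then projT1 (cid h) else ab_point ha hb.
pose lab w : Sigma * nat := (pick w, (size w - L)%N).
pose W := [set w : seq 'I_k | (N1 <= size w)%N && (w \in Typ (size w))].
apply: ge_ereal_inf; exists (\esum_(p in lab @` W) (expR (- s * p.2%:R))%:E)%E.
  exists (lab @` W) => //; split.
  - exact: card_le_trans (card_image_le _ _) (countableP _).
  - move=> _ [w /andP[wN _] <-] /=; move: wN; rewrite /N1; move: (size w) => a; clear; lia.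
  move=> y Gy; have [n N1n nT] := generic_typical r N1 Gy e0.
  exists (lab (prx y n)).
    exists (prx y n) => //; rewrite /W /= size_prx N1n /= mem_filter nT mem_words size_prx.
    exact: eqxx.
  have Ln : (L <= n)%N by apply: leq_trans N1n; rewrite leq_addl.
  apply: (bowen_ball_prefix LP); rewrite /= size_prx subnK // /pick.
  case: pselect => [h|[]]; last by exists y; rewrite size_prx.
  by case: cid => z; rewrite size_prx.
apply: esum_le_bound => F uF FW.
pose M := (\sum_(p <- F) p.2 + L).+1%N.
pose L0 := [seq lab w | w <- flatten [seq Typ n | n <- iota N1 M]].
apply: (@le_trans _ _ (\sum_(p <- L0) expR (- s * p.2%:R))).
  apply: ler_sum_sub => // p pF.
  have [w /andP[wN wT] E] := FW _ pF; apply/mapP; exists w => //.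
  apply/flatten_mapP; exists (size w) => //; rewrite mem_iota wN /=.
  have : (p.2 <= \sum_(p <- F) p.2)%N by rewrite (big_rem p) //= leq_addr.
  rewrite -E /= /M; move: (size w) (bigop _ _ _) => a b; clear; lia.
rewrite big_map big_flatten big_map; apply: le_trans tail.
apply: (@le_trans _ _ (C * \sum_(n <- iota N1 M) x ^+ n)); last first.
  by rewrite ler_wpM2l ?(ltW C0) // sum_geometric_iota.
rewrite mulr_sumr big_seq [leRHS]big_seq; apply: ler_sum => n; rewrite mem_iota => /andP[N1n _].
have Ln : (L <= n)%N by apply: leq_trans N1n; rewrite leq_addl.
apply: le_trans (count n Ln); rewrite -sum1_size natr_sum mulr_suml big_seq [leRHS]big_seq.
by apply: ler_sum => w; rewrite mem_filter mem_words /= => /andP[_ /eqP ->]; rewrite mul1r.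
Qed.

Lemma htop_scale_le r (eps : R) : 0 < eps ->
  (htop_scale d sg (generic_points sg mu) eps <=
   (block_entropy m_ r.+1 - block_entropy m_ r)%:E)%E.
Proof.
move=> eps0; apply/lee_addgt0Pr => e e0; apply: ereal_inf_lbound.
exists (block_entropy m_ r.+1 - block_entropy m_ r + e) => //=.
rewrite /bowen_measure; under eq_fun do rewrite (@premeasure_small r) ?ltrDl //.
exact: lim_cst.
Qed.

End UpperBound.

(** * The lower bound *)

Section Concatenation.
Variable T : Type.
Implicit Types (f : nat -> seq T).

Fixpoint cat_upto f t := if t is t'.+1 then cat_upto f t' ++ f t' else [::].

Lemma size_cat_upto f t : size (cat_upto f t) = (\sum_(i < t) size (f i))%N.
Proof. by elim: t => [|t IH]; rewrite ?big_ord0 // big_ord_recr /= size_cat IH. Qed.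

Lemma take_cat_upto f t i n : (n <= size (cat_upto f t))%N ->
  take n (cat_upto f (t + i)) = take n (cat_upto f t).
Proof.
move=> nt; elim: i => [|i IH]; rewrite ?addn0 // addnS /= takel_cat //.
apply: leq_trans nt _; rewrite !size_cat_upto big_split_ord /=.
exact: leq_addr.
Qed.

End Concatenation.

Section AvoidingBranch.
Variables (R : realType) (T P : eqType).
Variables (Ss : nat -> seq (seq T)) (La : nat -> nat).
Hypotheses (uniq_Ss : forall t, uniq (Ss t)) (Ss_gt0 : forall t, (0 < size (Ss t))%N).
Hypothesis size_Ss : forall t S, S \in Ss t -> size S = La t.
Variables (G : P -> Prop) (u : P -> seq T) (tau : P -> nat) (kap : R).

(** The mass of a node of level [t] under the uniform distribution on the tree with branches
    [Ss]. *)
Definition node_mass t : R := \prod_(i < t) (size (Ss i))%:R^-1.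

Lemma node_mass_gt0 t : 0 < node_mass t.
Proof. by apply: prodr_gt0 => i _; rewrite invr_gt0 ltr0n. Qed.

Lemma node_massS t : node_mass t.+1 = node_mass t / (size (Ss t))%:R.
Proof. by rewrite /node_mass big_ord_recr. Qed.

(* Finite subfamilies stand for the sum over the countable cover. *)
Definition light v (A : R) := forall F, uniq F ->
  (forall p, p \in F -> G p /\ prefix v (u p)) -> \sum_(p <- F) node_mass (tau p) <= A.

(** All elements of [Ss t] have the same length, so the families below different children are
    disjoint and some child carries at most the average mass. *)
Lemma light_child t v A : light v A ->
  exists S, S \in Ss t /\ light (v ++ S) (A / (size (Ss t))%:R).
Proof.
move=> vA; apply: contrapT => /forallNP H; set a := A / _ in H.
have Hx S : exists F, S \in Ss t -> [/\ uniq F,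
    forall p, p \in F -> G p /\ prefix (v ++ S) (u p) & a < \sum_(p <- F) node_mass (tau p)].
  have [St|] := boolP (S \in Ss t); last by exists [::].
  have /not_andP[//|/existsNP[F /not_implyP[uF /not_implyP[FP /negP]]]] := H S.
  by rewrite -ltNge => aF; exists F.
have [Fs FsP] := choice Hx.
have dis S S' p : S \in Ss t -> S' \in Ss t -> p \in Fs S -> p \in Fs S' -> S = S'.
  move=> St S't pS pS'; have [_ /(_ p pS)[_ vS] _] := FsP S St.
  have [_ /(_ p pS')[_ vS'] _] := FsP S' S't.
  move: vS vS'; rewrite !prefixE !size_cat (size_Ss St) (size_Ss S't) => /eqP -> /eqP E.
  by move/eqP: E; rewrite eqseq_cat // eqxx /= => /eqP.
have HL L : uniq L -> {subset L <= Ss t} -> L <> [::] -> exists F, [/\ uniq F,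
    forall p, p \in F -> G p /\ exists2 S, S \in L & p \in Fs S &
    (size L)%:R * a < \sum_(p <- F) node_mass (tau p)].
  elim: L => // S L IH /= /andP[SL uL] sL _.
  have St : S \in Ss t by apply: sL; rewrite mem_head.
  have sL' : {subset L <= Ss t} by move=> S' S'L; apply: sL; rewrite inE S'L orbT.
  have [uF FP aF] := FsP S St.
  have [L0|/eqP L0] := eqVneq L [::].
    exists (Fs S); split => // [p pF|]; last by rewrite L0 mul1r.
    by have [Gp _] := FP p pF; split => //; exists S; rewrite ?mem_head.
  have [F [uF' F'P aF']] := IH uL sL' L0; exists (Fs S ++ F); split.
  - rewrite cat_uniq uF uF' andbT /=; apply/hasPn => p /F'P[_ [S' S'L pS']].
    apply: contra SL => pS; have St' := sL' _ S'L.
    by rewrite (dis S S' p).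
  - move=> p; rewrite mem_cat => /orP[pF|/F'P[Gp [S' S'L pS']]].
      by have [Gp _] := FP p pF; split => //; exists S; rewrite ?mem_head.
    by split => //; exists S'; rewrite // inE S'L orbT.
  by rewrite big_cat /= -natr1 mulrDl mul1r addrC ltrD.
have Ss0 : Ss t <> [::] by move=> E; have := Ss_gt0 t; rewrite E.
have [F [uF FP]] := HL _ (uniq_Ss t) (fun _ => id) Ss0.
rewrite mulrC divfK ?pnatr_eq0 -?lt0n // ltNge vA // => p /FP[Gp [S St pS]].
by split => //; have [_ /(_ p pS)[_ /(prefix_trans (prefix_prefix v S))]] := FsP S St.
Qed.

(** The elements below the current node keep a total mass of at most [kap * node_mass t]. One that
    contains the node of level [tau p] would alone contribute [node_mass (tau p)], which is too
    much. *)
Lemma avoiding_branch : kap < 1 ->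
  (forall F, uniq F -> (forall p, p \in F -> G p) -> \sum_(p <- F) node_mass (tau p) <= kap) ->
  exists f, (forall t, f t \in Ss t) /\ forall p, G p -> ~~ prefix (cat_upto f (tau p)) (u p).
Proof.
move=> kap1 Hkap.
have Hx (tv : nat * seq T) : exists S, light tv.2 (kap * node_mass tv.1) ->
    S \in Ss tv.1 /\ light (tv.2 ++ S) (kap * node_mass tv.1.+1).
  have [/light_child-/(_ tv.1) [S]|nl] := pselect (light tv.2 (kap * node_mass tv.1)).
    by rewrite -mulrA -node_massS; exists S.
  by exists [::].
have [nx nxP] := choice Hx.
pose vv := fix vv t := if t is t'.+1 then vv t' ++ nx (t', vv t') else [::].
have vvE t : cat_upto (fun t => nx (t, vv t)) t = vv t by elim: t => //= t ->.
have lv t : light (vv t) (kap * node_mass t).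
  elim: t => [|t IH]; last exact: (nxP (t, vv t) IH).2.
  by move=> F uF FP; rewrite /node_mass big_ord0 mulr1; apply: Hkap => // p /FP[].
exists (fun t => nx (t, vv t)); split => [t|p Gp]; first exact: (nxP (t, vv t) (lv t)).1.
rewrite vvE; apply/negP => pv; have := lv (tau p) [:: p] isT.
rewrite big_seq1 => /(_ _)h.
have /h : forall p0, p0 \in [:: p] -> G p0 /\ prefix (vv (tau p)) (u p0).
  by move=> p0; rewrite inE => /eqP ->.
by rewrite -ler_pdivrMr ?node_mass_gt0 // divff ?gt_eqF ?node_mass_gt0 // leNgt kap1.
Qed.

End AvoidingBranch.

Lemma block_index (b : nat -> nat) n : b 0%N = 0%N -> (forall t, b t < b t.+1)%N ->
  exists t, (b t <= n < b t.+1)%N.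
Proof.
move=> b0 bS; elim: n => [|n [t /andP[h1 h2]]]; first by exists 0%N; have := bS 0%N;
  rewrite b0 => ->.
have [h|h] := ltnP n.+1 (b t.+1); first by exists t; rewrite h (leqW h1).
by exists t.+1; rewrite h (leq_trans _ (bS _)).
Qed.

Section Stages.
Variable Lam : nat -> nat.

(* The stage grows so slowly that one block of the current stage is short compared
   with all the preceding ones. *)
Fixpoint stage t := if t is t'.+1 then
  if ((stage t').+1 * Lam (stage t').+1 <= t)%N then (stage t').+1 else stage t' else 0%N.

Lemma stage_mul t : (stage t * Lam (stage t) <= t)%N.
Proof. by elim: t => //= t IH; case: ifP => // _; exact: leqW. Qed.

Lemma stage_mono t i : (stage t <= stage (t + i))%N.
Proof.
elim: i => [|i IH]; rewrite ?addn0 // addnS /=; apply: leq_trans IH _.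
by case: ifP.
Qed.

Lemma stage_unbounded J : exists t, (J <= stage t)%N.
Proof.
elim: J => [|J [t Jt]]; first by exists 0%N.
exists (t + J.+1 * Lam J.+1).+1 => /=.
have := leq_trans Jt (stage_mono t (J.+1 * Lam J.+1)).
set t' := (t + _)%N; rewrite leq_eqVlt => /orP[/eqP <-|].
  by rewrite leqW // leq_addl.
by case: ifP => // _ h; exact: leqW.
Qed.

End Stages.

Lemma frequency_step (R : realDomainType) (o1 o2 o3 l L B p q e : R) :
  l <= e * L -> o1 <= o3 + o2 + l -> o3 + o2 <= o1 -> q * L <= e * L ->
  `|o2 - L * p| <= q * L -> `|o1 - (B + L) * p| <= `|o3 - B * p| + 2 * e * L.
Proof.
have := ler_norm (o3 - B * p); have := ler_norm (- (o3 - B * p)); rewrite normrN.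
move: `|o3 - B * p| => A h1 h2 h3 h4 h5 h6; rewrite !ler_norml => /andP[h7 h8].
by apply/andP; split; lra.
Qed.

Lemma frequency_end (R : realDomainType) (o1 o2 o3 o4 l L n B p e A : R) :
  0 < e -> 0 <= p -> p <= 1 -> 0 <= l -> 0 <= o1 -> B <= n -> n <= B + L ->
  o4 <= o2 + l -> o2 <= o4 + l -> o1 <= n - B ->
  o2 <= o3 + o1 + l -> o3 + o1 <= o2 -> L <= e * B ->
  `|o3 - B * p| <= A + 2 * e * B -> `|o4 - n * p| <= 4 * e * n + (A + 2 * l).
Proof.
move=> e0 p0 p1 l0 o0 Bn nB h1 h2 h3 h4 h5 LB hA.
have B0 : e * B <= e * n by rewrite ler_pM2l.
have /andP[hm1 hm2] : 0 <= (n - B) * p <= n - B by apply/andP; split; nra.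
move: hm1 hm2 hA; rewrite mulrBl !ler_norml => hm1 hm2 /andP[h6 h7].
by apply/andP; split; lra.
Qed.

Section LowerBound.
Context {R : realType} {alpha beta : R}.
Context {ha : 0 <= alpha < 1} {hb : 2 < beta}.
Local Notation k := (ab_k alpha beta).
Local Notation Sigma := (ab_space ha hb).
Local Notation sg := (ab_sigma ha hb).
Implicit Types (x y : Sigma) (u v g w : seq 'I_k).
Variables (mu : probability (borel Sigma) R) (hmu : invariant_measure sg mu).
Local Notation m g := (mass mu (cyl (ha := ha) (hb := hb) g)).
Local Notation m_ := (fun g => m g).

Lemma concat_point (f : nat -> seq 'I_k) :
  (forall t, full alpha beta (f t)) -> (forall t, (0 < size (f t))%N) ->
  exists x, forall t, prx x (size (cat_upto f t)) = cat_upto f t.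
Proof.
move=> ff f0; have szge t : (t <= size (cat_upto f t))%N.
  by elim: t => //= t IH; rewrite size_cat -[t.+1]addn1 leq_add.
pose c0 := (val (ab_point ha hb) : fullshift k) 0%N.
pose w : fullshift k := fun i => nth c0 (cat_upto f i.+1) i.
have wE t n : (n <= size (cat_upto f t))%N -> pre w n = take n (cat_upto f t).
  move=> nt; apply: (@eq_from_nth _ c0) => [|i]; rewrite size_pre ?size_takel // => ni.
  rewrite nth_mkseq // nth_take // /w.
  have [it|ti] := leqP i.+1 t.
    by rewrite -(subnKC it) -[LHS](nth_take _ (ltnSn i)) -[RHS](nth_take _ (ltnSn i)) take_cat_upto.
  rewrite -(subnKC (ltnW ti)) -[LHS](nth_take _ (ltnSn i)) -[RHS](nth_take _ (ltnSn i)).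
  by rewrite take_cat_upto // (leq_trans ni).
have cw : @ab_shift R alpha beta w.
  apply: (full_in_shift ha hb) => n; exists (drop n (cat_upto f n)).
  rewrite (wE n) // cat_take_drop; elim: n => [|n IH] //.
  exact: full_cat.
by exists (SigSub (mem_set cw)) => t; rewrite /prx /= (wE t) // take_size.
Qed.

Variables (Lam : nat -> nat) (SS : nat -> seq (seq 'I_k)).
(** Makes junction errors negligible: for [size g <= j] and [1 <= e * j], [size g] is at most
    [e * Lam j]. *)
Hypothesis Lam_gt : forall j, (j * j < Lam j)%N.
Hypothesis size_SS : forall j u, u \in SS j -> size u = Lam j.
Hypothesis freq_SS : forall j u g, u \in SS j -> g <> [::] -> (size g <= j)%N ->
  `|(occ g u)%:R - (Lam j)%:R * m g| <= j.+1%:R^-1 * (Lam j)%:R.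
Variables (f : nat -> seq 'I_k).
Hypothesis fS : forall t, f t \in SS (stage Lam t).
Local Notation b t := (size (cat_upto f t)).

Lemma block_ge t : (t <= b t)%N.
Proof.
elim: t => //= t IH; rewrite size_cat -[t.+1]addn1 leq_add // (size_SS (fS t)).
exact: leq_trans (Lam_gt _).
Qed.

Lemma blockS t : b t.+1 = (b t + Lam (stage Lam t))%N.
Proof. by rewrite /= size_cat (size_SS (fS t)). Qed.

Lemma block_mono t i : (b t <= b (t + i))%N.
Proof. by elim: i => [|i IH]; rewrite ?addn0 // addnS blockS (leq_trans IH) ?leq_addr. Qed.

Lemma block_at n : exists t, (b t <= n < b t.+1)%N.
Proof.
apply: block_index => // t; rewrite blockS -[ltnLHS]addn0 ltn_add2l.
exact: leq_ltn_trans (Lam_gt _).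
Qed.

Lemma block_at_ge t0 t n : (b t0 <= n < b t.+1)%N -> (t0 <= t)%N.
Proof.
move=> /andP[h1 h2]; rewrite leqNgt; apply/negP => tt0.
have := block_mono t.+1 (t0 - t.+1); rewrite subnKC // => h3.
by have := leq_trans h2 (leq_trans h3 h1); rewrite ltnn.
Qed.

Lemma block_small t : (stage Lam t * Lam (stage Lam t) <= b t)%N.
Proof. exact: leq_trans (stage_mul _ _) (block_ge t). Qed.

Lemma concat_frequency x g (e : R) : (forall t, prx x (b t) = cat_upto f t) ->
  g <> [::] -> 0 < e -> exists n0 (C : R), forall n, (n0 <= n)%N ->
  `|(visits g x n)%:R - n%:R * m g| <= 4 * e * n%:R + C.
Proof.
move=> xf g0 e0; have m0 := mass_cyl_ge0 mu g; have m1 := mass_cyl_le1 mu g.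
have [J0 J0P] := exists_nat_ge (1 / e); pose J := (maxn J0 (size g)).
have JP : 1 <= e * J%:R.
  rewrite mulrC -ler_pdivrMr //; apply: le_trans J0P _; by rewrite ler_nat leq_maxl.
have [t1 t1P] := stage_unbounded Lam J.
have late t : (t1 <= t)%N -> let j := stage Lam t in
    [/\ (size g <= j)%N, j.+1%:R^-1 <= e, (size g)%:R <= e * (Lam j)%:R &
        (Lam j)%:R <= e * (b t)%:R].
  move=> t1t j; have Jj : (J <= j)%N.
    by rewrite /j -(subnKC t1t); exact: leq_trans t1P (stage_mono _ _ _).
  have gj : (size g <= j)%N by apply: leq_trans Jj; rewrite leq_maxr.
  have ej : 1 <= e * j%:R by apply: le_trans JP _; rewrite ler_pM2l // ler_nat.
  have L0 : 0 <= (Lam j)%:R :> R by rewrite ler0n.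
  split => //.
  - rewrite -[leLHS]mul1r ler_pdivrMr ?ltr0n //; apply: le_trans ej _.
    by rewrite ler_pM2l // ler_nat.
  - have : (j * size g <= Lam j)%N by apply: leq_trans (ltnW (Lam_gt j)); rewrite leq_mul2l gj orbT.
    rewrite -(ler_nat R) natrM; have : 0 <= (size g)%:R :> R by rewrite ler0n.
    by move: ((size g)%:R : R) => G *; nra.
  have := block_small t; rewrite -/j -(ler_nat R) natrM.
  by move: ((size _)%:R : R) => G; nra.
pose D t : R := `|(occ g (cat_upto f t))%:R - (b t)%:R * m g|.
have DS t : (t1 <= t)%N -> D t.+1 <= D t + 2 * e * (Lam (stage Lam t))%:R.
  move=> /late; set j := stage Lam t => -[gj je ge _].
  have := freq_SS (fS t) g0 gj; rewrite -/j.
  have : j.+1%:R^-1 * (Lam j)%:R <= e * (Lam j)%:R by rewrite ler_wpM2r ?ler0n.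
  rewrite /D blockS -/j natrD /=.
  have := occ_cat_ge g (cat_upto f t) (f t); have := occ_cat_le g (cat_upto f t) (f t).
  rewrite -!(ler_nat R) !natrD.
  by move=> h1 h2 h3 h4; exact: (@frequency_step R _ _ _ _ _ _ _ _ _ ge h1 h2 h3 h4).
have Dt i : D (t1 + i)%N <= D t1 + 2 * e * (b (t1 + i))%:R.
  elim: i => [|i IH]; first by rewrite addn0 lerDl !mulr_ge0 // ltW.
  rewrite addnS blockS natrD; have := DS (t1 + i)%N (leq_addr _ _); move: IH.
  by lra.
exists (b t1), (D t1 + 2 * (size g)%:R) => n n1.
have [T /andP[Tn nT]] := block_at n.
have t1T : (t1 <= T)%N by apply: (@block_at_ge t1 T n); rewrite n1.
have := Dt (T - t1)%N; rewrite subnKC //; have [_ _ _] := late T t1T.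
move: nT; rewrite blockS; set j := stage Lam T => nT LT.
have E : prx x n = cat_upto f T ++ drop (b T) (prx x n).
  by rewrite -{1}(cat_take_drop (b T) (prx x n)) prx_take // xf.
have := occ_cat_ge g (cat_upto f T) (drop (b T) (prx x n)).
have := occ_cat_le g (cat_upto f T) (drop (b T) (prx x n)).
have := occ_size g (drop (b T) (prx x n)).
have /andP[] := near_visits x n g0; rewrite -E size_drop size_prx /D.
rewrite -!(ler_nat R) !natrD natrB //.
have : n%:R <= (b T)%:R + (Lam j)%:R :> R by rewrite -natrD ler_nat ltnW.
have : (b T)%:R <= n%:R :> R by rewrite ler_nat.
have : 0 <= (occ g (drop (b T) (prx x n)))%:R :> R by rewrite ler0n.
have : 0 <= (size g)%:R :> R by rewrite ler0n.
move=> h1 h2 h3 h4 h5 h6 h7 h8 h9 h10.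
exact: (@frequency_end R _ _ _ _ _ _ _ _ _ _ _ e0 m0 m1 h1 h2 h3 h4 h5 h6 h7 h8 h9 LT h10).
Qed.

Lemma concat_generic x : (forall t, prx x (b t) = cat_upto f t) -> generic_points sg mu x.
Proof.
move=> xf; apply: visits_generic => g; have [->|/eqP g0] := eqVneq g [::].
  have -> : cyl [::] = setT :> set (borel Sigma) by apply/seteqP; split.
  rewrite mass_setT; apply/cvgrPdist_le => e e0; exists 1%N => // n /= n1.
  rewrite (_ : visits _ _ _ = n) ?divff ?subrr ?normr0 ?ltW // ?pnatr_eq0 -?lt0n //.
  by rewrite /visits /= sum1_card card_ord.
apply/cvgrPdist_le => e e0; have e5 : 0 < e / 5 by lra.
have [n0 [C H]] := concat_frequency xf g0 e5.
have [n1 n1P] := exists_nat_ge (C / (e / 5)).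
exists (maxn n0 n1).+1 => // n /= nn; have n0n : (n0 <= n)%N.
  by apply: leq_trans (leq_maxl n0 n1) (ltnW nn).
have n1n : (n1 <= n)%N by apply: leq_trans (leq_maxr n0 n1) (ltnW nn).
have n_gt0 : 0 < n%:R :> R by rewrite ltr0n; apply: leq_ltn_trans nn.
have Cn : C <= n%:R * (e / 5).
  by rewrite -ler_pdivrMr //; apply: le_trans n1P _; rewrite ler_nat.
rewrite distrC -(ler_pM2r n_gt0).
rewrite -[X in _ * X <= _](gtr0_norm n_gt0) -normrM mulrBl divfK ?gt_eqF //.
by rewrite [m g * _]mulrC; apply: le_trans (H n n0n) _; lra.
Qed.

End LowerBound.

(** * Entropy of the set of generic points *)

Section SaturatedShift.
Context {R : realType} {alpha beta : R}.
Context {ha : 0 <= alpha < 1} {hb : 2 < beta}.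
Local Notation k := (ab_k alpha beta).
Local Notation Sigma := (ab_space ha hb).
Local Notation sg := (ab_sigma ha hb).
Implicit Types (x y : Sigma) (u v g w : seq 'I_k).
Variables (mu : probability (borel Sigma) R) (hmu : invariant_measure sg mu).
Variables (d : Sigma -> Sigma -> R).
Local Notation m g := (mass mu (cyl (ha := ha) (hb := hb) g)).
Local Notation m_ := (fun g => m g).

Lemma bowen_premeasure_mono (Z : set Sigma) (s eps : R) :
  {homo (fun N => bowen_premeasure d sg Z s N eps) : n1 n2 / (n1 <= n2)%N >-> (n1 <= n2)%E}.
Proof.
move=> n1 n2 n12; apply: ereal_inf_le_tmp => _ [G [cG GN ZG] <-]; exists G => //.
by split => // p Gp; exact: leq_trans (GN p Gp).
Qed.

Lemma bowen_measure0 (Z : set Sigma) (s eps : R) N :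
  bowen_measure d sg Z s eps = 0%E -> (bowen_premeasure d sg Z s N eps <= 0)%E.
Proof.
have /ereal_nondecreasing_cvgn/cvg_lim := @bowen_premeasure_mono Z s eps.
rewrite /bowen_measure => -> // <-; apply: ereal_sup_ubound; by exists N.
Qed.

Lemma bowen_ball_letters (eps : R) x y n :
  (forall x y, d x y <= eps -> prx x 1 = prx y 1) ->
  bowen_ball d sg n x eps y -> prx x n = prx y n.
Proof.
move=> H xy; apply/pre_eqP => i /xy/H; rewrite /prx /pre /= => -[].
by rewrite !val_iter_sigma addn0.
Qed.

Variable c : R.
Hypothesis entropy_ge : forall N0, exists2 N, (N0 <= N)%N & N%:R * c <= block_entropy m_ N.

Lemma block_family (delta : R) : 0 < delta -> exists (Lam : nat -> nat) (SS : nat -> seq (seq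
  'I_k)), forall j,
  [/\ (j * j < Lam j)%N, uniq (SS j),
      forall u, u \in SS j -> full alpha beta u /\ size u = Lam j,
      forall u g, u \in SS j -> g <> [::] -> (size g <= j)%N ->
        `|(occ g u)%:R - (Lam j)%:R * m g| <= j.+1%:R^-1 * (Lam j)%:R &
      expR ((Lam j)%:R * (c - delta)) <= (size (SS j))%:R].
Proof.
move=> delta0.
have H j : exists LS : nat * seq (seq 'I_k), [/\ (j * j < LS.1)%N, uniq LS.2,
      forall u, u \in LS.2 -> full alpha beta u /\ size u = LS.1,
      forall u g, u \in LS.2 -> g <> [::] -> (size g <= j)%N ->
        `|(occ g u)%:R - LS.1%:R * m g| <= j.+1%:R^-1 * LS.1%:R &
      expR (LS.1%:R * (c - delta)) <= (size LS.2)%:R].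
  pose e : R := Num.min delta j.+1%:R^-1.
  have e0 : 0 < e by rewrite lt_min delta0 invr_gt0 ltr0n.
  have [|N0|La [S [uS Lj fS freq card]]] :=
    @superblocks R k alpha beta (ab_params ha hb) c m_ _ _ e j (j * j).+1 e0.
  - by move=> g; rewrite mass_cyl_ge0 mass_cyl_le1.
  - have [N N0N HN] := entropy_ge N0; exists N, (fun w : N.-tuple 'I_k => m w).
    by split => //; exact: invariant_source.
  exists (La, S); split => //= [u g uS' g0 gj|].
    apply: le_trans (freq u g uS' g0 gj) _.
    by rewrite ler_wpM2r // ge_min lexx orbT.
  by apply: le_trans card; rewrite ler_expR ler_wpM2l // lerB // ge_min lexx.
have [LS LSP] := choice H.
by exists (fun j => (LS j).1), (fun j => (LS j).2).
Qed.

(** If [s < c] had Bowen measure 0, there would be a cover of weight below 1/2 by balls of large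
    order. A ball of order [n] fixes [n] letters and weighs at least the mass of the node at the
    last block boundary up to [n], so [avoiding_branch] yields a generic point outside the cover. *)
Lemma htop_scale_ge (eps : R) : (forall x y, d x y <= eps -> prx x 1 = prx y 1) ->
  (c%:E <= htop_scale d sg (generic_points sg mu) eps)%E.
Proof.
move=> exps; apply: le_ereal_inf_tmp => _ [s /= s0 <-]; rewrite lee_fin leNgt; apply/negP => sc.
pose delta := (c - s) / 2; have delta0 : 0 < delta by rewrite /delta; lra.
have [Lam [SS SSP]] := block_family delta0.
pose Ss t := SS (stage Lam t); pose La t := Lam (stage Lam t).
have Ss_gt0 t : (0 < size (Ss t))%N.
  have [_ _ _ _ h] := SSP (stage Lam t); rewrite -(ltr0n R).
  by apply: lt_le_trans h; exact: expR_gt0.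
have szS t u : u \in Ss t -> size u = La t.
  by have [_ _ h _ _] := SSP (stage Lam t) => /h[].
have Lam_gt j : (j * j < Lam j)%N by have [] := SSP j.
have sizeS j u : u \in SS j -> size u = Lam j by have [_ _ h _ _] := SSP j => /h[].
pose b t := (\sum_(i < t) La i)%N.
have bS t : b t.+1 = (b t + La t)%N by rewrite /b big_ord_recr.
have bL t : (b t < b t.+1)%N.
  by rewrite bS -[ltnLHS]addn0 ltn_add2l; exact: leq_ltn_trans (Lam_gt _).
have b_ge t : (t <= b t)%N.
  by elim: t => // t IH; exact: leq_ltn_trans IH (bL t).
have b_mono t i : (b t <= b (t + i))%N.
  by elim: i => [|i IH]; rewrite ?addn0 // addnS (leq_trans IH) // ltnW.
have [J JP] := exists_nat_ge (`|s| / delta); have [t0 t0P] := stage_unbounded Lam J.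
have bi n : exists t, (b t <= n < b t.+1)%N.
  by apply: block_index => //; rewrite /b big_ord0.
have [tau tauP] := choice bi.
have node_le t : node_mass R Ss t <= expR (- (c - delta) * (b t)%:R).
  elim: t => [|t IH]; first by rewrite /node_mass /b !big_ord0 mulr0 expR0.
  rewrite node_massS bS natrD mulrDr expRD.
  apply: ler_pM => //; [by rewrite ltW // node_mass_gt0|].
  rewrite mulNr expRN lef_pV2 ?posrE ?ltr0n ?expR_gt0 // mulrC.
  by have [_ _ _ _] := SSP (stage Lam t).
(* [n] exceeds the boundary [b T] by less than one block. This changes the exponent by at most
   [|s| * La T], which [delta * b T] absorbs from stage [J] on. *)
have node_le_s n : (b t0 <= n)%N -> node_mass R Ss (tau n) <= expR (- s * n%:R).
  move=> nt0; apply: le_trans (node_le _) _; rewrite ler_expR.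
  have /andP[T1 T2] := tauP n; set T := tau n in T1 T2 *.
  have t0T : (t0 <= T)%N.
    rewrite leqNgt; apply/negP => Tt0; have := b_mono T.+1 (t0 - T.+1)%N; rewrite subnKC // => h.
    by have := leq_trans T2 (leq_trans h nt0); rewrite ltnn.
  have Jst : (J <= stage Lam T)%N.
    by rewrite -(subnKC t0T); exact: leq_trans t0P (stage_mono _ _ _).
  have : (J * La T <= b T)%N.
    by apply: leq_trans (leq_trans (stage_mul Lam T) (b_ge T)); rewrite leq_mul2r Jst orbT.
  move: T2 JP; rewrite bS ler_pdivrMr // => /ltnW; rewrite -!(ler_nat R) natrD natrM.
  move: T1; rewrite -(ler_nat R); have : 0 <= (La T)%:R :> R by rewrite ler0n.
  have := ler_norm s; have := ler_norm (- s); rewrite normrN.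
  rewrite (_ : c - delta = s + delta); last by rewrite /delta; lra.
  move: ((La T)%:R : R) ((b T)%:R : R) (n%:R : R) (J%:R : R) `|s| => L B nn j a.
  move=> h1 h2 L0 h3 h4 h5 h6.
  have : a * L <= delta * B by nra.
  have : - s * (nn - B) >= - (a * L) by nra.
  by nra.
have : (bowen_premeasure d sg (generic_points sg mu) s (b t0) eps < (1 / 2)%:E)%E.
  by apply: le_lt_trans (bowen_measure0 _ s0) _; rewrite lte_fin; lra.
move=> /ereal_inf_lt[_ [G0 [_ GN Gcov] <-] Gsum].
have [||F uF FG|f [fS fN]] := @avoiding_branch R 'I_k (Sigma * nat)%type Ss La _ Ss_gt0 szS
    (fun p => G0 p) (fun p => prx p.1 p.2) (fun p => tau p.2) (1 / 2).
- by move=> t; have [] := SSP (stage Lam t).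
- by lra.
- rewrite -lee_fin; apply: le_trans (ltW Gsum).
  apply: (@le_trans _ _ (\sum_(p <- F) expR (- s * p.2%:R))%:E).
    rewrite lee_fin big_seq [leRHS]big_seq; apply: ler_sum => p pF.
    by apply: node_le_s; apply: GN; exact: FG.
  apply: ereal_sup_ubound; exists [set` F].
    by split; [exact: finite_seq|exact: FG].
  by rewrite -fsbig_seq // sumEFin.
have ff t : full alpha beta (f t) by have [_ _ h _ _] := SSP (stage Lam t); have [] := h _ (fS t).
have f0 t : (0 < size (f t))%N by rewrite (szS _ _ (fS t)); exact: leq_ltn_trans (Lam_gt _).
have [x xP] := concat_point (ha := ha) (hb := hb) ff f0.
have Gx : generic_points sg mu x.
  have freq j : forall u g, u \in SS j -> g <> [::] -> (size g <= j)%N ->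
    `|(occ g u)%:R - (Lam j)%:R * m g| <= j.+1%:R^-1 * (Lam j)%:R by have [] := SSP j.
  have h1 := concat_generic Lam_gt sizeS freq; have h2 := h1 f fS; have h3 := h2 x xP; exact: h3.
have [[y n] Gy /(bowen_ball_letters exps) /= E] := Gcov _ Gx.
have /negP := fN _ Gy; apply; rewrite /= E.
have /andP[T1 _] := tauP n.
have bE t : b t = size (cat_upto f t).
  by rewrite size_cat_upto; apply: eq_bigr => i _; rewrite (szS _ _ (fS i)).
rewrite bE in T1; rewrite -xP -(prx_take x T1); exact: prefix_take.
Qed.

Lemma block_entropy_steps (q : R) n :
  (forall r, q <= block_entropy m_ r.+1 - block_entropy m_ r) -> n%:R * q <= block_entropy m_ n.
Proof.
move=> H; elim: n => [|n IH].
  by rewrite mul0r /block_entropy big_seq1 (_ : m [::] = 1) ?ln1 ?mulr0 // -(mass_setT mu);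
    congr (mass _ _); apply/seteqP.
by have := H n; rewrite -natr1 mulrDl mul1r; lra.
Qed.

End SaturatedShift.

(** The limit of [H n / n] comes without subadditivity: [X] is at most every difference
    [H r.+1 - H r], hence at most every [H n / n], and at least every [c] with [N * c <= H N] for
    arbitrarily large [N]. *)
Lemma htop_scale_entropy (R : realType) (alpha beta : R)
    (ha : 0 <= alpha < 1) (hb : 2 < beta)
    (d : ab_space ha hb -> ab_space ha hb -> R) (mu : probability (borel (ab_space ha hb)) R)
    (eps : R) :
  compatible_metric d -> invariant_measure (ab_sigma ha hb) mu -> 0 < eps ->
  (forall x y, d x y <= eps -> prx x 1 = prx y 1) ->
  htop_scale d (ab_sigma ha hb) (generic_points (ab_sigma ha hb) mu) eps = (metric_entropy mu)%:E.
Proof.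
move=> hd hmu eps0 exps; set X := htop_scale _ _ _ _.
pose H := block_entropy (fun g => mass mu (cyl (ha := ha) (hb := hb) g)).
have XU r : (X <= (H r.+1 - H r)%:E)%E := htop_scale_le hmu hd r eps0.
have XL (c : R) : (forall N0, exists2 N, (N0 <= N)%N & N%:R * c <= H N) -> (c%:E <= X)%E.
  by move=> hc; exact: (htop_scale_ge hmu hc exps).
have H0 n : 0 <= H n.
  rewrite /H /block_entropy sumr_ge0 // => w _; rewrite mulNr -mulrN mulr_ge0 ?mass_cyl_ge0 //.
  by rewrite oppr_ge0 ln_le0 // mass_cyl_le1.
have X0 : (0%:E <= X)%E by apply: XL => N; exists N => //; rewrite mulr0 H0.
have [q XE] : exists q, X = q%:E.
  exists (fine X); rewrite fineK // ge0_fin_numE //.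
  exact: le_lt_trans (XU 0%N) (ltry _).
rewrite XE in XU XL X0 *; congr EFin; rewrite metric_entropyE; apply/esym/cvg_lim => //.
apply/cvgrPdist_le => e e0.
have [N0 HN0] : exists N0, forall N, (N0 <= N)%N -> H N < N%:R * (q + e).
  apply: contrapT => nH; suff : (q + e <= q) by lra.
  rewrite -lee_fin; apply: XL => N0; have /existsNP[N /not_implyP[NN0 /negP]] := (forallNP _).2
    nH N0.
  by rewrite -leNgt; exists N.
exists N0.+1 => // n /= nN0; have n0 : 0 < n%:R :> R by rewrite ltr0n; case: n nN0.
have h1 := HN0 n (ltnW nN0).
have h2 : n%:R * q <= H n by apply: block_entropy_steps => r; rewrite -lee_fin; exact: XU.
rewrite -/(H n) ler_norml; apply/andP; split.
  rewrite lerBrDr -lerBrDl opprK mulrC ler_pdivrMr // mulrC; lra.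
rewrite lerBlDr addrC -lerBlDr mulrC ler_pdivlMr // mulrC mulrBr.
have : 0 <= n%:R * e by rewrite mulr_ge0 // ltW.
lra.
Qed.

Theorem theoremA (R : realType) (alpha beta : R)
    (ha : 0 <= alpha < 1) (hb : 2 < beta)
    (d : ab_space ha hb -> ab_space ha hb -> R) (hd : compatible_metric d)
    (mu : probability (borel (ab_space ha hb)) R)
    (hmu : invariant_measure (ab_sigma ha hb) mu) :
  htop d (ab_sigma ha hb) (generic_points (ab_sigma ha hb) mu) =
  (metric_entropy mu)%:E.
Proof.
have [e0 e0_gt0 e0P] := metric_expansive hd.
(* The value is already attained at every scale below an expansivity constant, so the limit is that
   of an eventually constant function. *)
rewrite /htop; apply: cvg_lim => //; apply: cvg_near_cst.
near=> eps; apply: htop_scale_entropy => //.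
by move=> x y xy; apply: e0P; apply: le_trans xy _; near: eps; exact: nbhs_right_le.
Unshelve. all: by end_near.
Qed.
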